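(* Let $\Sigma$ be a rational pointed fan in $\mathbb{R}^d$ with face poset $P$, let $K$ be a field, and let $\mathfrak{m}$ be the graded maximal ideal of the face ring $K[\Sigma]$. Then for every $i$ there is an isomorphism of $\mathbb{Z}^d$-graded $K$-modules $$H^i_{\mathfrak m}(K[\Sigma])\cong\bigoplus_{C\in P}\widetilde H^{\,i-\dim(C)-1}((C,1_{\widehat P});K)\otimes_K H^{\dim(C)}_{\mathfrak m}(K[C]),$$ where the reduced cohomology groups are placed in degree $0$.
   Context: A rational pointed fan $\Sigma$ in $\mathbb{R}^d$ is a finite collection of rational pointed cones in $\mathbb{R}^d$ such that for $C'\subseteq C$ with $C\in\Sigma$, $C'$ is a face of $C$ if and only if $C'\in\Sigma$, and such that if $C,C'\in\Sigma$ then $C\cap C'$ is a common face of $C$ and $C'$. Its face poset $P$ is the set of cones of $\Sigma$ ordered by inclusion. The face ring $K[\Sigma]$ has $K$-basis $x^a$, for $a\in\mathbb{Z}^d\cap\bigcup_{C\in\Sigma}C$, with $x^ax^b=x^{a+b}$ if $a$ and $b$ lie in a common cone of $\Sigma$ and $x^ax^b=0$ otherwise; it is $\mathbb{Z}^d$-graded with $x^a$ in degree $a$, Noetherian, and has a unique graded maximal ideal $\mathfrak m$ (spanned by the $x^a$ with $a\ne0$). $K[C]=K[C\cap\mathbb{Z}^d]$ is the monoid algebra of $C\cap\mathbb{Z}^d$, a $K[\Sigma]$-module via the surjection $K[\Sigma]\to K[C]$ with $x^a\mapsto x^a$ if $a\in C$ and $x^a\mapsto0$ otherwise. $H^i_{\mathfrak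 m}$ denotes local cohomology over $K[\Sigma]$. $(C,1_{\widehat P})=\{D\in P: C\subsetneq D\}$ as a sub-poset of $P$. $\widetilde H^{j}(Q;K)$ for a poset $Q$ is the reduced simplicial cohomology of its order complex (simplicial complex of finite chains); for $Q=\emptyset$ it is $K$ for $j=-1$ and $0$ otherwise. *)

(* Defs.v *)
From HB Require Import structures.
From mathcomp Require Import all_boot all_order all_algebra finmap.
From mathcomp Require Import boolp classical_sets reals.
From mathcomp Require Import monalg zify.

Set Implicit Arguments.
Unset Strict Implicit.
Unset Printing Implicit Defensive.

Import Order.TTheory GRing.Theory Num.Theory.

Local Open Scope classical_set_scope.
Local Open Scope ring_scope.

#[local] Obligation Tactic := idtac.

Record subspace (K : fieldType) (V : lmodType K) := Subspace {
  subspace_set :> V -> Prop;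
  subspace0 : subspace_set 0;
  subspaceD : forall x y, subspace_set x -> subspace_set y ->
    subspace_set (x + y);
  subspaceZ : forall a x, subspace_set x -> subspace_set (a *: x) }.

Section Subspace.
Variables (K : fieldType) (V : lmodType K) (W : subspace V).

Definition subspace_pred : {pred V} := fun x => `[< W x >].

Fact subspace_pred_closed : submod_closed subspace_pred.
Proof.
split=> [|a x y /asboolP Wx /asboolP Wy]; apply/asboolP.
  exact: subspace0.
by apply: subspaceD => //; exact: subspaceZ.
Qed.

HB.instance Definition _ :=
  GRing.isSubmodClosed.Build K V subspace_pred subspace_pred_closed.

Definition subspace_type := {x : V | x \in subspace_pred}.

HB.instance Definition _ := Choice.on subspace_type.
HB.instance Definition _ := SubChoice.on subspace_type.
HB.instance Definition _ := [SubChoice_isSubLmodule of subspace_type by <:].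

Definition quotient_space : Type := Quotient.quot subspace_pred.
HB.instance Definition _ := GRing.Zmodule.on quotient_space.

Definition quotient_pi (x : V) : quotient_space :=
  \pi_(Quotient.quot subspace_pred)%qT x.

Definition quotient_repr (x : quotient_space) : V :=
  @generic_quotient.repr _ (Quotient.quot subspace_pred) x.

Lemma quotient_reprK : cancel quotient_repr quotient_pi.
Proof. by move=> x; exact: reprK. Qed.

Lemma quotient_piD x y : quotient_pi (x + y) = quotient_pi x + quotient_pi y.
Proof. exact: Quotient.pi_add. Qed.

Lemma quotient_piP x y : quotient_pi x = quotient_pi y <-> W (x - y).
Proof.
have -> : (quotient_pi x = quotient_pi y) =
          (x = y %[mod Quotient.quot subspace_pred])%qT by [].
by split=> [/eqP|Wxy]; last apply/eqP; rewrite -Quotient.idealrBE;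
  [move/asboolP|apply/asboolP].
Qed.

Definition quotient_scale (a : K) (x : quotient_space) : quotient_space :=
  quotient_pi (a *: quotient_repr x).

Lemma quotient_piZ a x : quotient_scale a (quotient_pi x) = quotient_pi (a *: x).
Proof.
apply/quotient_piP; rewrite -scalerBr; apply: subspaceZ.
by apply/quotient_piP; rewrite quotient_reprK.
Qed.

Fact quotient_scaleA a b x :
  quotient_scale a (quotient_scale b x) = quotient_scale (a * b) x.
Proof. by rewrite -[x]quotient_reprK !quotient_piZ scalerA. Qed.

Fact quotient_scale1 : left_id 1 quotient_scale.
Proof. by move=> x; rewrite -[x]quotient_reprK quotient_piZ scale1r. Qed.

Fact quotient_scaleDr : right_distributive quotient_scale +%R.
Proof.
move=> a x y; rewrite -[x]quotient_reprK -[y]quotient_reprK -quotient_piD.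
by rewrite !quotient_piZ scalerDr quotient_piD.
Qed.

Fact quotient_scaleDl x : {morph quotient_scale^~ x : a b / a + b}.
Proof.
move=> a b; rewrite -[x]quotient_reprK !quotient_piZ scalerDl.
exact: quotient_piD.
Qed.

HB.instance Definition _ := GRing.Zmodule_isLmodule.Build K quotient_space
  quotient_scaleA quotient_scale1 quotient_scaleDr quotient_scaleDl.
End Subspace.

Program Definition subspace_span (K : fieldType) (V : lmodType K) (S : set V) :
  subspace V := {| subspace_set x := forall W : subspace V, S `<=` W -> W x |}.
Next Obligation. by move=> K V S W _; exact: subspace0. Qed.
Next Obligation.
by move=> K V S x y Sx Sy W SW; apply: subspaceD; [exact: Sx|exact: Sy].
Qed.
Next Obligation. by move=> K V S a x Sx W SW; apply: subspaceZ; exact: Sx. Qed.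

(* U (x) V is the space with basis the symbols << (u, v) >>, modulo
   bilinearity. *)
Section Tensor.
Variables (K : fieldType) (U V : lmodType K).

Local Notation sym u v := (<< (u, v) >> : {malg K[(U * V)%type]}).

Variant tensor_relation : set {malg K[(U * V)%type]} :=
| TensorDl u1 u2 v : tensor_relation (sym (u1 + u2) v - sym u1 v - sym u2 v)
| TensorDr u v1 v2 : tensor_relation (sym u (v1 + v2) - sym u v1 - sym u v2)
| TensorZl a u v : tensor_relation (sym (a *: u) v - a *: sym u v)
| TensorZr a u v : tensor_relation (sym u (a *: v) - a *: sym u v).

Definition tensor : lmodType K :=
  quotient_space (subspace_span tensor_relation).
End Tensor.

Section DirectSum.
Variables (K : fieldType) (I : finType) (V : I -> lmodType K).

(* As I is finite, families indexed by I form the direct sum. *)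
Definition dsum : Type := {dffun forall i, V i}.
HB.instance Definition _ := Choice.on dsum.

Implicit Types f g h : dsum.

Definition dsum_zero : dsum := [ffun i => 0].
Definition dsum_opp f : dsum := [ffun i => - f i].
Definition dsum_add f g : dsum := [ffun i => f i + g i].
Definition dsum_scale (a : K) f : dsum := [ffun i => a *: f i].

Fact dsum_addA : associative dsum_add.
Proof. by move=> f g h; apply/ffunP=> i; rewrite !ffunE addrA. Qed.
Fact dsum_addC : commutative dsum_add.
Proof. by move=> f g; apply/ffunP=> i; rewrite !ffunE addrC. Qed.
Fact dsum_add0 : left_id dsum_zero dsum_add.
Proof. by move=> f; apply/ffunP=> i; rewrite !ffunE add0r. Qed.
Fact dsum_addN : left_inverse dsum_zero dsum_opp dsum_add.
Proof. by move=> f; apply/ffunP=> i; rewrite !ffunE addNr. Qed.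
HB.instance Definition _ :=
  GRing.isZmodule.Build dsum dsum_addA dsum_addC dsum_add0 dsum_addN.

Fact dsum_scaleA a b f : dsum_scale a (dsum_scale b f) = dsum_scale (a * b) f.
Proof. by apply/ffunP=> i; rewrite !ffunE scalerA. Qed.
Fact dsum_scale1 : left_id 1 dsum_scale.
Proof. by move=> f; apply/ffunP=> i; rewrite !ffunE scale1r. Qed.
Fact dsum_scaleDr : right_distributive dsum_scale +%R.
Proof. by move=> a f g; apply/ffunP=> i; rewrite !ffunE scalerDr. Qed.
Fact dsum_scaleDl f : {morph dsum_scale^~ f : a b / a + b}.
Proof. by move=> a b; apply/ffunP=> i; rewrite !ffunE scalerDl. Qed.
HB.instance Definition _ := GRing.Zmodule_isLmodule.Build K dsum
  dsum_scaleA dsum_scale1 dsum_scaleDr dsum_scaleDl.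
End DirectSum.

Record cochain_complex (K : fieldType) := CochainComplex {
  cochain :> nat -> lmodType K;
  differential : forall n, {linear cochain n -> cochain n.+1};
  differentialK : forall n x, differential n.+1 (differential n x) = 0 }.

Section Cohomology.
Variables (K : fieldType) (C : cochain_complex K).

Program Definition cocycle n : subspace (C n) :=
  {| subspace_set x := differential C n x = 0 |}.
Next Obligation. by move=> n /=; rewrite raddf0. Qed.
Next Obligation. by move=> n x y /= dx dy; rewrite raddfD /= dx dy addr0. Qed.
Next Obligation. by move=> n a x /= dx; rewrite linearZ /= dx scaler0. Qed.

Definition is_coboundary n : C n -> Prop :=
  match n with
  | 0 => fun x => x = 0
  | m.+1 => fun x => exists y, x = differential C m y
  end.

Program Definition coboundary n : subspace (subspace_type (cocycle n)) :=
  {| subspace_set x := is_coboundary (val x) |}.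
Next Obligation. by case=> [|n] //=; exists 0; rewrite raddf0. Qed.
Next Obligation.
case=> [|n] x y /=; first by move=> -> ->; rewrite addr0.
by move=> [u xu] [v yv]; exists (u + v); rewrite raddfD /= -xu -yv.
Qed.
Next Obligation.
case=> [|n] a x /=; first by move=> ->; rewrite scaler0.
by move=> [u xu]; exists (a *: u); rewrite linearZ /= -xu.
Qed.

Definition cohomology n : lmodType K := quotient_space (coboundary n).
End Cohomology.

(* The S-module M viewed as an R-module through f : R -> S. *)
Definition restrict_scalars (R S : nzRingType) (f : {rmorphism R -> S})
  (M : lmodType S) : Type := M.

Section RestrictionOfScalars.
Variables (R S : nzRingType) (f : {rmorphism R -> S}) (M : lmodType S).

Local Notation restricted := (restrict_scalars f M).
HB.instance Definition _ := GRing.Zmodule.on restricted.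

Definition restricted_scale (a : R) (x : restricted) : restricted :=
  f a *: (x : M).

Fact restricted_scaleA a b x :
  restricted_scale a (restricted_scale b x) = restricted_scale (a * b) x.
Proof. by rewrite /restricted_scale scalerA rmorphM. Qed.
Fact restricted_scale1 : left_id 1 restricted_scale.
Proof. by move=> x; rewrite /restricted_scale rmorph1 scale1r. Qed.
Fact restricted_scaleDr : right_distributive restricted_scale +%R.
Proof. by move=> a x y; exact: scalerDr. Qed.
Fact restricted_scaleDl x : {morph restricted_scale^~ x : a b / a + b}.
Proof. by move=> a b; rewrite /restricted_scale rmorphD scalerDl. Qed.

HB.instance Definition _ :=
  GRing.Zmodule_isLmodule.Build R restricted
    restricted_scaleA restricted_scale1 restricted_scaleDr restricted_scaleDl.
End RestrictionOfScalars.

(* M is the internal direct sum of the subsets part g. *)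
Definition direct_decomposition (G M : zmodType) (part : G -> M -> Prop) :=
  (forall x, exists (s : seq G) (y : G -> M),
     (forall g, part g (y g)) /\ x = \sum_(g <- s) y g) /\
  (forall (s : seq G) (y : G -> M), uniq s -> (forall g, part g (y g)) ->
     \sum_(g <- s) y g = 0 -> forall g, g \in s -> y g = 0).

Record grading (K : fieldType) (G : zmodType) (A : comAlgType K) := Grading {
  degree_part :> G -> A -> Prop;
  degree_part0 : forall g, degree_part g 0;
  degree_partD : forall g x y, degree_part g x -> degree_part g y ->
    degree_part g (x + y);
  degree_partZ : forall g a x, degree_part g x -> degree_part g (a *: x);
  degree_part1 : degree_part 0 1;
  degree_partM : forall g h x y, degree_part g x -> degree_part h y ->
    degree_part (g + h) (x * y);
  degree_part_direct : direct_decomposition degree_part }.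

Record graded_module (K : fieldType) (G : zmodType) (A : comAlgType K)
    (deg : grading G A) := GradedModule {
  module_sort :> lmodType A;
  module_part : G -> module_sort -> Prop;
  module_part0 : forall g, module_part g 0;
  module_partD : forall g x y, module_part g x -> module_part g y ->
    module_part g (x + y);
  module_partZ : forall g h a x, deg g a -> module_part h x ->
    module_part (g + h) (a *: x);
  module_part_direct : direct_decomposition module_part }.

Section GradedModules.
Variables (K : fieldType) (G : zmodType) (A : comAlgType K) (deg : grading G A).
Implicit Types M N E : graded_module deg.

Definition graded_hom M N (f : {linear M -> N}) :=
  forall g x, module_part g x -> module_part g (f x).

Definition graded_injective E :=
  forall M N (j : {linear M -> N}) (f : {linear M -> E}),
    graded_hom j -> injective j -> graded_hom f ->
    exists2 h : {linear N -> E}, graded_hom h & forall x, h (j x) = f x.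

Record injective_resolution M := InjectiveResolution {
  resolution :> nat -> graded_module deg;
  resolution_aug : {linear M -> resolution 0};
  resolution_diff : forall n, {linear resolution n -> resolution n.+1};
  resolution_aug_graded : graded_hom resolution_aug;
  resolution_diff_graded : forall n, graded_hom (resolution_diff n);
  resolution_injective : forall n, graded_injective (resolution n);
  resolution_aug_inj : injective resolution_aug;
  resolution_exact0 : forall x,
    resolution_diff 0 x = 0 <-> exists y, x = resolution_aug y;
  resolution_exactS : forall n x,
    resolution_diff n.+1 x = 0 <-> exists y, x = resolution_diff n y }.
End GradedModules.

Section IdealPowers.
Variable A : comNzRingType.
Implicit Types I J : set A.

Definition ideal_mul I J : set A :=
  [set r | exists2 s : seq (A * A), forall p, p \in s -> I p.1 /\ J p.2 &
                                    r = \sum_(p <- s) p.1 * p.2].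

Fixpoint ideal_exp I n : set A :=
  if n is n'.+1 then ideal_mul I (ideal_exp I n') else setT.

(* Gamma_I(M), the elements killed by a power of I. *)
Definition torsion I (M : lmodType A) : set M :=
  [set x | exists n, forall r, ideal_exp I n r -> r *: x = 0].

Lemma ideal_expS I n : ideal_exp I n.+1 `<=` ideal_exp I n.
Proof.
elim: n => [//|n IHn] r [s Is rs]; exists s => // p /Is[Ip Jp].
by split=> //; exact: IHn.
Qed.

Lemma ideal_exp_sub I m n : (m <= n)%N -> ideal_exp I n `<=` ideal_exp I m.
Proof.
move=> /subnK <-; elim: (n - m)%N => [|k IHk] //.
by apply: subset_trans IHk; rewrite addSn; exact: ideal_expS.
Qed.

Lemma torsion0 I M : @torsion I M 0.
Proof. by exists 0%N => r _; rewrite scaler0. Qed.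

Lemma torsionD I (M : lmodType A) (x y : M) :
  torsion I x -> torsion I y -> torsion I (x + y).
Proof.
move=> [m xm] [n yn]; exists (maxn m n) => r Ir; rewrite scalerDr xm ?yn ?addr0//.
  by apply: ideal_exp_sub Ir; exact: leq_maxr.
by apply: ideal_exp_sub Ir; exact: leq_maxl.
Qed.

Lemma torsionZ I (M : lmodType A) a (x : M) : torsion I x -> torsion I (a *: x).
Proof.
by move=> [n xn]; exists n => r Ir; rewrite scalerA mulrC -scalerA xn ?scaler0.
Qed.

Lemma torsion_linear I (M N : lmodType A) (f : {linear M -> N}) (x : M) :
  torsion I x -> torsion I (f x).
Proof. by move=> [n xn]; exists n => r Ir; rewrite -linearZ xn ?raddf0. Qed.
End IdealPowers.

Section LocalCohomology.
Variables (K : fieldType) (G : zmodType) (A : comAlgType K) (deg : grading G A).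
Variables (I : set A) (M : graded_module deg) (E : injective_resolution M).

Local Notation over_K n := (restrict_scalars (GRing.in_alg A) (E n)).

Program Definition torsion_strand (g : G) n : subspace (over_K n) :=
  {| subspace_set x := torsion I (x : E n) /\ module_part g (x : E n) |}.
Next Obligation.
by move=> g n; split; [exact: torsion0 | exact: module_part0].
Qed.
Next Obligation.
move=> g n x y [x1 x2] [y1 y2].
by split; [exact: torsionD | exact: module_partD].
Qed.
Next Obligation.
move=> g n a x [x1 x2]; split; first exact: torsionZ.
rewrite -[g]add0r; apply: module_partZ x2.
by apply: degree_partZ; exact: degree_part1.
Qed.

Section StrandDifferential.
Variables (g : G) (n : nat).

Fact strand_diff_subproof (x : subspace_type (torsion_strand g n)) :
  (resolution_diff E n (val x) : over_K n.+1)
    \in subspace_pred (torsion_strand g n.+1).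
Proof.
case: x => x /= /asboolP[x1 x2]; apply/asboolP; split.
  exact: torsion_linear.
exact: resolution_diff_graded.
Qed.

Definition strand_diff (x : subspace_type (torsion_strand g n)) :
  subspace_type (torsion_strand g n.+1) :=
  Sub (resolution_diff E n (val x) : over_K n.+1) (strand_diff_subproof x).

Fact strand_diff_linear : linear strand_diff.
Proof.
by move=> a x y; apply: val_inj; rewrite /= [LHS]linearP.
Qed.

HB.instance Definition _ := GRing.isLinear.Build K _ _ _ strand_diff
  strand_diff_linear.
End StrandDifferential.

Fact strand_diffK g n x : @strand_diff g n.+1 (@strand_diff g n x) = 0.
Proof. by apply: val_inj; apply/resolution_exactS; exists (val x). Qed.

(* The degree g part of the complex Gamma_I (E). *)
Definition torsion_complex (g : G) : cochain_complex K :=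
  {| cochain := fun n => subspace_type (torsion_strand g n);
     differential := fun n => @strand_diff g n;
     differentialK := @strand_diffK g |}.

(* H^n_I(M), as the family of its homogeneous components: the n-th right
   derived functor of Gamma_I on graded A-modules, computed from the injective
   resolution E of M. *)
Definition local_cohomology (n : nat) (g : G) : lmodType K :=
  cohomology (torsion_complex g) n.
End LocalCohomology.

Lemma bump_swap (k j : nat) : bump (bump k j) (unbump j k) = k.
Proof.
rewrite /bump /unbump; case: (leqP k j) => kj /=; rewrite ?subn0 ?add0n ?add1n.
  by rewrite ltnNge kj.
by rewrite subn1 -ltnS prednK; lia.
Qed.

Lemma unbump_swap (k j : nat) : unbump (unbump j k) (bump k j) = j.
Proof.
rewrite /bump /unbump; case: (leqP k j) => kj /=;
  rewrite ?subn0 ?add0n ?add1n; lia.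
Qed.

Lemma bump_unbump_sign (k j : nat) : (k <= j)%N ->
  (bump k j + unbump j k = (k + j).+1)%N.
Proof. by move=> kj; rewrite /bump /unbump kj ltnNge kj /=; lia. Qed.

Lemma bump_le_unbump (k j : nat) : (bump k j <= unbump j k)%N = ~~ (k <= j)%N.
Proof. by rewrite /bump /unbump; case: (leqP k j); lia. Qed.

Section OrderComplex.
Variables (K : fieldType) (disp : Order.disp_t) (Q : finPOrderType disp).

(* The chains x_0 < ... < x_(n-1), i.e., the (n-1)-simplices of the order
   complex; n = 0 gives the empty simplex. *)
Definition chain n :=
  {x : {ffun 'I_n -> Q} | [forall i : 'I_n, forall j : 'I_n, (i < j)%N ==> (x i < x j)%O]}.
HB.instance Definition _ n := Finite.on (chain n).
HB.instance Definition _ n := SubFinite.on (chain n).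

Fact chain_face_subproof n (k : 'I_n.+1) (x : chain n.+1) :
  [forall i : 'I_n, forall j : 'I_n, (i < j)%N ==>
    ([ffun i => val x (lift k i)] i < [ffun i => val x (lift k i)] j)%O].
Proof.
apply/forallP=> i; apply/forallP=> j; apply/implyP=> ij; rewrite !ffunE.
have /forallP/(_ (lift k i))/forallP/(_ (lift k j))/implyP := valP x; apply.
by rewrite /= ltnNge leq_bump2 -ltnNge.
Qed.

Definition chain_face n (k : 'I_n.+1) (x : chain n.+1) : chain n :=
  Sub [ffun i => val x (lift k i)] (chain_face_subproof k x).

Definition simplicial_diff n (f : {ffun chain n -> K^o}) :
  {ffun chain n.+1 -> K^o} :=
  [ffun x => \sum_(k < n.+1) (-1) ^+ k * f (chain_face k x)].

Fact simplicial_diff_linear n : linear (@simplicial_diff n).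
Proof.
move=> a f g; apply/ffunP=> x; rewrite !ffunE scaler_sumr -big_split /=.
by apply: eq_bigr => k _; rewrite !ffunE mulrDr mulrCA.
Qed.

HB.instance Definition _ n := GRing.isLinear.Build K _ _ _ (@simplicial_diff n)
  (@simplicial_diff_linear n).

Definition face_swap n (p : 'I_n.+2 * 'I_n.+1) : 'I_n.+2 * 'I_n.+1 :=
  (lift p.1 p.2, inord (unbump p.2 p.1)).

Lemma face_swap_unbump n (p : 'I_n.+2 * 'I_n.+1) :
  (face_swap p).2 = unbump p.2 p.1 :> nat.
Proof.
case: p => [[k klt] [j jlt]]; rewrite /face_swap /= inordK // /unbump.
by case: ltnP => kj; lia.
Qed.

Lemma face_swap_bump n (p : 'I_n.+2 * 'I_n.+1) :
  (face_swap p).1 = bump p.1 p.2 :> nat.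
Proof. by []. Qed.

Lemma face_swapK n : involutive (@face_swap n).
Proof.
move=> p; have [p1 p2] := (face_swap_bump p, face_swap_unbump p).
apply/pair_eqP/andP; split; apply/eqP/val_inj.
  by rewrite [LHS]face_swap_bump p1 p2 bump_swap.
by rewrite [LHS]face_swap_unbump p1 p2 unbump_swap.
Qed.

Lemma chain_face_swap n (p : 'I_n.+2 * 'I_n.+1) (x : chain n.+2) :
  chain_face (face_swap p).2 (chain_face (face_swap p).1 x) =
  chain_face p.2 (chain_face p.1 x).
Proof.
apply: val_inj; apply/ffunP=> i; rewrite !ffunE; congr (val x _); apply: val_inj.
transitivity (bump (face_swap p).1 (bump (face_swap p).2 i)) => //.
by rewrite face_swap_bump face_swap_unbump -bumpC.
Qed.

Fact simplicial_diffK n f : @simplicial_diff n.+1 (@simplicial_diff n f) = 0.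
Proof.
apply/ffunP=> x; rewrite !ffunE.
pose F (p : 'I_n.+2 * 'I_n.+1) : K :=
  (-1) ^+ (p.1 + p.2) * f (chain_face p.2 (chain_face p.1 x)).
have F_swap (p : 'I_n.+2 * 'I_n.+1) : (p.1 <= p.2)%N -> F (face_swap p) = - F p.
  move=> le_p; rewrite /F chain_face_swap -mulNr; congr (_ * _).
  have -> : ((face_swap p).1 + (face_swap p).2 = (p.1 + p.2).+1)%N.
    by rewrite face_swap_unbump face_swap_bump bump_unbump_sign.
  by rewrite exprS mulN1r.
transitivity (\sum_p F p : K).
  under eq_bigr do rewrite ffunE mulr_sumr.
  by rewrite pair_bigA; apply: eq_bigr => p _; rewrite /F exprD mulrA.
rewrite (bigID (fun p : 'I_n.+2 * 'I_n.+1 => p.1 <= p.2)%N) /=.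
rewrite [X in _ + X](reindex_onto (@face_swap n) (@face_swap n)) /= => [|p _].
  rewrite [X in _ + X](_ : _ = - \sum_(p : 'I_n.+2 * 'I_n.+1 | (p.1 <= p.2)%N) F p) ?subrr //.
  rewrite -sumrN; apply: eq_big => [p|p /andP[le_p _]].
    rewrite face_swapK eqxx andbT -face_swap_bump face_swap_unbump.
    by rewrite face_swap_bump bump_le_unbump negbK.
  apply: F_swap; move: le_p; rewrite -face_swap_bump face_swap_unbump.
  by rewrite face_swap_bump bump_le_unbump negbK.
exact: face_swapK.
Qed.

(* The cochain complex of the order complex of Q, augmented by the empty
   simplex; cochains of degree n - 1 are placed in degree n. *)
Definition order_complex : cochain_complex K :=
  {| cochain := fun n => {ffun chain n -> K^o};
     differential := fun n => @simplicial_diff n;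
     differentialK := simplicial_diffK |}.

Definition reduced_cohomology (j : int) : lmodType K :=
  if j + 1 is Posz n then cohomology order_complex n else 'rV[K]_0.
End OrderComplex.

Section Cones.
Variables (R : realType) (d : nat).
Implicit Types C F : set 'rV[R]_d.

Definition real_point (a : 'rV[int]_d) : 'rV[R]_d := map_mx intr a.

Definition rational_cone C := exists n (v : 'I_n -> 'rV[int]_d),
  C = [set x | exists2 c : 'I_n -> R,
                 forall i, 0 <= c i & x = \sum_i c i *: real_point (v i)].

Definition pointed_cone C := forall x, C x -> C (- x) -> x = 0.

Definition face_of F C := exists u : 'cV[R]_d,
  (forall x, C x -> 0 <= (x *m u) 0 0) /\
  F = [set x | C x /\ (x *m u) 0 0 = 0].

Definition is_linear_hull C (U : {vspace 'rV[R]_d}) :=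
  (forall x, C x -> x \in U) /\
  forall U' : {vspace 'rV[R]_d}, (forall x, C x -> x \in U') -> (U <= U')%VS.

Definition cone_dim C : nat := \dim (xget 0%VS (is_linear_hull C)).

(* In fan_face, nothing is lost by letting F be any subset of C: the faces of a
   rational pointed cone are rational pointed cones.  Nonemptiness of the fan
   is what makes K[Sigma] a nonzero ring with graded maximal ideal. *)
Record fan := Fan {
  cones : {fset set 'rV[R]_d};
  fan_neq0 : cones != fset0;
  fan_rational : forall C, C \in cones -> rational_cone C;
  fan_pointed : forall C, C \in cones -> pointed_cone C;
  fan_face : forall C F, C \in cones -> F `<=` C ->
    face_of F C <-> F \in cones;
  fan_inter : forall C C', C \in cones -> C' \in cones ->
    face_of (C `&` C') C /\ face_of (C `&` C') C' }.

Lemma real_point0 : real_point 0 = 0.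
Proof. by rewrite /real_point raddf0. Qed.

Lemma real_pointD a b : real_point (a + b) = real_point a + real_point b.
Proof. by rewrite /real_point raddfD. Qed.

Lemma rational_cone0 C : rational_cone C -> C 0.
Proof.
move=> [n [v ->]]; exists (fun=> 0) => //.
by rewrite big1 // => i _; rewrite scale0r.
Qed.

Lemma rational_coneD C x y : rational_cone C -> C x -> C y -> C (x + y).
Proof.
move=> [n [v ->]] [b b0 ->] [c c0 ->]; exists (fun i => b i + c i).
  by move=> i; rewrite addr_ge0.
by rewrite -big_split; apply: eq_bigr => i _; rewrite scalerDl.
Qed.

Lemma face_addP F C x y : face_of F C -> C x -> C y -> F (x + y) -> F x /\ F y.
Proof.
move=> [u [u_ge0 ->]] Cx Cy [_ /eqP].
rewrite mulmxDl mxE paddr_eq0 ?u_ge0 // => /andP[/eqP x0 /eqP y0].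
by [].
Qed.

Lemma fan_addP (S : fan) C C' x y : C \in cones S -> C' \in cones S ->
  C x -> C y -> C' (x + y) -> C' x /\ C' y.
Proof.
move=> CS C'S Cx Cy C'xy; have [CC' _] := fan_inter CS C'S.
have CC'xy : (C `&` C') (x + y).
  by split=> //; apply: rational_coneD => //; exact: fan_rational CS.
by have [[_ ?] [_ ?]] := face_addP CC' Cx Cy CC'xy.
Qed.

End Cones.

(* Ordered by inclusion, as a subtype of set 'rV[R]_d. *)
Definition face_poset (R : realType) (d : nat) (S : fan R d) : Type :=
  cones S.

HB.instance Definition _ R d (S : @fan R d) := Finite.on (face_poset S).
HB.instance Definition _ R d (S : @fan R d) :=
  SubChoice.copy (face_poset S) (fset_sub_type (cones S)).
HB.instance Definition _ R d (S : @fan R d) :=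
  [SubChoice_isSubPOrder of face_poset S by <: with set_display].

(* The open interval (C, 1). *)
Definition open_interval (R : realType) (d : nat) (S : fan R d)
  (C : face_poset S) : Type := {D : face_poset S | (C < D)%O}.
HB.instance Definition _ R d (S : @fan R d) (C : face_poset S) :=
  Finite.on (open_interval C).
HB.instance Definition _ R d (S : @fan R d) (C : face_poset S) :=
  SubChoice.on (open_interval C).
HB.instance Definition _ R d (S : @fan R d) (C : face_poset S) :=
  [SubChoice_isSubPOrder of open_interval C by <: with set_display].

Lemma face_posetE (R : realType) (d : nat) (S : fan R d) (C D : face_poset S) :
  (C <= D)%O = `[< val C `<=` val D >].
Proof. by []. Qed.

HB.lock Definition linear_ext (K : fieldType) (S : choiceType) (V : lmodType K)
  (phi : S -> V) (f : {malg K[S]}) : V := \sum_(a <- msupp f) f@_a *: phi a.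

Section LinearExtension.
Variables (K : fieldType) (S : choiceType) (V : lmodType K).
Implicit Types (phi : S -> V) (f g : {malg K[S]}).

Lemma linear_extw phi f (D : {fset S}) : (msupp f `<=` D)%fset ->
  linear_ext phi f = \sum_(a <- D) f@_a *: phi a.
Proof.
rewrite linear_ext.unlock => fD; apply: big_fset_incl fD _ => a _ /mcoeff_outdom ->.
by rewrite scale0r.
Qed.

Fact linear_ext_linear phi : linear (linear_ext phi).
Proof.
move=> c f g; pose D := (msupp f `|` msupp g `|` msupp (c *: f + g))%fset.
have [fD gD cD] : [/\ msupp f `<=` D, msupp g `<=` D &
    msupp (c *: f + g) `<=` D]%fset.
  split; last exact: fsubsetUr.
    by apply: fsubset_trans (fsubsetUl _ _); exact: fsubsetUl.
  by apply: fsubset_trans (fsubsetUl _ _); exact: fsubsetUr.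
rewrite (linear_extw phi fD) (linear_extw phi gD) (linear_extw phi cD).
rewrite scaler_sumr -big_split /=; apply: eq_bigr => a _.
by rewrite mcoeffD mcoeffZ scalerDl scalerA.
Qed.

HB.instance Definition _ phi := GRing.isLinear.Build K _ _ _ (linear_ext phi)
  (linear_ext_linear phi).

Lemma linear_extU phi a : linear_ext phi << a >> = phi a.
Proof.
rewrite (linear_extw _ (msuppU_le (x := 1))) big_seq_fset1 mcoeffUU.
by rewrite scale1r.
Qed.

Lemma linear_ext_comb phi psi c f :
  linear_ext (fun a => c *: phi a + psi a) f
  = c *: linear_ext phi f + linear_ext psi f.
Proof.
rewrite linear_ext.unlock scaler_sumr -big_split /=; apply: eq_bigr => a _.
by rewrite scalerDr !scalerA mulrC.
Qed.
End LinearExtension.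

Lemma malg_basis_ind (K : fieldType) (S : choiceType)
    (P : {malg K[S]} -> Prop) :
  P 0 -> (forall c f g, P f -> P g -> P (c *: f + g)) -> (forall a, P << a >>) ->
  forall f, P f.
Proof.
move=> P0 Pcomb PU f; rewrite [f]monalgE.
elim: (enum_fset (msupp f)) => [|a s IHs]; first by rewrite big_nil.
rewrite big_cons -[<< f@_a *g a >>](_ : f@_a *: << a >> = _).
  by apply: Pcomb.
by apply/malgP => b; rewrite mcoeffZ !mcoeffU mulr_natr.
Qed.

Lemma malg_bilinear_assoc (K : fieldType) (S : choiceType)
    (m : {malg K[S]} -> {malg K[S]} -> {malg K[S]}) :
  (forall c f1 f2 g, m (c *: f1 + f2) g = c *: m f1 g + m f2 g) ->
  (forall c f g1 g2, m f (c *: g1 + g2) = c *: m f g1 + m f g2) ->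
  (forall a b c, m << a >> (m << b >> << c >>) = m (m << a >> << b >>) << c >>) ->
  associative m.
Proof.
move=> mDl mDr mU.
have m0l g : m 0 g = 0 by have := mDl (-1) 0 0 g; rewrite !scaleN1r !addNr.
have m0r f : m f 0 = 0 by have := mDr (-1) f 0 0; rewrite !scaleN1r !addNr.
move=> f g h; elim/malg_basis_ind: f => [|c f1 f2 IH1 IH2|a].
- by rewrite !m0l.
- by rewrite !mDl IH1 IH2.
elim/malg_basis_ind: g => [|c g1 g2 IH1 IH2|b].
- by rewrite m0r !m0l m0r.
- by rewrite !(mDl, mDr) IH1 IH2.
elim/malg_basis_ind: h => [|k h1 h2 IH1 IH2|c].
- by rewrite !m0r.
- by rewrite !mDr IH1 IH2.
exact: mU.
Qed.

(* The decomposition of a space with basis S when a in S has degree deg a. *)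
Section BasisGrading.
Variables (K : fieldType) (S : choiceType) (G : zmodType) (deg : S -> G).

Definition malg_part (g : G) (f : {malg K[S]}) : Prop :=
  forall a, f@_a != 0 -> deg a = g.

Lemma malg_part0 g : malg_part g 0.
Proof. by move=> a; rewrite mcoeff0 eqxx. Qed.

Lemma malg_partD g f1 f2 :
  malg_part g f1 -> malg_part g f2 -> malg_part g (f1 + f2).
Proof.
move=> f1g f2g a; rewrite mcoeffD; have [f1a|/f1g //] := eqVneq f1@_a 0.
by rewrite f1a add0r => /f2g.
Qed.

Lemma malg_partZ g c f : malg_part g f -> malg_part g (c *: f).
Proof.
move=> fg a; rewrite mcoeffZ mulf_eq0 negb_or => /andP[_]; exact: fg.
Qed.

Lemma malg_partU c a : malg_part (deg a) << c *g a >>.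
Proof. by move=> b; rewrite mcoeffU; have [->|] := eqVneq a b; rewrite ?eqxx. Qed.

Lemma malg_part_sum (I : eqType) (r : seq I) (F : I -> {malg K[S]}) g :
  (forall i, i \in r -> malg_part g (F i)) -> malg_part g (\sum_(i <- r) F i).
Proof.
move=> Fg; rewrite big_seq; elim/big_ind: _ => //; first exact: malg_part0.
exact: malg_partD.
Qed.

Lemma malg_part_direct : direct_decomposition malg_part.
Proof.
split=> [f|s y s_uniq yP sum0 g gs].
  pose y g : {malg K[S]} := [malg a in msupp f => if deg a == g then f@_a else 0].
  have yE g a : (y g)@_a = if deg a == g then f@_a else 0.
    rewrite mcoeffE; case: ifP => // /negbT /mcoeff_outdom ->.
    by case: ifP.
  exists (undup (map deg (msupp f))), y; split.
    by move=> g a; rewrite yE; case: (deg a =P g) => // _; rewrite eqxx.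
  apply/malgP => a; rewrite raddf_sum /=; under eq_bigr do rewrite yE.
  rewrite -big_mkcond /=.
  have [af|af] := boolP (a \in msupp f); last first.
    by rewrite big1 ?mcoeff_outdom // => g _; rewrite mcoeff_outdom.
  rewrite -big_filter (_ : [seq _ <- _ | _] = [:: deg a]) ?big_seq1 //.
  rewrite (eq_filter (a2 := pred1 (deg a))) => [|g]; last by rewrite /= eq_sym.
  by rewrite filter_pred1_uniq ?undup_uniq // mem_undup map_f.
apply/malgP => a; rewrite mcoeff0; have [ag|ag] := eqVneq (deg a) g; last first.
  by apply/eqP/negP => /negP/yP/eqP; rewrite (negbTE ag).
have := congr1 (mcoeff a) sum0; rewrite mcoeff0 raddf_sum /= (bigD1_seq g) //=.
rewrite big1 ?addr0 // => h /negbTE hg.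
by apply/eqP/negP => /negP/yP/eqP; rewrite ag eq_sym hg.
Qed.
End BasisGrading.

Section FaceRing.
Variables (R : realType) (d : nat) (S : fan R d) (K : fieldType).

Definition support_point (a : 'rV[int]_d) : bool :=
  `[< exists2 C, C \in cones S & C (real_point R a) >].

Definition in_common_cone (a b : 'rV[int]_d) : bool :=
  `[< exists C, [/\ C \in cones S, C (real_point R a) & C (real_point R b)] >].

Definition support_points : Type := {a : 'rV[int]_d | support_point a}.
HB.instance Definition _ := Choice.on support_points.
HB.instance Definition _ := SubChoice.on support_points.

(* The space with basis x^a = << a >>, for a in the support of the fan. *)
Definition face_ring : Type := {malg K[support_points]}.
HB.instance Definition _ := GRing.Lmodule.on face_ring.

(* x^a if a is in the support, and 0 otherwise. *)
Definition face_monomial (a : 'rV[int]_d) : {malg K[support_points]} :=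
  if insub a is Some s then << s >> else 0.

Definition face_monomial_mul (a b : support_points) : {malg K[support_points]} :=
  if in_common_cone (val a) (val b) then face_monomial (val a + val b) else 0.

Definition face_one : face_ring := face_monomial 0.

Definition face_mul (f g : face_ring) : face_ring :=
  linear_ext (fun a => linear_ext (face_monomial_mul a) g) f.

Lemma face_monomialE (s : support_points) : face_monomial (val s) = << s >>.
Proof. by rewrite /face_monomial valK. Qed.

Lemma face_mulDl c f1 f2 g :
  face_mul (c *: f1 + f2) g = c *: face_mul f1 g + face_mul f2 g.
Proof. by rewrite /face_mul linearP. Qed.

Lemma face_mulDr c f g1 g2 :
  face_mul f (c *: g1 + g2) = c *: face_mul f g1 + face_mul f g2.
Proof.
rewrite /face_mul -linear_ext_comb; congr linear_ext.
by apply/funext => a; rewrite linearP.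
Qed.

Lemma face_mul0l g : face_mul 0 g = 0.
Proof. exact: linear0. Qed.

Lemma face_mul0r f : face_mul f 0 = 0.
Proof. by have := face_mulDr (-1) f 0 0; rewrite scaleN1r addNr scaleN1r addNr. Qed.

Lemma face_mulU a b : face_mul << a >> << b >> = face_monomial_mul a b.
Proof. by rewrite /face_mul !linear_extU. Qed.

Lemma in_common_coneC a b : in_common_cone a b = in_common_cone b a.
Proof. by apply/asboolP/asboolP => -[C [? ? ?]]; exists C. Qed.

Lemma support_point0 : support_point 0.
Proof.
have /fset0Pn[C CS] := fan_neq0 S; apply/asboolP; exists C => //.
by rewrite real_point0; apply: rational_cone0; exact: fan_rational CS.
Qed.

Lemma in_common_coneD a b : in_common_cone a b -> support_point (a + b).
Proof.
move=> /asboolP[C [CS Ca Cb]]; apply/asboolP; exists C => //.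
by rewrite real_pointD; apply: rational_coneD => //; exact: fan_rational CS.
Qed.

Lemma in_common_cone0 a : support_point a -> in_common_cone 0 a.
Proof.
move=> /asboolP[C CS Ca]; apply/asboolP; exists C; split=> //.
by rewrite real_point0; apply: rational_cone0; exact: fan_rational CS.
Qed.

Lemma in_common_coneA a b c :
  in_common_cone a b && in_common_cone (a + b) c
  = in_common_cone b c && in_common_cone a (b + c).
Proof.
have three x y z : in_common_cone x y -> in_common_cone (x + y) z ->
    exists C, [/\ C \in cones S, C (real_point R x), C (real_point R y) &
                  C (real_point R z)].
  move=> /asboolP[C [CS Cx Cy]] /asboolP[C' [C'S C'xy C'z]].
  by rewrite real_pointD in C'xy; exists C'; have [] := fan_addP CS C'S Cx Cy C'xy.
have four x y z C : C \in cones S -> C (real_point R x) -> C (real_point R y) ->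
    C (real_point R z) -> in_common_cone x y && in_common_cone (x + y) z.
  move=> CS Cx Cy Cz; apply/andP; split; apply/asboolP; exists C; split=> //.
  by rewrite real_pointD; apply: rational_coneD => //; exact: fan_rational CS.
apply/idP/idP => /andP[].
  move=> /three H /H[C [CS Ca Cb Cc]].
  by rewrite [in_common_cone a _]in_common_coneC (four _ _ _ C).
rewrite [in_common_cone a _]in_common_coneC => /three H /H[C [CS Cb Cc Ca]].
exact: (four _ _ _ C).
Qed.

Fact face_mulC : commutative face_mul.
Proof.
elim/malg_basis_ind => [g|c f1 f2 IH1 IH2 g|a].
- by rewrite face_mul0l face_mul0r.
- by rewrite face_mulDl face_mulDr IH1 IH2.
elim/malg_basis_ind => [|c g1 g2 IH1 IH2|b].
- by rewrite face_mul0l face_mul0r.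
- by rewrite face_mulDl face_mulDr IH1 IH2.
rewrite [LHS]face_mulU [RHS]face_mulU /face_monomial_mul in_common_coneC.
by rewrite [val a + val b]addrC.
Qed.

Lemma face_mulM (a b c : support_points) :
  face_mul (face_monomial_mul a b) << c >> =
  if in_common_cone (val a) (val b) && in_common_cone (val a + val b) (val c)
  then face_monomial (val a + val b + val c) else 0.
Proof.
rewrite {1}/face_monomial_mul; have [ab|_] /= := boolP (in_common_cone _ _).
  rewrite /face_monomial insubT; first exact: in_common_coneD.
  by move=> h; rewrite face_mulU.
by rewrite face_mul0l.
Qed.

Fact face_mulA : associative face_mul.
Proof.
apply: malg_bilinear_assoc face_mulDl face_mulDr _ => a b c.
transitivity (face_mul (face_monomial_mul b c) << a >>).
  by rewrite face_mulC; congr face_mul; exact: face_mulU.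
transitivity (face_mul (face_monomial_mul a b) << c >>); last first.
  by congr face_mul; exact/esym/face_mulU.
rewrite (face_mulM b c a) (face_mulM a b c) (in_common_coneA (val a)).
rewrite [in_common_cone (val a) _]in_common_coneC.
by rewrite -[val a + _ + _]addrA [val a + _]addrC.
Qed.

Fact face_mul1 : left_id face_one face_mul.
Proof.
rewrite /face_one /face_monomial insubT; first exact: support_point0.
move=> h0; elim/malg_basis_ind => [|c g1 g2 IH1 IH2|a].
- by rewrite face_mul0r.
- by rewrite face_mulDr IH1 IH2.
rewrite face_mulU /face_monomial_mul /= in_common_cone0 ?(valP a) //.
by rewrite add0r face_monomialE.
Qed.

Fact face_mul_addl : left_distributive face_mul +%R.
Proof. by move=> f1 f2 g; rewrite -[f1]scale1r face_mulDl !scale1r. Qed.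

Fact face_one_neq0 : face_one != 0.
Proof.
rewrite /face_one /face_monomial insubT; first exact: support_point0.
by move=> h0; rewrite monalgU_eq0 oner_eq0.
Qed.

HB.instance Definition _ := GRing.Zmodule_isComNzRing.Build face_ring
  face_mulA face_mulC face_mul1 face_mul_addl face_one_neq0.

Fact face_scaleAl (c : K) (f g : face_ring) : c *: (f * g) = (c *: f) * g.
Proof. by have := face_mulDl c f 0 g; rewrite !addr0 face_mul0l addr0. Qed.

HB.instance Definition _ := GRing.Lmodule_isLalgebra.Build K face_ring
  face_scaleAl.
HB.instance Definition _ := GRing.Lalgebra_isComAlgebra.Build K face_ring.

Definition face_degree : support_points -> 'rV[int]_d := val.

Lemma face_monomial_part a : malg_part face_degree a (face_monomial a).
Proof.
rewrite /face_monomial; case: insubP => [s _ <-|_]; last exact: malg_part0.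
exact: malg_partU.
Qed.

Fact face_part1 : malg_part face_degree 0 (1 : face_ring).
Proof. exact: face_monomial_part. Qed.

Fact face_partM a b (f g : face_ring) : malg_part face_degree a f ->
  malg_part face_degree b g -> malg_part face_degree (a + b) (f * g).
Proof.
move=> fa gb; rewrite -[f * g]/(face_mul f g) /face_mul linear_ext.unlock.
apply: malg_part_sum => s sf; apply: malg_partZ; apply: malg_part_sum => t tg.
apply: malg_partZ; rewrite -mcoeff_neq0 in sf; rewrite -mcoeff_neq0 in tg.
rewrite -(fa s sf) -(gb t tg) /face_monomial_mul.
by case: ifP => _; [exact: face_monomial_part | exact: malg_part0].
Qed.

Definition face_grading : grading 'rV[int]_d face_ring :=
  @Grading K 'rV[int]_d face_ring (malg_part face_degree)
    (@malg_part0 _ _ _ face_degree) (@malg_partD _ _ _ face_degree)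
    (@malg_partZ _ _ _ face_degree) face_part1 face_partM
    (malg_part_direct K face_degree).

Definition face_module : graded_module face_grading :=
  @GradedModule K 'rV[int]_d face_ring face_grading face_ring^o
    (malg_part face_degree)
    (@malg_part0 _ _ _ face_degree) (@malg_partD _ _ _ face_degree)
    face_partM (malg_part_direct K face_degree).

(* The ideal spanned by the x^a with a != 0. *)
Definition graded_maximal_ideal : set face_ring :=
  [set f | forall a, f@_a != 0 -> face_degree a != 0].

End FaceRing.

Section ConeRing.
Variables (R : realType) (d : nat) (S : fan R d) (C : face_poset S).

Definition in_cone (a : 'rV[int]_d) : bool := `[< val C (real_point R a) >].

Definition cone_points : Type := {a : 'rV[int]_d | in_cone a}.
HB.instance Definition _ := Choice.on cone_points.
HB.instance Definition _ := SubChoice.on cone_points.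

Fact in_cone0 : in_cone 0.
Proof.
apply/asboolP; rewrite real_point0; apply: rational_cone0.
exact: fan_rational (valP C).
Qed.

Fact in_coneD (a b : cone_points) : in_cone (val a + val b).
Proof.
apply/asboolP; rewrite real_pointD; apply: rational_coneD.
- exact: fan_rational (valP C).
- exact/asboolP/(valP a).
- exact/asboolP/(valP b).
Qed.

Definition cone_point0 : cone_points := Sub 0 in_cone0.
Definition cone_pointD (a b : cone_points) : cone_points :=
  Sub (val a + val b) (in_coneD a b).

Fact cone_pointA : associative cone_pointD.
Proof. by move=> a b c; apply: val_inj; rewrite /= addrA. Qed.
Fact cone_pointC : commutative cone_pointD.
Proof. by move=> a b; apply: val_inj; rewrite /= addrC. Qed.
Fact cone_point0D : left_id cone_point0 cone_pointD.
Proof. by move=> a; apply: val_inj; rewrite /= add0r. Qed.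
Fact cone_pointD0 : right_id cone_point0 cone_pointD.
Proof. by move=> a; apply: val_inj; rewrite /= addr0. Qed.
Fact cone_pointD_eq0 a b :
  cone_pointD a b = cone_point0 -> a = cone_point0 /\ b = cone_point0.
Proof.
move=> /(congr1 val) /= ab0.
have b_a : val b = - val a by apply/eqP; rewrite -addr_eq0 addrC ab0.
have a0 : val a = 0.
  have : real_point R (val a) = 0.
    apply: (fan_pointed (valP C)); first exact/asboolP/(valP a).
    by have := asboolW (valP b); rewrite b_a /real_point raddfN.
  move=> /matrixP a0; apply/matrixP => i j; have := a0 i j; rewrite !mxE.
  by move=> /eqP; rewrite intr_eq0 => /eqP.
by split; apply: val_inj; rewrite /= ?b_a a0 ?oppr0.
Qed.

HB.instance Definition _ := Choice_isMonomialDef.Build cone_points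
  cone_pointA cone_point0D cone_pointD0 cone_pointD_eq0.
HB.instance Definition _ :=
  MonomialDef_isConomialDef.Build cone_points cone_pointC.

Variable K : fieldType.

Definition cone_ring : Type := {malg K[cone_points]}.
HB.instance Definition _ := GRing.Lmodule.on cone_ring.
HB.instance Definition _ := GRing.ComNzRing.on cone_ring.

Definition cone_monomial (a : 'rV[int]_d) : {malg K[cone_points]} :=
  if insub a is Some s then << s >> else 0.

(* The surjection K[Sigma] -> K[C]. *)
Definition cone_proj (f : face_ring S K) : cone_ring :=
  linear_ext (fun a : support_points S => cone_monomial (val a)) f.

Lemma cone_monomialE (s : cone_points) : cone_monomial (val s) = << s >>.
Proof. by rewrite /cone_monomial valK. Qed.

Lemma cone_monomial_out a : ~~ in_cone a -> cone_monomial a = 0.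
Proof. by move=> aC; rewrite /cone_monomial insubN. Qed.

Lemma cone_proj_monomial a : support_point S a ->
  cone_proj (face_monomial S K a) = cone_monomial a.
Proof.
by move=> aS; rewrite /cone_proj /face_monomial insubT linear_extU.
Qed.

Lemma cone_projP c f g : cone_proj (c *: f + g) = c *: cone_proj f + cone_proj g.
Proof. exact: linearP. Qed.

Fact cone_proj_zmod : zmod_morphism cone_proj.
Proof. by move=> f g; exact: raddfB. Qed.

Lemma cone_monomialM a b : support_point S a -> support_point S b ->
  (cone_monomial a : cone_ring) * cone_monomial b =
  if in_common_cone S a b then cone_monomial (a + b) else 0.
Proof.
move=> aS bS; have CS := valP C.
have [aC|aC] := boolP (in_cone a); last first.
  rewrite (cone_monomial_out aC) mul0r; case: ifP => // /asboolP[D [DS Da Db]].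
  rewrite cone_monomial_out //; apply: contra aC => /asboolP.
  rewrite real_pointD => abC; apply/asboolP.
  by have [] := fan_addP DS CS Da Db abC.
have [bC|bC] := boolP (in_cone b); last first.
  rewrite (cone_monomial_out bC) mulr0; case: ifP => // /asboolP[D [DS Da Db]].
  rewrite cone_monomial_out //; apply: contra bC => /asboolP.
  rewrite real_pointD => abC; apply/asboolP.
  by have [] := fan_addP DS CS Da Db abC.
have -> : in_common_cone S a b.
  by apply/asboolP; exists (val C); split=> //; exact/asboolP.
have := cone_monomialE (cone_pointD (Sub a aC) (Sub b bC)).
have := cone_monomialE (Sub b bC); have := cone_monomialE (Sub a aC).
rewrite !SubK /= => -> -> ->.
by apply: etrans (fgmulUU _ _ _ _) _; rewrite mulr1.
Qed.

Fact cone_proj_monoid : monoid_morphism cone_proj.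
Proof.
split.
  rewrite [LHS](cone_proj_monomial (support_point0 S)).
  exact: (cone_monomialE cone_point0).
have pD c f g : cone_proj (c *: f + g) = c *: cone_proj f + cone_proj g.
  exact: cone_projP.
have p0 : cone_proj 0 = 0 by exact: raddf0.
have mDl c (f g h : cone_ring) : (c *: f + g) * h = c *: (f * h) + g * h.
  by rewrite mulrDl scalerAl.
have mDr c (f g h : cone_ring) : h * (c *: f + g) = c *: (h * f) + h * g.
  by rewrite ![h * _]mulrC mDl.
have fDl c (f g h : face_ring S K) : (c *: f + g) * h = c *: (f * h) + g * h.
  by rewrite mulrDl scalerAl.
have fDr c (f g h : face_ring S K) : h * (c *: f + g) = c *: (h * f) + h * g.
  by rewrite ![h * _]mulrC fDl.
elim/malg_basis_ind => [g|c f1 f2 IH1 IH2 g|a].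
- by rewrite mul0r p0 mul0r.
- by rewrite fDl !pD IH1 IH2 mDl.
elim/malg_basis_ind => [|c g1 g2 IH1 IH2|b].
- by rewrite mulr0 p0 mulr0.
- by rewrite fDr !pD IH1 IH2 mDr.
transitivity (cone_proj (face_monomial_mul K a b)).
  by congr cone_proj; exact: face_mulU.
transitivity ((cone_monomial (val a) : cone_ring) * cone_monomial (val b)).
  rewrite cone_monomialM ?(valP a) ?(valP b) // /face_monomial_mul.
  case: ifP => ab; last exact: raddf0.
  exact/cone_proj_monomial/in_common_coneD.
by congr (_ * _); exact/esym/linear_extU.
Qed.

HB.instance Definition _ :=
  GRing.isZmodMorphism.Build (face_ring S K) cone_ring cone_proj cone_proj_zmod.
HB.instance Definition _ :=
  GRing.isMonoidMorphism.Build (face_ring S K) cone_ring cone_proj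
    cone_proj_monoid.

Definition cone_degree : cone_points -> 'rV[int]_d := val.

Lemma cone_monomial_part a : malg_part cone_degree a (cone_monomial a).
Proof.
rewrite /cone_monomial; case: insubP => [s _ <-|_]; last exact: malg_part0.
exact: malg_partU.
Qed.

Lemma cone_proj_part a f :
  malg_part (@face_degree R d S) a f -> malg_part cone_degree a (cone_proj f).
Proof.
move=> fa; rewrite /cone_proj linear_ext.unlock; apply: malg_part_sum => s sf.
apply: malg_partZ; rewrite -mcoeff_neq0 in sf; rewrite -(fa s sf).
exact: cone_monomial_part.
Qed.

Lemma cone_partM a b (f g : cone_ring) : malg_part cone_degree a f ->
  malg_part cone_degree b g -> malg_part cone_degree (a + b) (f * g).
Proof.
move=> fa gb; rewrite [f * g]malgME; apply: malg_part_sum => s sf.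
apply: malg_part_sum => t tg.
rewrite -mcoeff_neq0 in sf; rewrite -mcoeff_neq0 in tg.
rewrite -(fa s sf) -(gb t tg).
exact: malg_partU cone_degree (f@_s * g@_t) (cone_pointD s t).
Qed.

(* K[C] as a module over K[Sigma]. *)
Definition cone_ring_module : lmodType (face_ring S K) :=
  restrict_scalars cone_proj cone_ring^o.

Fact cone_part_scale a b f (x : cone_ring_module) :
  face_grading S K a f -> malg_part cone_degree b x ->
  malg_part cone_degree (a + b) (f *: x).
Proof. by move=> fa xb; apply: cone_partM => //; exact: cone_proj_part. Qed.

Definition cone_module : graded_module (face_grading S K) :=
  @GradedModule K 'rV[int]_d (face_ring S K) (face_grading S K)
    cone_ring_module (malg_part cone_degree)
    (@malg_part0 _ _ _ cone_degree) (@malg_partD _ _ _ cone_degree)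
    cone_part_scale (malg_part_direct K cone_degree).

End ConeRing.

(* Graded vector spaces are given by their homogeneous components, so a graded
   isomorphism is a linear isomorphism in each degree. *)
Definition graded_iso (K : fieldType) (G : Type) (U V : G -> lmodType K) : Prop :=
  forall g, exists f : {linear U g -> V g}, bijective f.

(* Main.v *)
(* Local cohomology is computed from a cobar resolution M -> B M -> B (B M) -> ...,
   where B M is the graded module of K-linear maps A -> M.  It is functorial for
   K-linear graded maps, so that torsion in its degree a strand is exact on
   sequences of graded modules, and it agrees with injective resolutions.

   For a face F of a cone and a real point w, let K{w + F} have as basis the
   lattice points of w + F.  By induction on F, its local cohomology in degree b
   is concentrated in cohomological degree dim F, and vanishes unless w - b lies
   in the interior of F.  When w - b is not interior, a lattice point v interior
   to F gives an inclusion K{w + F} -> K{w - v + F} inducing an injection on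
   cohomology, since the cokernel is filtered by the finitely many jumps K{w - t v + bd F};
   its composite with the translation by v is multiplication by x^v, which is
   locally nilpotent on cohomology.  When w - b is interior, moving w into the
   interior of a facet shifts the cohomological degree by one.  In particular
   H^j(K[C])_a = 0 unless j = dim C and -a is interior to C, which happens for at
   most one cone C0.

   The face ring is resolved by the modules whose basis in degree p consists of
   the chains of cones of the fan all containing p: in each degree this is the
   augmented cochain complex of a cone over the carrier of p.  In degree a only
   the chains starting at C0 contribute, and the double complex collapses to the
   cochains of the open interval (C0, 1) with values in H^(dim C0)(K[C0])_a. *)

From HB Require Import structures.
Require Import Defs.
From mathcomp Require Import all_boot all_order all_algebra finmap.
From mathcomp Require Import boolp classical_sets reals functions.
From mathcomp Require Import monalg zify ring lra.

Set Implicit Arguments.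
Unset Strict Implicit.
Unset Printing Implicit Defensive.

Import Order.TTheory GRing.Theory Num.Theory.

Local Open Scope classical_set_scope.
Local Open Scope ring_scope.

#[local] Obligation Tactic := idtac.

(** * Graded maps *)

(** The resolutions in the statement are arbitrary and unrelated, and torsion is only left exact, so
    exact sequences of modules do not act on them directly. Cofree modules remedy this: B makes
    K-linear maps A-linear, hence torsion preserving, and over K every exact sequence splits. What
    has to be supplied is acyclicity. Injective modules are acyclic because they are retracts of B
    E. Torsion modules, which occur when F is the origin, are acyclic because a cofree module allows
    division by a monomial once one more factor of that monomial is multiplied in; the induction
    runs over finitely many monomials generating the maximal ideal. Nilpotence is not formal either:
    multiplication by x^v on M and on the resolving terms are different maps, joined by an explicit
    homotopy, and only the second visibly kills torsion elements. The parameter w is real so that F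
    can be moved continuously: lattice points then enter through one translated boundary at a time.
    The direction of motion can be chosen so that a single facet contributes, which is how the
    dimension enters. *)

Lemma eq_sum_support (G : choiceType) (M : nmodType) (y : G -> M) (s t : seq G) :
  uniq s -> uniq t -> (forall g, g \notin s -> y g = 0) ->
  (forall g, g \notin t -> y g = 0) -> \sum_(g <- s) y g = \sum_(g <- t) y g.
Proof.
have filt r : \sum_(g <- r) y g = \sum_(g <- [seq g <- r | y g != 0]) y g.
  rewrite big_filter [LHS](bigID (fun g => y g != 0)) /= [X in _ + X]big1 ?addr0 //.
  by move=> g /negPn/eqP.
move=> us ut ys yt; rewrite filt [RHS]filt; apply: perm_big.
apply: uniq_perm; rewrite ?filter_uniq // => g; rewrite !mem_filter.
case: (boolP (y g == 0)) => //= yg; apply/idP/idP => _.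
  by apply: contraNT yg => /yt ->.
by apply: contraNT yg => /ys ->.
Qed.

Section Decomposition.
Variables (G M : zmodType) (part : G -> M -> Prop).
Hypothesis part0 : forall g, part g 0.
Hypothesis partD : forall g x y, part g x -> part g y -> part g (x + y).

(** [direct_decomposition] leaves the family arbitrary off the list [s]. Requiring it to vanish
    there makes the family unique, as in [decomposes_uniq]. *)
Definition decomposes (x : M) (y : G -> M) :=
  (forall g, part g (y g)) /\
  exists s, [/\ uniq s, forall g, g \notin s -> y g = 0 & x = \sum_(g <- s) y g].

Lemma decomposes_sum (s : seq G) (x : M) (y : G -> M) :
  decomposes x y -> uniq s -> (forall g, g \notin s -> y g = 0) ->
  x = \sum_(g <- s) y g.
Proof. by move=> [_ [t [ut yt ->]]] us ys; exact: eq_sum_support. Qed.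

Lemma decomposesD x x' y y' :
  decomposes x y -> decomposes x' y' -> decomposes (x + x') (fun g => y g + y' g).
Proof.
move=> dx dx'; move: (dx) (dx') => [py [s [us ys _]]] [py' [t [ut yt _]]].
split; first by move=> g; exact: partD.
have e1 g : g \notin undup (s ++ t) -> y g = 0.
  by rewrite mem_undup mem_cat negb_or => /andP[/ys].
have e2 g : g \notin undup (s ++ t) -> y' g = 0.
  by rewrite mem_undup mem_cat negb_or => /andP[_ /yt].
exists (undup (s ++ t)); split; rewrite ?undup_uniq //.
  by move=> g gs; rewrite e1 ?e2 ?addr0.
rewrite big_split /= -(decomposes_sum dx) ?undup_uniq //.
by rewrite -(decomposes_sum dx') ?undup_uniq.
Qed.

Lemma decomposes_part g x : part g x ->
  decomposes x (fun h => if h == g then x else 0).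
Proof.
move=> px; split; first by move=> h; case: eqP => [->|].
exists [:: g]; split=> //; last by rewrite big_seq1 eqxx.
by move=> h; rewrite inE => /negbTE ->.
Qed.

Lemma decomposes0 : decomposes 0 (fun=> 0).
Proof. by split=> //; exists [::]; split=> //; rewrite big_nil. Qed.

Lemma decomposes_bigsum (I : Type) (r : seq I) (z : I -> M) :
  (forall i, exists y, decomposes (z i) y) ->
  exists y, decomposes (\sum_(i <- r) z i) y.
Proof.
move=> dz; elim: r => [|i r [y' dy']].
  by rewrite big_nil; exists (fun=> 0); exact: decomposes0.
have [y dy] := dz i.
by rewrite big_cons; exists (fun g => y g + y' g); exact: decomposesD.
Qed.

Lemma direct_decompositionP :
  (forall x, exists y, decomposes x y) ->
  (forall y, decomposes 0 y -> forall g, y g = 0) ->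
  direct_decomposition part.
Proof.
move=> ex un; split=> [x|s y us py y0 g gs].
  by have [y [py [s [us ys xs]]]] := ex x; exists s, y.
suff : (if g \in s then y g else 0) = 0 by rewrite gs.
apply: (un (fun g => if g \in s then y g else 0)); split.
  by move=> h; case: ifP.
exists s; split=> //; first by move=> h /negbTE ->.
by rewrite -[LHS]y0 big_seq [RHS]big_seq; apply: eq_bigr => h ->.
Qed.

Hypothesis direct : direct_decomposition part.

Lemma decomposes_ex x : exists y, decomposes x y.
Proof.
have [s [y [py ->]]] := direct.1 x; apply: decomposes_bigsum => g.
by exists (fun h => if h == g then y g else 0); exact: decomposes_part.
Qed.

Hypothesis partN : forall g x, part g x -> part g (- x).

Lemma decomposes_uniq x y y' : decomposes x y -> decomposes x y' -> y =1 y'.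
Proof.
move=> dy dy'; suff H z : decomposes 0 z -> forall g, z g = 0.
  have dN : decomposes (- x) (fun g => - y' g).
    move: dy' => [py [s [us ys ->]]]; split; first by move=> g; exact: partN.
    by exists s; split=> //; [move=> g /ys ->; rewrite oppr0|rewrite sumrN].
  have := decomposesD dy dN; rewrite subrr => /H H0 g.
  by apply/eqP; rewrite -subr_eq0 H0.
move=> [pz [s [us zs z0]]] g; have [gs|/zs //] := boolP (g \in s).
exact: (direct.2 s).
Qed.
End Decomposition.

Section Graded.
Variables (K : fieldType) (G : zmodType) (A : comAlgType K) (deg : grading G A).
Implicit Types M N P E : graded_module deg.

Lemma deg_scalar (k : K) : deg 0 (k%:A).
Proof. by apply: degree_partZ; exact: degree_part1. Qed.

Lemma module_partK M g (k : K) (x : M) :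
  module_part g x -> module_part g (k%:A *: x).
Proof. by move=> gx; rewrite -[g]add0r; apply: module_partZ gx; exact: deg_scalar. Qed.

Lemma module_partN M g (x : M) : module_part g x -> module_part g (- x).
Proof. by move=> gx; have := module_partK (-1) gx; rewrite !scaleN1r. Qed.

Lemma module_partB M g (x y : M) :
  module_part g x -> module_part g y -> module_part g (x - y).
Proof. by move=> gx gy; apply: module_partD => //; exact: module_partN. Qed.

Lemma module_part_sum M g (I : Type) (r : seq I) (P : pred I) (x : I -> M) :
  (forall i, P i -> module_part g (x i)) -> module_part g (\sum_(i <- r | P i) x i).
Proof.
move=> gx; elim/big_ind: _ => //; first exact: module_part0.
exact: module_partD.
Qed.

Definition mdec M (x : M) (y : G -> M) := decomposes (@module_part _ _ _ _ M) x y.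

Lemma mdec_ex M (x : M) : exists y, mdec x y.
Proof.
exact: decomposes_ex (@module_part0 _ _ _ _ M) (@module_partD _ _ _ _ M)
  (@module_part_direct _ _ _ _ M) x.
Qed.

Lemma mdec_uniq M (x : M) y y' : mdec x y -> mdec x y' -> y =1 y'.
Proof.
move=> dx dy; have dU := @decomposes_uniq G M (@module_part _ _ _ _ M).
exact: (dU (@module_partD _ _ _ _ M) (@module_part_direct _ _ _ _ M)
  (@module_partN M) _ _ _ dx dy).
Qed.

(** The homogeneous component of [x] in degree [g]; by [mdec_uniq] the choice does not matter. *)
Definition hc M (g : G) (x : M) : M := sval (cid (mdec_ex x)) g.

Lemma hcP M (x : M) : mdec x (fun g => hc g x).
Proof. exact: svalP (cid (mdec_ex x)). Qed.

Lemma hc_part M g (x : M) : module_part g (hc g x).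
Proof. exact: (hcP x).1. Qed.

Lemma hcE M (x : M) y : mdec x y -> forall g, hc g x = y g.
Proof. by move=> dy g; exact: mdec_uniq (hcP x) dy g. Qed.

Lemma hcD M g (x y : M) : hc g (x + y) = hc g x + hc g y.
Proof.
apply: (hcE (y := fun g => hc g x + hc g y)).
by apply: decomposesD; [exact: module_partD|exact: hcP..].
Qed.

Lemma hcK M g (k : K) (x : M) : hc g (k%:A *: x) = k%:A *: hc g x.
Proof.
apply: (hcE (y := fun g => k%:A *: hc g x)); split.
  by move=> h; apply: module_partK; exact: hc_part.
have [_ [s [us sx xs]]] := hcP x; exists s; split=> //.
  by move=> h /sx ->; rewrite scaler0.
by rewrite {1}xs scaler_sumr.
Qed.

Lemma hc_id M g (x : M) : module_part g x -> hc g x = x.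
Proof.
move=> gx; have /hcE -> := decomposes_part (@module_part0 _ _ _ _ M) gx.
by rewrite eqxx.
Qed.

Lemma hc0 M g : hc g (0 : M) = 0.
Proof. by apply: hc_id; exact: module_part0. Qed.

Lemma hc_neq M g h (x : M) : module_part g x -> h != g -> hc h x = 0.
Proof.
move=> gx /negbTE hg; have /hcE -> := decomposes_part (@module_part0 _ _ _ _ M) gx.
by rewrite hg.
Qed.

Lemma hc_inj M (x y : M) : (forall g, hc g x = hc g y) -> x = y.
Proof.
move=> xy; have [_ [s [us sx xs]]] := hcP x; rewrite [LHS]xs.
rewrite [RHS](decomposes_sum (hcP y) us); last by move=> g /sx; rewrite xy.
by apply: eq_bigr.
Qed.

(** A graded module carries only an A-action, so K acts through [k%:A]. Maps are bare functions with
    predicates, since many maps below are K-linear but not A-linear, and some have nonzero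
    degree. *)
Definition klin M N (f : M -> N) :=
  forall (k : K) x y, f (k%:A *: x + y) = k%:A *: f x + f y.

Definition alin M N (f : M -> N) := forall (r : A) x y, f (r *: x + y) = r *: f x + f y.

Definition gmap (e : G) M N (f : M -> N) :=
  klin f /\ forall g x, module_part g x -> module_part (g + e) (f x).

Lemma alin_klin M N (f : M -> N) : alin f -> klin f.
Proof. by move=> lf k. Qed.

Section KlinTheory.
Variables (M N : graded_module deg) (f : M -> N) (lf : klin f).
Lemma klinD x y : f (x + y) = f x + f y.
Proof. by have := lf 1 x y; rewrite !scale1r. Qed.
Lemma klin0 : f 0 = 0.
Proof. by apply: (addrI (f 0)); rewrite -klinD !addr0. Qed.
Lemma klinZ (k : K) x : f (k%:A *: x) = k%:A *: f x.
Proof. by have := lf k x 0; rewrite klin0 !addr0. Qed.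
Lemma klinN x : f (- x) = - f x.
Proof. by apply: (addrI (f x)); rewrite -klinD !subrr klin0. Qed.
Lemma klinB x y : f (x - y) = f x - f y.
Proof. by rewrite klinD klinN. Qed.
Lemma klin_sum (I : Type) (r : seq I) (P : pred I) (x : I -> M) :
  f (\sum_(i <- r | P i) x i) = \sum_(i <- r | P i) f (x i).
Proof. by apply: (big_morph f klinD klin0). Qed.
End KlinTheory.

Lemma alinZ M N (f : M -> N) (lf : alin f) r x : f (r *: x) = r *: f x.
Proof.
by have := lf r x 0; rewrite (klin0 (alin_klin lf)) !addr0.
Qed.

Lemma hc_gmap M N (f : M -> N) : gmap 0 f -> forall g x, hc g (f x) = f (hc g x).
Proof.
move=> [lf gf] g x; apply: (hcE (y := fun g => f (hc g x))).
have [_ [s [us sx xs]]] := hcP x; split.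
  by move=> h; rewrite -[X in module_part X _]addr0; apply: gf; exact: hc_part.
exists s; split=> //; first by move=> h /sx ->; exact: klin0.
by rewrite {1}xs klin_sum.
Qed.

Lemma gmap_comp e e' M N P (f : M -> N) (f' : N -> P) :
  gmap e f -> gmap e' f' -> gmap (e + e') (f' \o f).
Proof.
move=> [lf gf] [lf' gf']; split=> [k x y|g x gx] /=; first by rewrite lf lf'.
by rewrite addrA; apply/gf'/gf.
Qed.

Lemma gmap_comp0 e M N P (f : M -> N) (f' : N -> P) :
  gmap e f -> gmap 0 f' -> gmap e (f' \o f).
Proof. by move=> gf gf'; have := gmap_comp gf gf'; rewrite addr0. Qed.


Lemma gmap_id M : gmap 0 (@id M).
Proof. by split=> // g x; rewrite addr0. Qed.

Lemma gmap_add e M N (f f' : M -> N) : gmap e f -> gmap e f' ->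
  gmap e (fun x => f x + f' x).
Proof.
move=> [lf gf] [lf' gf']; split=> [k x y|g x gx].
  by rewrite lf lf' scalerDr addrACA.
by apply: module_partD; [exact: gf|exact: gf'].
Qed.

Lemma gmap_opp e M N (f : M -> N) : gmap e f -> gmap e (fun x => - f x).
Proof.
move=> [lf gf]; split=> [k x y|g x gx]; first by rewrite lf opprD scalerN.
by apply: module_partN; exact: gf.
Qed.

Lemma gmap_sub e M N (f f' : M -> N) : gmap e f -> gmap e f' ->
  gmap e (fun x => f x - f' x).
Proof. by move=> gf gf'; apply: gmap_add => //; exact: gmap_opp. Qed.

Lemma gmap_scale M (r : A) e : deg e r -> gmap e (fun x : M => r *: x).
Proof.
move=> er; split=> [k x y|g x gx]; last by rewrite addrC; exact: module_partZ.
by rewrite scalerDr !scalerA mulrC.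
Qed.

Lemma gmap_0 e M N : gmap e (fun _ : M => 0 : N).
Proof.
by split=> [k x y|g x _]; [rewrite scaler0 addr0|exact: module_part0].
Qed.

(* A maximal partial K-linear map Y -> X that inverts f on its image is
   everywhere defined. *)
Lemma pseudo_inverse M N (f : M -> N) : klin f ->
  exists s : N -> M, klin s /\ forall x, f (s (f x)) = f x.
Proof.
move=> lf.
(* Zorn's lemma also asks about the empty chain, whose union is empty; adding [(0, 0)] lets the
   empty set stand for the graph of the map on the zero space. *)
pose with0 (D : set (N * M)) : set (N * M) := fun p => p = (0, 0) \/ D p.
pose Q (D : set (N * M)) :=
  [/\ forall (k : K) p q, with0 D p -> with0 D q ->
        with0 D (k%:A *: p.1 + q.1, k%:A *: p.2 + q.2),
      forall x, with0 D (0, x) -> x = 0 &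
      forall x y, with0 D (f x, y) -> f y = f x].
have [F FP Ftot|D [[D1 D2 D3] Dmax]] := @Zorn_bigcup (N * M)%type Q.
  have lift p q : with0 (\bigcup_(X in F) X) p -> with0 (\bigcup_(X in F) X) q ->
     (p = (0, 0) /\ q = (0, 0)) \/ exists2 X, F X & with0 X p /\ with0 X q.
    case=> [->|[X FX Xp]] [->|[Z FZ Zq]]; first by left.
    - by right; exists Z => //; split; [left|right].
    - by right; exists X => //; split; [right|left].
    - right; have [XZ|ZX] := Ftot _ _ FX FZ.
        by exists Z => //; split; right => //; exact: XZ.
      by exists X => //; split; right => //; exact: ZX.
  split.
  - move=> k p q Fp Fq; have [[-> ->]|[X FX [Xp Xq]]] := lift _ _ Fp Fq.
      by left; rewrite /= !scaler0 !addr0.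
    have [X1 _ _] := FP _ FX; have [->|Xpq] := X1 k _ _ Xp Xq; first by left.
    by right; exists X.
  - move=> x Fx; have [[[->] _]//|[X FX [Xx _]]] := lift _ _ Fx Fx.
    by have [_ X2 _] := FP _ FX; exact: X2.
  - move=> x y Fxy; have [[[-> ->] _]|[X FX [Xx _]]] := lift _ _ Fxy Fxy.
      by rewrite (klin0 lf).
    by have [_ _ X3] := FP _ FX; exact: X3.
have total y0 : exists x0, with0 D (y0, x0).
  apply: contrapT => nex.
  (* If some [y0 + y1] with [y1] in the domain is a value [f x'], then [x0] is forced to be
     [x' - x1] modulo the kernel of [f]; if there is none, any value will do. *)
  have [x0 x0P] : exists x0 : M, forall (k : K) y1 x1 x, with0 D (y1, x1) ->
      k%:A *: y0 + y1 = f x -> f (k%:A *: x0 + x1) = f x.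
    have [[y1 [x1 [x' [D11 fx']]]]|no] := pselect (exists y1 x1 x', with0 D (y1, x1)
        /\ y0 + y1 = f x').
      exists (x' - x1) => k y2 x2 x D22 fx.
      have y2E : f (x - k%:A *: x') = y2 - k%:A *: y1.
        rewrite (klinB lf) (klinZ lf) -fx -fx' scalerDr opprD addrACA.
        by rewrite subrr add0r.
      have := D1 (- k) _ _ D11 D22; rewrite /= !scaleNr => D12.
      have : with0 D (f (x - k%:A *: x'), - (k%:A *: x1) + x2).
        by rewrite y2E [y2 - _]addrC.
      move=> /D3; rewrite (klinB lf) (klinZ lf) => /eqP.
      rewrite eq_sym subr_eq => /eqP ->.
      rewrite -(klinZ lf) -(klinD lf); congr f.
      by rewrite scalerBr -addrA addrC.
    exists 0 => k y1 x1 x D11 fx; have [k0|k0] := eqVneq k 0.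
      move: fx; rewrite k0 scale0r !scale0r !add0r => fx.
      by apply: D3; rewrite -fx.
    case: no; exists (k^-1%:A *: y1), (k^-1%:A *: x1), (k^-1%:A *: x).
    split.
      have := D1 k^-1 _ (0, 0) D11 (or_introl erefl).
      by rewrite /= !addr0.
    rewrite (klinZ lf) -fx scalerDr scalerA -scalerAl mul1r scalerA.
    by rewrite mulVf // !scale1r.
  pose D' : set (N * M) := [set p | exists k q, with0 D q /\
     p = (k%:A *: y0 + q.1, k%:A *: x0 + q.2)].
  have D'0 : with0 D' = D'.
    rewrite eqEsubset; split=> [p [->|//]|p]; last by right.
    exists 0, (0, 0); split; first by left.
    by rewrite !scale0r /= !addr0.
  have y0D (k : K) q : with0 D q -> k%:A *: y0 + q.1 = 0 -> k = 0.
    move=> Dq e; apply: contrapT => /eqP k0; apply: nex.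
    exists (- k^-1%:A *: q.2).
    have := D1 (- k^-1) _ (0, 0) Dq (or_introl erefl).
    rewrite /= !addr0 !scaleNr; congr (with0 D (_, _)).
    have -> : q.1 = - (k%:A *: y0) by apply/eqP; rewrite -addr_eq0 addrC e.
    by rewrite scalerN opprK scalerA -scalerAl mul1r scalerA mulVf // !scale1r.
  case: (Dmax D'); last first.
    split; rewrite D'0.
    - move=> k p q [c [p' [Dp' ->]]] [e [q' [Dq' ->]]].
      exists (k * c + e), (k%:A *: p'.1 + q'.1, k%:A *: p'.2 + q'.2).
      split; first exact: D1.
      rewrite /= !scalerDr !scalerDl !scalerA -scalerAl mul1r scalerA.
      by congr (_, _); rewrite addrACA.
    - move=> x [k [q [Dq [e ->]]]]; have k0 := y0D _ _ Dq (esym e).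
      move: e; rewrite k0 !scale0r !add0r => e; apply: D2; rewrite e.
      by rewrite -surjective_pairing.
    - move=> x y [k [q [Dq [e ->]]]]; apply: (x0P k q.1) => //.
      by rewrite -surjective_pairing.
  split=> [p Dp|sub].
    by exists 0, p; split; [right|rewrite !scale0r !add0r -surjective_pairing].
  apply: nex; exists x0; right; apply: sub.
  exists 1, (0, 0); split; first by left.
  by rewrite /= !scale1r !addr0.
pose s y := sval (cid (total y)).
have sP y : with0 D (y, s y) := svalP (cid (total y)).
have s_uniq y x : with0 D (y, x) -> x = s y.
  move=> Dx; apply/eqP; rewrite -subr_eq0; apply/eqP/D2.
  have := D1 (-1) _ _ (sP y) Dx; rewrite /= !scaleN1r.
  by rewrite addNr [- s y + x]addrC.
exists s; split=> [k x y|x]; last exact/D3.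
by apply/esym/s_uniq; exact: D1 (sP x) (sP y).
Qed.

(** Only the diagonal part of [s] is kept: the degree [g] component of [t y] is that of [s] applied
    to the degree [g] component of [y]. As [f] preserves degrees, the diagonal part is still a
    pseudo-inverse. *)
Lemma graded_pseudo_inverse M N (f : M -> N) : gmap 0 f ->
  exists s : N -> M, gmap 0 s /\ forall x, f (s (f x)) = f x.
Proof.
move=> gf; have [s [ls fs]] := pseudo_inverse gf.1.
have ex y : exists x, forall g, hc g x = hc g (s (hc g y)).
  have [_ [r [ur ry _]]] := hcP y.
  exists (\sum_(g <- r) hc g (s (hc g y))).
  apply: hcE; split; first by move=> g; exact: hc_part.
  exists r; split=> // g /ry ->; rewrite (klin0 ls).
  exact: hc0.
pose t y := sval (cid (ex y)).
have tP y g : hc g (t y) = hc g (s (hc g y)) := svalP (cid (ex y)) g.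
exists t; split; first split.
- by move=> k x y; apply: hc_inj => g; rewrite hcD hcK !tP hcD hcK ls hcD hcK.
- move=> g x gx; rewrite addr0 (_ : t x = hc g (t x)); first exact: hc_part.
  apply: hc_inj => h; have [->|hg] := eqVneq h g; first by rewrite [RHS]hc_id //; exact: hc_part.
  rewrite [RHS](hc_neq (hc_part _ _) hg) tP (hc_neq gx hg) (klin0 ls).
  exact: hc0.
- move=> x; apply: hc_inj => g; rewrite (hc_gmap gf) tP -(hc_gmap gf).
  have -> : hc g (f x) = f (hc g x) by exact: hc_gmap.
  rewrite fs hc_id //.
  by rewrite -(hc_gmap gf); exact: hc_part.
Qed.

(** Writes the identity of [N] through [f] and [f'] by K-linear graded maps. Such an identity
    survives every construction that is functorial and additive in these maps, which therefore
    preserves exactness. *)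
Lemma exact_splitting M N P (f : M -> N) (f' : N -> P) : gmap 0 f -> gmap 0 f' ->
  (forall y, f' y = 0 -> exists x, y = f x) ->
  exists (s : N -> M) (t : P -> N),
    [/\ gmap 0 s, gmap 0 t & forall y, y = f (s y) + t (f' y)].
Proof.
move=> gf gf' ex; have [s [gs sP]] := graded_pseudo_inverse gf.
have [t [gt tP]] := graded_pseudo_inverse gf'.
exists (fun y => s (y - t (f' y))), t; split=> // [|y].
  apply: (gmap_comp0 (f := fun y => y - t (f' y))) => //.
  apply: gmap_sub; first exact: gmap_id.
  exact: (gmap_comp0 gf').
have /ex [x xE] : f' (y - t (f' y)) = 0 by rewrite (klinB gf'.1) tP subrr.
by rewrite xE sP -xE subrK.
Qed.
End Graded.

(** * Coinduced modules *)

Section Coinduced.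
Variables (K : fieldType) (G : zmodType) (A : comAlgType K) (deg : grading G A).
Variable M : graded_module deg.

Lemma ring_dec_ex (r : A) : exists y, decomposes deg r y.
Proof.
exact: decomposes_ex (@degree_part0 _ _ _ deg) (@degree_partD _ _ _ deg)
  (@degree_part_direct _ _ _ deg) r.
Qed.

Definition homog (g : G) (phi : A -> M) :=
  (forall (k : K) r r', phi (k *: r + r') = k%:A *: phi r + phi r') /\
  forall h r, deg h r -> module_part (h + g) (phi r).

Lemma homog0 g : homog g 0.
Proof. by split=> [k r r'|h r _]; [rewrite scaler0 addr0|exact: module_part0]. Qed.

Lemma homogD g phi psi : homog g phi -> homog g psi -> homog g (phi + psi).
Proof.
move=> [lf gf] [lf' gf']; split=> [k r r'|h r hr]; rewrite !fctE.
  by rewrite lf lf' scalerDr addrACA.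
by apply: module_partD; [exact: gf|exact: gf'].
Qed.

(** Finite sums of homogeneous K-linear maps: the graded Hom instead of all K-linear maps, so that
    the module is the direct sum of its degrees. *)
Definition coind_pred (phi : A -> M) := exists y, decomposes homog phi y.

Lemma coind_predD phi psi : coind_pred phi -> coind_pred psi -> coind_pred (phi + psi).
Proof.
move=> [y dy] [z dz]; exists (fun g => y g + z g).
exact: (decomposesD homogD).
Qed.

Lemma coind_pred0 : coind_pred 0.
Proof. by exists (fun=> 0); exact: decomposes0 homog0. Qed.

Lemma coind_pred_homog g phi : homog g phi -> coind_pred phi.
Proof. by move=> gphi; eexists; exact: decomposes_part homog0 _ _ gphi. Qed.

Lemma coind_pred_sum (I : Type) (r : seq I) (F : I -> (A -> M)) :
  (forall i, coind_pred (F i)) -> coind_pred (\sum_(i <- r) F i).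
Proof. by move=> cF; elim/big_ind: _ => //; [exact: coind_pred0|exact: coind_predD]. Qed.

Lemma coind_linear phi : coind_pred phi ->
  forall (k : K) r r', phi (k *: r + r') = k%:A *: phi r + phi r'.
Proof.
move=> [y [hy [s [_ _ ->]]]] k r r'; elim: s => [|g s IHs].
  by rewrite !big_nil (_ : forall a : A, (0 : A -> M) a = 0) // scaler0 addr0.
by rewrite !big_cons !fctE IHs (hy g).1 scalerDr addrACA.
Qed.

Lemma homog_shift e g r phi : deg e r -> homog g phi ->
  homog (e + g) (fun r' => phi (r * r')).
Proof.
move=> er [lf gf]; split=> [k x x'|h x hx].
  by rewrite mulrDr -scalerAr lf.
by rewrite addrCA addrA; apply: gf; exact: degree_partM.
Qed.

Lemma fct_sumE (T : Type) (V : zmodType) (I : Type) (r : seq I) (F : I -> (T -> V)) x :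
  (\sum_(i <- r) F i) x = \sum_(i <- r) F i x.
Proof. by elim/big_rec2: _ => // i y z _ <-. Qed.

Lemma coind_pred_shift r phi : coind_pred phi -> coind_pred (fun r' => phi (r * r')).
Proof.
move=> cphi; have lphi := coind_linear cphi.
have [x [dx [s [_ _ ->]]]] := ring_dec_ex r.
have [y [dy [t [_ _ phiE]]]] := cphi.
rewrite (_ : (fun _ => _) = \sum_(g <- s) \sum_(h <- t) (fun r' => y h (x g * r'))).
  apply: coind_pred_sum => g; apply: coind_pred_sum => h.
  by apply: (coind_pred_homog (g := g + h)); exact: homog_shift.
apply/funext => r'; rewrite fct_sumE mulr_suml.
have phi0 : phi 0 = 0.
  by have := lphi (-1) 0 0; rewrite scaler0 addr0 !scaleN1r addNr.
have phiD a b : phi (a + b) = phi a + phi b.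
  by have := lphi 1 a b; rewrite !scale1r.
rewrite (big_morph phi phiD phi0); apply: eq_bigr => g _.
by rewrite {1}phiE !fct_sumE.
Qed.

Record coind := Coind { coind_fun :> A -> M; coindP : coind_pred coind_fun }.

HB.instance Definition _ := gen_eqMixin coind.
HB.instance Definition _ := gen_choiceMixin coind.

Lemma coind_eq (phi psi : coind) : phi =1 psi -> phi = psi.
Proof.
case: phi psi => [f Pf] [g Pg] /= /funext fg; case: _ / fg in Pg *.
by congr Coind.
Qed.

Lemma coind_predN phi : coind_pred phi -> coind_pred (- phi).
Proof.
move=> cphi; have := coind_pred_shift (-1) cphi; congr coind_pred.
apply/funext => r; rewrite mulN1r fctE.
have := coind_linear cphi (-1) r 0; rewrite addr0 !scaleN1r => ->.
by have := coind_linear cphi (-1) 0 0; rewrite scaler0 addr0 !scaleN1r addNr => ->; rewrite addr0.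
Qed.

Definition coind_zero := Coind coind_pred0.
Definition coind_opp (phi : coind) := Coind (coind_predN (coindP phi)).
Definition coind_add (phi psi : coind) := Coind (coind_predD (coindP phi) (coindP psi)).
Definition coind_scale (r : A) (phi : coind) := Coind (coind_pred_shift r (coindP phi)).

Fact coind_addA : associative coind_add.
Proof. by move=> f g h; apply: coind_eq => r /=; rewrite !fctE addrA. Qed.
Fact coind_addC : commutative coind_add.
Proof. by move=> f g; apply: coind_eq => r /=; rewrite !fctE addrC. Qed.
Fact coind_add0 : left_id coind_zero coind_add.
Proof. by move=> f; apply: coind_eq => r /=; rewrite !fctE add0r. Qed.
Fact coind_addN : left_inverse coind_zero coind_opp coind_add.
Proof. by move=> f; apply: coind_eq => r /=; rewrite !fctE addNr. Qed.
HB.instance Definition _ :=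
  GRing.isZmodule.Build coind coind_addA coind_addC coind_add0 coind_addN.

Fact coind_scaleA a b f : coind_scale a (coind_scale b f) = coind_scale (a * b) f.
Proof. by apply: coind_eq => r /=; rewrite mulrA [b * a]mulrC. Qed.
Fact coind_scale1 : left_id 1 coind_scale.
Proof. by move=> f; apply: coind_eq => r /=; rewrite mul1r. Qed.
Fact coind_scaleDr : right_distributive coind_scale +%R.
Proof. by move=> a f g; apply: coind_eq => r. Qed.
Fact coind_scaleDl f : {morph coind_scale^~ f : a b / a + b}.
Proof.
move=> a b; apply: coind_eq => r /=; rewrite !fctE mulrDl.
by have := coind_linear (coindP f) 1 (a * r) (b * r); rewrite !scale1r.
Qed.
HB.instance Definition _ := GRing.Zmodule_isLmodule.Build A coind
  coind_scaleA coind_scale1 coind_scaleDr coind_scaleDl.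

Lemma coindD (phi psi : coind) r : (phi + psi) r = phi r + psi r.
Proof. by []. Qed.
Lemma coindN (phi : coind) r : (- phi) r = - phi r.
Proof. by []. Qed.
Lemma coindZ a (phi : coind) r : (a *: phi) r = phi (a * r).
Proof. by []. Qed.
Lemma coind_sum (I : Type) (s : seq I) (F : I -> coind) r :
  (\sum_(i <- s) F i) r = \sum_(i <- s) F i r.
Proof. by elim/big_rec2: _ => // i y z _ <-. Qed.
Lemma coindL (phi : coind) (k : K) r r' :
  phi (k *: r + r') = k%:A *: phi r + phi r'.
Proof. exact: coind_linear (coindP phi) _ _ _. Qed.
Lemma coindDr (phi : coind) r r' : phi (r + r') = phi r + phi r'.
Proof. by have := coindL phi 1 r r'; rewrite !scale1r. Qed.
Lemma coind0r (phi : coind) : phi 0 = 0.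
Proof. by apply: (addrI (phi 0)); rewrite -coindDr !addr0. Qed.
Lemma coindZr (phi : coind) (k : K) r : phi (k *: r) = k%:A *: phi r.
Proof. by have := coindL phi k r 0; rewrite coind0r !addr0. Qed.
Lemma coind_sumr (phi : coind) (I : Type) (s : seq I) (F : I -> A) :
  phi (\sum_(i <- s) F i) = \sum_(i <- s) phi (F i).
Proof. exact: (big_morph phi (coindDr phi) (coind0r phi)). Qed.

Definition coind_part g (phi : coind) := homog g phi.

Lemma coind_part0 g : coind_part g 0.
Proof. exact: homog0. Qed.

Lemma coind_partD g x y : coind_part g x -> coind_part g y -> coind_part g (x + y).
Proof. exact: homogD. Qed.

Lemma coind_partZ g h a x : deg g a -> coind_part h x -> coind_part (g + h) (a *: x).
Proof. exact: homog_shift. Qed.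

Lemma coind_part_direct : direct_decomposition coind_part.
Proof.
apply: (direct_decompositionP coind_part0).
  move=> phi; have [y [hy [s [us ys phiE]]]] := coindP phi.
  exists (fun g => Coind (coind_pred_homog (hy g))); split; first exact: hy.
  exists s; split=> //; first by move=> g /ys yg; apply: coind_eq => r /=; rewrite yg.
  by apply: coind_eq => r; rewrite phiE coind_sum fct_sumE.
(* For uniqueness, evaluate at a homogeneous [x h]: the values [y g (x h)] lie in the distinct
   degrees [h + g] of [M], so each of them vanishes. *)
move=> y [hy [s [us ys sum0]]] g; apply: coind_eq => r.
have [x [dx [t [_ _ ->]]]] := ring_dec_ex r.
rewrite !coind_sumr; apply: eq_bigr => h _.
have dz : mdec (0 : M) (fun k => y (k - h) (x h)).
  split; first by move=> k; have := (hy (k - h)).2 h _ (dx h); rewrite addrC subrK.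
  exists [seq h + g | g <- s]; split.
  - by rewrite map_inj_uniq //; exact: addrI.
  - move=> k ks; rewrite ys //; apply: contra ks => ks; apply/mapP.
    by exists (k - h) => //; rewrite addrC subrK.
  - rewrite big_map; under eq_bigr do rewrite addrAC subrr add0r.
    by rewrite -coind_sum -sum0.
have := mdec_uniq dz (decomposes0 (@module_part0 _ _ _ _ M)) (h + g).
by rewrite addrAC subrr add0r.
Qed.

Definition CI : graded_module deg :=
  @GradedModule K G A deg coind coind_part coind_part0 coind_partD coind_partZ
    coind_part_direct.

(* Elements of [CI] are built from functions, with junk value 0 on functions that
   are not coinduced. *)
Definition coind_mk (phi : A -> M) : CI :=
  if pselect (coind_pred phi) is left c then Coind c else 0.

Lemma coind_mkE phi : coind_pred phi -> (coind_mk phi : coind) =1 phi.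
Proof. by rewrite /coind_mk; case: pselect. Qed.

Definition eta (x : M) : CI := coind_mk (fun r => r *: x).

Lemma etaE x r : (eta x : coind) r = r *: x.
Proof.
apply: coind_mkE; have [_ [s [_ _ ->]]] := hcP x.
rewrite (_ : (fun _ => _) = \sum_(g <- s) (fun r => r *: hc g x)); last first.
  by apply/funext => a; rewrite fct_sumE scaler_sumr.
apply: coind_pred_sum => g; apply: (coind_pred_homog (g := g)).
split=> [k a b|h a ha]; first by rewrite scalerDl scalerA mulr_algl.
by apply: module_partZ => //; exact: hc_part.
Qed.

Lemma eta_alin : alin eta.
Proof.
move=> r x y; apply: coind_eq => a.
by rewrite coindD coindZ !etaE scalerDr scalerA mulrC.
Qed.

Lemma eta_gmap : gmap 0 eta.
Proof.
split; first exact: alin_klin eta_alin.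
move=> g x gx; rewrite addr0; split=> [k a b|h a ha].
  by rewrite coindL.
by rewrite etaE; exact: module_partZ.
Qed.

Definition ev (r : A) (phi : CI) : M := (phi : coind) r.

Lemma ev_gmap e r : deg e r -> gmap e (ev r).
Proof.
move=> er; split=> [k x y|g x [_ gx]]; last by rewrite addrC; exact: gx.
by rewrite /ev coindD coindZ mulr_algl coindZr.
Qed.
End Coinduced.

Section CoinducedMap.
Variables (K : fieldType) (G : zmodType) (A : comAlgType K) (deg : grading G A).
Implicit Types M N P E : graded_module deg.

Definition ci_map M N (f : M -> N) (phi : CI M) : CI N :=
  coind_mk (fun r => f ((phi : coind M) r)).

Lemma homog_comp e M N (f : M -> N) : gmap e f -> forall g (phi : A -> M),
  homog g phi -> homog (g + e) (f \o phi).
Proof.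
move=> [lf gf] g phi [lp gp]; split=> [k r r'|h r hr] /=; first by rewrite lp lf.
by rewrite addrA; apply/gf/gp.
Qed.

Lemma ci_mapE e M N (f : M -> N) : gmap e f ->
  forall (phi : CI M) r, (ci_map f phi : coind N) r = f ((phi : coind M) r).
Proof.
move=> gf phi r; rewrite coind_mkE //.
have [y [hy [s [_ _ phiE]]]] := coindP phi.
rewrite (_ : (fun _ => _) = \sum_(g <- s) (f \o y g)).
  apply: coind_pred_sum => g; apply: coind_pred_homog.
  exact: homog_comp gf _ _ (hy g).
apply/funext => a; rewrite phiE fct_sumE fct_sumE.
exact: (klin_sum gf.1).
Qed.

(** The ring acts on arguments and [f] on values, so the two commute although [f] is only
    K-linear. *)
Lemma ci_map_alin e M N (f : M -> N) : gmap e f -> alin (ci_map f).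
Proof.
move=> gf r x y; apply: coind_eq => a.
by rewrite coindD coindZ !(ci_mapE gf) coindD coindZ (klinD gf.1).
Qed.

Lemma ci_map_gmap e M N (f : M -> N) : gmap e f -> gmap e (ci_map f).
Proof.
move=> gf; split; first exact: alin_klin (ci_map_alin gf).
move=> g phi gphi; have := homog_comp gf gphi.
by congr homog; apply/funext => r; rewrite (ci_mapE gf).
Qed.

Lemma ci_map_comp e e' M N P (f : M -> N) (f' : N -> P) : gmap e f -> gmap e' f' ->
  forall x, ci_map (f' \o f) x = ci_map f' (ci_map f x).
Proof.
move=> gf gf' x; apply: coind_eq => a.
by rewrite (ci_mapE gf') (ci_mapE gf) (ci_mapE (gmap_comp gf gf')).
Qed.

Lemma ci_map_id M (x : CI M) : ci_map id x = x.
Proof. by apply: coind_eq => a; rewrite (ci_mapE (gmap_id M)). Qed.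

Lemma ci_mapD e M N (f f' : M -> N) : gmap e f -> gmap e f' ->
  forall x, ci_map (fun x => f x + f' x) x = ci_map f x + ci_map f' x.
Proof.
move=> gf gf' x; apply: coind_eq => a.
by rewrite coindD (ci_mapE gf) (ci_mapE gf') (ci_mapE (gmap_add gf gf')).
Qed.

Lemma ci_mapN e M N (f : M -> N) : gmap e f ->
  forall x, ci_map (fun x => - f x) x = - ci_map f x.
Proof.
move=> gf x; apply: coind_eq => a.
by rewrite coindN (ci_mapE gf) (ci_mapE (gmap_opp gf)).
Qed.

Lemma ci_mapB e M N (f f' : M -> N) : gmap e f -> gmap e f' ->
  forall x, ci_map (fun x => f x - f' x) x = ci_map f x - ci_map f' x.
Proof.
by move=> gf gf' x; rewrite (ci_mapD gf (gmap_opp gf')) (ci_mapN gf').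
Qed.

Lemma ci_map0 M N (x : CI M) : ci_map (fun _ : M => 0 : N) x = 0.
Proof. by apply: coind_eq => a; rewrite (ci_mapE (gmap_0 0 M N)). Qed.

Lemma ci_mapZ (k : K) M N (f : N -> M) : gmap 0 f -> forall x,
  ci_map (fun x => k%:A *: f x) x = k%:A *: ci_map f x.
Proof.
move=> gf x; apply: coind_eq => a.
have gk : gmap 0 (fun x => k%:A *: f x).
  exact: (gmap_comp0 gf (gmap_scale M (deg_scalar deg k))).
rewrite (ci_mapE gk) coindZ (ci_mapE gf).
by rewrite mulr_algl coindZr (klinZ gf.1).
Qed.

Lemma eq_ci_map M N (f f' : M -> N) : f =1 f' -> ci_map f =1 ci_map f'.
Proof. by move=> /funext ->. Qed.

Lemma eta_natural e M N (f : M -> N) : alin f -> gmap e f -> forall x,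
  eta (f x) = ci_map f (eta x).
Proof.
by move=> lf gf x; apply: coind_eq => a; rewrite (ci_mapE gf) !etaE (alinZ lf).
Qed.
End CoinducedMap.

(** * The cobar resolution *)

Section Cobar.
Variables (K : fieldType) (G : zmodType) (A : comAlgType K) (deg : grading G A).
Implicit Types M N P E : graded_module deg.

Fixpoint cobar M n : graded_module deg :=
  if n is n'.+1 then CI (cobar M n') else M.

Fixpoint cobar_map M N (f : M -> N) n : cobar M n -> cobar N n :=
  match n with
  | 0 => f
  | m.+1 => ci_map (@cobar_map M N f m)
  end.

(** The alternating sum of the units inserted at the successive places, written recursively: the
    unit at the outermost place minus the differential applied to the values. *)
Fixpoint cobar_d M n : cobar M n -> cobar M n.+1 :=
  match n with
  | 0 => @eta K G A deg M
  | m.+1 => fun x => eta x - ci_map (@cobar_d M m) x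
  end.

Lemma cobar_map_gmap e M N (f : M -> N) n : gmap e f -> gmap e (cobar_map f (n := n)).
Proof. by move=> gf; elim: n => //= n IHn; exact: ci_map_gmap. Qed.

Lemma cobar_map_alin e M N (f : M -> N) n :
  gmap e f -> alin (cobar_map f (n := n.+1)).
Proof. by move=> gf; exact: ci_map_alin (cobar_map_gmap n gf). Qed.

Lemma cobar_mapS M N (f : M -> N) n (x : cobar M n.+1) :
  cobar_map f x = ci_map (cobar_map f (n := n)) x.
Proof. by []. Qed.

Lemma cobar_map_comp e e' M N P (f : M -> N) (f' : N -> P) n :
  gmap e f -> gmap e' f' ->
  forall x : cobar M n, cobar_map (f' \o f) x = cobar_map f' (cobar_map f x).
Proof.
move=> gf gf'; elim: n => //= n IHn x.
rewrite -(ci_map_comp (cobar_map_gmap n gf) (cobar_map_gmap n gf')).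
by apply: eq_ci_map => y; rewrite IHn.
Qed.

Lemma cobar_map_id M n (x : cobar M n) : cobar_map id x = x.
Proof.
elim: n x => //= n IHn x; rewrite -[RHS]ci_map_id.
by apply: eq_ci_map => y; rewrite IHn.
Qed.

Lemma cobar_mapD e M N (f f' : M -> N) n : gmap e f -> gmap e f' ->
  forall x : cobar M n,
  cobar_map (fun x => f x + f' x) x = cobar_map f x + cobar_map f' x.
Proof.
move=> gf gf'; elim: n => //= n IHn x.
rewrite -(ci_mapD (cobar_map_gmap n gf) (cobar_map_gmap n gf')).
by apply: eq_ci_map => y; rewrite IHn.
Qed.

Lemma cobar_map0 M N n (x : cobar M n) : cobar_map (fun _ : M => 0 : N) x = 0.
Proof.
elim: n x => //= n IHn x; rewrite -[RHS](ci_map0 _ x).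
by apply: eq_ci_map => y; rewrite IHn.
Qed.

Lemma cobar_mapZ (k : K) M N (f : M -> N) n : gmap 0 f ->
  forall x : cobar M n,
  cobar_map (fun x => k%:A *: f x) x = k%:A *: cobar_map f x.
Proof.
move=> gf; elim: n => //= n IHn x.
rewrite -(ci_mapZ k (cobar_map_gmap n gf)).
by apply: eq_ci_map => y; rewrite IHn.
Qed.

Lemma cobar_d_spec M n : alin (cobar_d (M := M) (n := n)) /\
  gmap 0 (cobar_d (M := M) (n := n)).
Proof.
elim: n => [|n [IHa IHg]] /=; first by split; [exact: eta_alin|exact: eta_gmap].
split; last by apply: gmap_sub; [exact: eta_gmap|exact: ci_map_gmap].
move=> r x y; rewrite eta_alin (ci_map_alin IHg).
by rewrite opprD addrACA scalerBr.
Qed.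

Lemma cobar_d_alin M n : alin (cobar_d (M := M) (n := n)).
Proof. exact: (cobar_d_spec M n).1. Qed.
#[local] Arguments cobar_d_alin : clear implicits.

Lemma cobar_d_gmap M n : gmap 0 (cobar_d (M := M) (n := n)).
Proof. exact: (cobar_d_spec M n).2. Qed.

Lemma cobar_dS M n (x : cobar M n.+1) :
  cobar_d x = eta x - ci_map (cobar_d (M := M) (n := n)) x.
Proof. by []. Qed.

Lemma cobar_d_natural e M N (f : M -> N) n : alin f -> gmap e f ->
  forall x : cobar M n, cobar_d (cobar_map f x) = cobar_map f (cobar_d x).
Proof.
move=> lf gf; elim: n => [|n IHn] x; first exact: (eta_natural lf gf).
rewrite !cobar_dS (eta_natural (cobar_map_alin gf) (cobar_map_gmap _ gf)).
have gS : gmap e (cobar_map f (n := n.+1)) by exact: cobar_map_gmap.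
rewrite [RHS](klinB (ci_map_gmap gS).1); congr (_ - _).
rewrite -(ci_map_comp (cobar_map_gmap n gf) (cobar_d_gmap _ _)).
rewrite -(ci_map_comp (cobar_d_gmap _ _) gS).
by apply: eq_ci_map => y /=; rewrite IHn.
Qed.

(** Naturality of [eta] for the A-linear differential gives
    [d (d x) = B d (eta x - d x) = B (d d) x], with [d d] one level down. *)
Lemma cobar_dK M n (x : cobar M n) : cobar_d (cobar_d x) = 0.
Proof.
elim: n x => [|n IHn] x.
  by rewrite cobar_dS /= (eta_natural (@eta_alin _ _ _ _ M) (eta_gmap M)) subrr.
rewrite cobar_dS (eta_natural (cobar_d_alin _ _) (cobar_d_gmap _ _)).
rewrite -(klinB (ci_map_gmap (cobar_d_gmap M n.+1)).1) cobar_dS subKr.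
rewrite -(ci_map_comp (cobar_d_gmap _ _) (cobar_d_gmap _ _)).
by rewrite -[RHS](ci_map0 _ x); apply: eq_ci_map => y; exact: IHn.
Qed.

(** Evaluation at 1 is a contraction. It is only K-linear and need not keep torsion, so nothing
    follows for the torsion parts. *)
Lemma cobar_exact M n (x : cobar M n.+1) : cobar_d x = 0 -> x = cobar_d (ev 1 x).
Proof.
move=> /eqP; rewrite cobar_dS subr_eq0 => /eqP /(congr1 (ev 1)).
by rewrite /ev etaE scale1r (ci_mapE (cobar_d_gmap _ _)).
Qed.

Lemma cobar_d0_inj M (x : M) : cobar_d (n := 0) x = 0 -> x = 0.
Proof. by move=> /(congr1 (ev 1)); rewrite /ev /= etaE scale1r. Qed.

(** * Contraction of the cobar complex of a retract of its coinduced module *)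

Section Retract.
Variables (E : graded_module deg) (rho : CI E -> E).
Hypotheses (rho_alin : alin rho) (rho_gmap : gmap 0 rho) (rhoK : cancel (@eta _ _ _ _ E) rho).

Fixpoint retract n : cobar E n.+1 -> cobar E n :=
  match n with
  | 0 => rho
  | m.+1 => ci_map (@retract m)
  end.

Lemma retract_gmap n : gmap 0 (retract (n := n)).
Proof. by elim: n => //= n IHn; exact: ci_map_gmap. Qed.

Lemma retract_alin n : alin (retract (n := n)).
Proof. by case: n => //= n; exact: ci_map_alin (retract_gmap n). Qed.

#[local] Arguments retract_alin : clear implicits.

(** [retract] applies [rho] at the innermost place. There it cancels the innermost unit, which
    carries the sign; it commutes with the other units by naturality. Being A-linear, unlike [ev 1],
    it keeps torsion. *)
Lemma retract_homotopy n (x : cobar E n.+1) :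
  retract (cobar_d x) = cobar_d (retract x) + (-1) ^+ n.+1 *: x.
Proof.
have retE m (y : cobar E m.+2) : retract y = ci_map (retract (n := m)) y by [].
have rd m (y : cobar E m.+1) : retract (cobar_d y) =
    eta (retract y) - ci_map (retract (n := m) \o cobar_d (n := m)) y.
  rewrite retE cobar_dS (klinB (ci_map_gmap (retract_gmap m)).1).
  rewrite -(eta_natural (retract_alin m) (retract_gmap m)).
  by rewrite -(ci_map_comp (cobar_d_gmap _ _) (retract_gmap m)).
elim: n x => [|n IHn] x; rewrite rd.
  rewrite expr1 scaleN1r; congr (_ - _); rewrite -[RHS]ci_map_id.
  by apply: eq_ci_map => y /=; rewrite rhoK.
rewrite cobar_dS retE.
rewrite (eq_ci_map (f' := fun y => cobar_d (retract y) + ((-1) ^+ n.+1)%:A *: y)); last first.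
  by move=> y; apply: etrans (IHn y) _; rewrite -in_algE rmorphXn rmorphN rmorph1.
have g1 := gmap_comp0 (retract_gmap n) (cobar_d_gmap E n).
have g2 := gmap_scale (cobar E n.+1) (deg_scalar deg ((-1) ^+ n.+1)).
rewrite (ci_mapD g1 g2) opprD addrA -(ci_map_comp (retract_gmap n) (cobar_d_gmap E n)).
congr (_ + _); rewrite (ci_mapZ _ (gmap_id _)) ci_map_id.
by rewrite -in_algE rmorphXn rmorphN rmorph1 [in RHS]exprS mulN1r scaleNr.
Qed.
End Retract.

Lemma injective_retract E : graded_injective E ->
  exists rho : CI E -> E, [/\ alin rho, gmap 0 rho & cancel (@eta _ _ _ _ E) rho].
Proof.
move=> injE.
pose j : {linear E -> CI E} := HB.pack (@eta K G A deg E)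
  (GRing.isLinear.Build A E (CI E) _ (@eta K G A deg E) (@eta_alin K G A deg E)).
have [||h hgr hj] := injE E (CI E) j idfun _ _ (fun _ _ h => h).
- by move=> g x gx; have := (eta_gmap E).2 g x gx; rewrite addr0.
- by move=> x y /(congr1 (ev 1)); rewrite /ev /= !etaE !scale1r.
have lh : alin h by move=> r x y; rewrite linearP.
exists h; split=> //; split; first exact: alin_klin.
by move=> g x gx; rewrite addr0; exact: hgr.
Qed.

(** * Outer and inner multiplication on the cobar complex *)

Section Homotopy.
Variables (r : A) (e : G) (er : deg e r) (M : graded_module deg).

(** Evaluates the factors after the outermost one at [r], with alternating signs. Inserting a unit
    next to an evaluation moves [r] by one place, so the homotopy carries multiplication by [r] from
    the outermost factor inwards to [M]. *)
Fixpoint homotopy n : cobar M n.+2 -> cobar M n.+1 :=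
  match n with
  | 0 => ci_map (ev r)
  | m.+1 => fun x => ci_map (ev r) x - ci_map (@homotopy m) x
  end.

Local Notation scale_r := (fun x : M => r *: x).

Lemma homotopy_spec n : alin (homotopy (n := n)) /\ gmap e (homotopy (n := n)).
Proof.
have ge N := ev_gmap N er.
elim: n => [|n [IHa IHg]] /=.
  by split; [exact: ci_map_alin (ge _)|exact: ci_map_gmap].
split; last by apply: gmap_sub; exact: ci_map_gmap.
move=> s x y; rewrite (ci_map_alin (ge _)) (ci_map_alin IHg).
by rewrite opprD addrACA scalerBr.
Qed.

Lemma homotopyS n (x : cobar M n.+3) :
  homotopy x = ci_map (ev r) x - ci_map (homotopy (n := n)) x.
Proof. by []. Qed.

Lemma homotopy0E (x : cobar M 2) : homotopy x = ci_map (ev r : CI M -> M) x.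
Proof. by []. Qed.

Lemma ev_eta N (x : N) : ev r (eta x) = r *: x.
Proof. by rewrite /ev etaE. Qed.

Lemma ci_ev_eta N (x : CI N) : ci_map (ev r) (eta x) = r *: x.
Proof.
apply: coind_eq => a; rewrite (ci_mapE (ev_gmap _ er)) etaE /ev !coindZ.
by rewrite mulrC.
Qed.

Lemma homotopy_cancel (V : zmodType) (a b z p f : V) :
  a - b + (z - p + b - (a - (p - f))) = z - f.
Proof.
rewrite opprB (addrACA (z - p)) addrCA addrA (addrC (a - b)) (addrA _ a) subrK.
by rewrite (addrC b) addrK addrA subrK.
Qed.

Lemma homotopy_move (V : zmodType) (a b u w y : V) :
  u + b - (a - (w - y)) = u + (b - y) - (a - w).
Proof.
by rewrite !opprB (addrAC w) (addrA (u + b)) (addrA u) (addrAC (u + b) (- y)).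
Qed.

Lemma homotopy0 (x : cobar M 1) :
  r *: x - cobar_map scale_r x = homotopy (cobar_d x).
Proof.
have ge N := ev_gmap N er.
rewrite homotopy0E cobar_dS (klinB (ci_map_gmap (ge M)).1).
rewrite ci_ev_eta -(ci_map_comp (eta_gmap _) (ge _)); congr (_ - _).
by apply: eq_ci_map => y /=; rewrite ev_eta.
Qed.

Lemma homotopyP n (x : cobar M n.+2) :
  r *: x - cobar_map scale_r x = cobar_d (homotopy x) + homotopy (cobar_d x).
Proof.
move: x.
have ge N := ev_gmap N er.
have gr N := gmap_scale N er.
have gd m := cobar_d_gmap M m.
have gh m := (homotopy_spec m).2.
have gin m := cobar_map_gmap m (gr M).
have ev_d m (y : cobar M m.+1) :
    ev r (cobar_d y) = r *: y - cobar_d (ev r y).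
  by rewrite cobar_dS (klinB (ge _).1) ev_eta /ev (ci_mapE (gd _)).
have ci_ev_d m (y : cobar M m.+2) : ci_map (ev r) (cobar_d y) =
    r *: y - ci_map (fun z => r *: z) y + ci_map (cobar_d (n := m)) (ci_map (ev r) y).
  rewrite cobar_dS (klinB (ci_map_gmap (ge (cobar M m.+1))).1) ci_ev_eta.
  rewrite -(ci_map_comp (gd m.+1) (ge (cobar M m.+1))).
  rewrite (eq_ci_map (f' := fun z => r *: z - cobar_d (ev r z))); last first.
    by move=> z; exact: ev_d.
  rewrite (ci_mapB (gr _) (gmap_comp0 (ge _) (gd m))).
  by rewrite (ci_map_comp (ge _) (gd m)) opprB addrA addrAC.
(* The correction [y] stands for the term [d h] one level down: it is 0 at the bottom and is given
   by the induction hypothesis afterwards. *)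
have step m (x : cobar M m.+2) (y : cobar M m.+2) :
    ci_map (homotopy (n := m) \o cobar_d (n := m.+1)) x =
      ci_map (fun z => r *: z) x - cobar_map scale_r x - y ->
    homotopy (cobar_d x) = r *: x - ci_map (fun z => r *: z) x +
      (ci_map (cobar_d (n := m)) (ci_map (ev r) x) - y) -
      (eta (homotopy x) - (ci_map (fun z => r *: z) x - cobar_map scale_r x)).
  move=> hy; rewrite homotopyS ci_ev_d cobar_dS (klinB (ci_map_gmap (gh m)).1).
  rewrite -(eta_natural (homotopy_spec m).1 (gh m)).
  rewrite -(ci_map_comp (gd _) (gh m)) hy.
  exact: homotopy_move.
elim: n => [|n IHn] x.
  rewrite (step 0 _ 0); last first.
    rewrite subr0 cobar_mapS -(ci_mapB (gr _) (gin 1%N)).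
    by apply: eq_ci_map => z; rewrite homotopy0.
  by rewrite subr0 cobar_dS homotopy0E homotopy_cancel.
rewrite (step n.+1 _ (ci_map (cobar_d (n := n.+1)) (ci_map (homotopy (n := n)) x))).
  rewrite cobar_dS {2}(homotopyS x).
  by rewrite (klinB (ci_map_gmap (gd _)).1) homotopy_cancel.
rewrite -(ci_map_comp (gh n) (gd _)) cobar_mapS.
rewrite -(ci_mapB (gr _) (gin n.+2)).
have g1 := gmap_sub (gr (cobar M n.+2)) (gin n.+2).
rewrite -(ci_mapB g1 (gmap_comp0 (gh n) (gd _))).
by apply: eq_ci_map => z; rewrite IHn addrAC subrr add0r.
Qed.
End Homotopy.
End Cobar.

(** * Correspondences and double complexes *)

Definition liso (K : fieldType) (U V : lmodType K) :=
  exists f : {linear U -> V}, bijective f.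

Section LinearIso.
Variable K : fieldType.
Implicit Types U V W : lmodType K.

Lemma liso_mk U V (f : U -> V) :
  (forall k x y, f (k *: x + y) = k *: f x + f y) ->
  (forall x, f x = 0 -> x = 0) -> (forall y, exists x, f x = y) -> liso U V.
Proof.
move=> lf injf surf.
pose g : {linear U -> V} := HB.pack f (GRing.isLinear.Build K U V _ f lf).
exists g; have injg : injective g.
  move=> x y /eqP; rewrite -subr_eq0 -raddfB => /eqP /injf /eqP.
  by rewrite subr_eq0 => /eqP.
exists (fun y => sval (cid (surf y))) => x; last exact: svalP (cid (surf x)).
by apply: injg; exact: svalP (cid (surf (g x))).
Qed.


Lemma liso_sym U V : liso U V -> liso V U.
Proof.
move=> [f [g fK gK]]; apply: (liso_mk (f := g)).
- move=> k x y; apply: (can_inj fK).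
  by rewrite gK linearP !gK.
- by move=> x gx; rewrite -[x]gK gx raddf0.
- by move=> y; exists (f y).
Qed.

Lemma liso_trans U V W : liso U V -> liso V W -> liso U W.
Proof.
move=> [f bf] [g bg]; exists (g \o f)%FUN; exact: bij_comp.
Qed.

Lemma liso0 U V : (forall x : U, x = 0) -> (forall y : V, y = 0) -> liso U V.
Proof.
move=> U0 V0; apply: (liso_mk (f := fun=> 0)) => [k x y|x _|y]; rewrite ?V0 //.
by exists 0; rewrite [RHS]V0.
Qed.

(* A linear correspondence inducing an isomorphism Z1 / N1 -> Z2 / N2. *)
Definition corr U V (Z1 N1 : U -> Prop) (Z2 N2 : V -> Prop) :=
  exists R : U -> V -> Prop,
    [/\ forall k x y x' y', R x y -> R x' y' -> R (k *: x + x') (k *: y + y'),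
        forall x, Z1 x -> exists y, R x y,
        forall y, Z2 y -> exists x, R x y &
        forall x y, R x y -> [/\ Z1 x, Z2 y & N1 x <-> N2 y]].

Lemma corr_trans U V W Z1 N1 Z2 N2 Z3 N3 :
  @corr U V Z1 N1 Z2 N2 -> @corr V W Z2 N2 Z3 N3 -> @corr U W Z1 N1 Z3 N3.
Proof.
move=> [R [Rl Rt Rs RP]] [S [Sl St Ss SP]].
exists (fun x z => exists2 y, R x y & S y z); split.
- move=> k x z x' z' [y Rxy Syz] [y' Rxy' Syz'].
  by exists (k *: y + y'); [exact: Rl|exact: Sl].
- move=> x /Rt[y Rxy]; have [_ Zy _] := RP _ _ Rxy.
  by have [z Syz] := St _ Zy; exists z, y.
- move=> z /Ss[y Syz]; have [Zy _ _] := SP _ _ Syz.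
  by have [x Rxy] := Rs _ Zy; exists x, y.
- move=> x z [y /RP[Zx _ xy] /SP[_ Zz yz]]; split=> //.
  by split=> [/xy /yz|/yz /xy].
Qed.

Definition exact_at (C : cochain_complex K) n :=
  forall x, differential C n x = 0 -> is_coboundary x.

Lemma coh_eq0 (C : cochain_complex K) n : exact_at C n -> forall x : cohomology C n, x = 0.
Proof.
move=> exC x; rewrite -[x]quotient_reprK.
apply: etrans (_ : quotient_pi _ 0 = _).
  apply/quotient_piP; rewrite subr0; apply: exC.
  exact: (asboolW (valP (quotient_repr x))).
by apply: (addrI (quotient_pi _ 0)); rewrite -quotient_piD !addr0.
Qed.
End LinearIso.

Section Correspondence.
Variables (K : fieldType) (C D : cochain_complex K).

(** Total on cochains, with the zero class off the cocycles, so that classes carry no proofs. *)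
Definition coh_class n (x : C n) : cohomology C n :=
  quotient_pi (coboundary C n)
    (if pselect (differential C n x = 0) is left h then
       Sub x (asboolT (h : cocycle C n x)) else 0).
End Correspondence.

Section CohomologyClass.
Variables (K : fieldType) (C : cochain_complex K).

Lemma coh_classE n (x : C n) (h : differential C n x = 0) :
  coh_class x = quotient_pi (coboundary C n) (Sub x (asboolT (h : cocycle C n x))).
Proof.
rewrite /coh_class; case: pselect => // h'.
by congr (quotient_pi _ _); apply: val_inj.
Qed.

Lemma coh_class_eq n (x y : C n) : differential C n x = 0 ->
  differential C n y = 0 -> coh_class x = coh_class y <-> is_coboundary (x - y).
Proof.
move=> dx dy; rewrite (coh_classE dx) (coh_classE dy).
exact: quotient_piP.
Qed.

Lemma coh_class_lin n k (x y : C n) : differential C n x = 0 ->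
  differential C n y = 0 -> coh_class (k *: x + y) = k *: coh_class x + coh_class y.
Proof.
move=> dx dy; have dxy : differential C n (k *: x + y) = 0.
  by rewrite linearP /= dx dy scaler0 addr0.
rewrite (coh_classE dx) (coh_classE dy) (coh_classE dxy).
apply: etrans (_ : _ = quotient_scale k (quotient_pi _ _) + _) _ => //.
rewrite quotient_piZ -quotient_piD.
by congr (quotient_pi _ _); apply: val_inj.
Qed.

Lemma coh_class0 n : coh_class (0 : C n) = 0.
Proof.
have := coh_class_lin (n := n) 1 (raddf0 _) (raddf0 _).
by rewrite !scaler0 !scale1r !addr0 => /esym/(canRL (addKr _)); rewrite addNr.
Qed.

Lemma coh_class_surj n (z : cohomology C n) :
  exists2 x : C n, differential C n x = 0 & coh_class x = z.
Proof.
have h : differential C n (val (quotient_repr z)) = 0.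
  exact: (asboolW (valP (quotient_repr z))).
exists (val (quotient_repr z)) => //.
rewrite (coh_classE h) -[RHS]quotient_reprK.
by congr (quotient_pi _ _); apply: val_inj.
Qed.

Lemma coh_class_eq0 n (x : C n) : differential C n x = 0 ->
  coh_class x = 0 <-> is_coboundary x.
Proof.
move=> dx; rewrite -(coh_class0 n) (coh_class_eq dx (raddf0 _)).
by rewrite subr0.
Qed.
End CohomologyClass.

(** [R] need not be single valued. If two related pairs have cohomologous first entries, their
    difference is a related pair by linearity, so the second entries are cohomologous too and [R]
    descends to classes. *)
Lemma corr_liso (K : fieldType) (C D : cochain_complex K) n m :
  corr (fun x => differential C n x = 0) (is_coboundary (n := n))
       (fun y => differential D m y = 0) (is_coboundary (n := m)) ->
  liso (cohomology C n) (cohomology D m).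
Proof.
move=> [R [Rl Rt Rs RP]].
have Rcl x y x' y' : R x y -> R x' y' -> coh_class x = coh_class x' ->
    coh_class y = coh_class y'.
  move=> Rxy Rxy'; have [dx dy _] := RP _ _ Rxy; have [dx' dy' _] := RP _ _ Rxy'.
  move=> /(coh_class_eq dx dx').1 bx; apply/(coh_class_eq dy dy').
  have := Rl (-1) _ _ _ _ Rxy' Rxy; rewrite !scaleN1r ![- _ + _]addrC.
  by move=> /RP[_ _ <-].
have rep z : exists y, exists2 x, R x y & coh_class x = z.
  have [x dx xz] := coh_class_surj z.
  by have [y Rxy] := Rt _ dx; exists y, x.
pose f z := coh_class (sval (cid (rep z))).
have fP x y : R x y -> f (coh_class x) = coh_class y.
  rewrite /f; case: cid => y' /= [x' Rxy' xx'] Rxy.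
  exact: Rcl Rxy' Rxy xx'.
apply: (liso_mk (f := f)).
- move=> k z z'; have [x dx xz] := coh_class_surj z.
  have [x' dx' xz'] := coh_class_surj z'.
  have [y Rxy] := Rt _ dx; have [y' Rxy'] := Rt _ dx'.
  have [_ dy _] := RP _ _ Rxy; have [_ dy' _] := RP _ _ Rxy'.
  rewrite -xz -xz' -(coh_class_lin _ dx dx') (fP _ _ (Rl _ _ _ _ _ Rxy Rxy')).
  by rewrite (coh_class_lin _ dy dy') (fP _ _ Rxy) (fP _ _ Rxy').
- move=> z; have [x dx <-] := coh_class_surj z.
  have [y Rxy] := Rt _ dx; have [_ dy b] := RP _ _ Rxy.
  by rewrite (fP _ _ Rxy) (coh_class_eq0 dy) (coh_class_eq0 dx) -b.
- move=> z; have [y dy <-] := coh_class_surj z.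
  by have [x Rxy] := Rs _ dy; exists (coh_class x); exact: fP.
Qed.

Lemma coboundary_cocycle (K : fieldType) (C : cochain_complex K) n (x : C n) :
  is_coboundary x -> differential C n x = 0.
Proof.
case: n x => [|n] x /=; first by move=> ->; rewrite raddf0.
by move=> [y ->]; rewrite differentialK.
Qed.

Lemma ltn_neq m n : (m < n)%N -> m != n.
Proof. by move=> mn; rewrite ltn_eqF. Qed.

(** * Collapse of a double complex with columns exact off one degree *)

Section DoubleComplex.
Variables (K : fieldType) (A W : cochain_complex K) (D : nat -> cochain_complex K).
Variables (eps : forall p, A p -> D 0 p) (dh : forall q p, D q p -> D q.+1 p).
Local Notation dv := (differential (D _) _).
Hypothesis eps_lin : forall p k x y, @eps p (k *: x + y) = k *: eps x + eps y.
Hypothesis dh_lin : forall q p k x y, @dh q p (k *: x + y) = k *: dh x + dh y.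
Hypothesis eps_d : forall p x, eps (differential A p x) = dv (eps x).
Hypothesis dh_d : forall q p (x : D q p), dh (dv x) = dv (dh x).
Hypothesis eps_inj : forall p x, @eps p x = 0 -> x = 0.
Hypothesis dh_eps : forall p x, dh (@eps p x) = 0.
Hypothesis dh_dh : forall q p x, dh (@dh q p x) = 0.
Hypothesis eps_ex : forall p (x : D 0 p), dh x = 0 -> exists y, x = eps y.
Hypothesis dh_ex : forall q p (x : D q.+1 p), dh x = 0 -> exists y, x = dh y.
Variable n : nat.
Hypothesis D_ex : forall q j, j != n -> exact_at (D q) j.
Variable pi : forall q, D q n -> W q.
Hypothesis pi_lin : forall q k x y, dv x = 0 -> dv y = 0 ->
  @pi q (k *: x + y) = k *: pi x + pi y.
Hypothesis pi_surj : forall q w, exists2 x, dv x = 0 & @pi q x = w.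
Hypothesis pi_ker : forall q (x : D q n), dv x = 0 ->
  pi x = 0 <-> is_coboundary x.
Hypothesis pi_d : forall q (x : D q n), dv x = 0 ->
  pi (dh x) = differential W q (pi x).

Lemma dh0 q p : @dh q p 0 = 0.
Proof. by have := dh_lin (-1) (0 : D q p) 0; rewrite scaler0 addr0 scaleN1r addNr. Qed.
Lemma dhB q p x y : @dh q p (x - y) = dh x - dh y.
Proof. by have := dh_lin (-1) y x; rewrite !scaleN1r ![- _ + _]addrC. Qed.
Lemma pi0 q : @pi q 0 = 0.
Proof.
have := pi_lin (-1) (raddf0 (differential (D q) n)) (raddf0 _).
by rewrite scaler0 addr0 scaleN1r addNr.
Qed.
Lemma piB q x y : dv x = 0 -> dv y = 0 -> @pi q (x - y) = pi x - pi y.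
Proof. by move=> dx dy; have := pi_lin (-1) dy dx; rewrite !scaleN1r ![- _ + _]addrC. Qed.
Lemma eps0 p : @eps p 0 = 0.
Proof. by have := eps_lin (-1) (0 : A p) 0; rewrite scaler0 addr0 scaleN1r addNr. Qed.

(** Cocycles and coboundaries of the subcomplex [ker dh] of the column [D k]. For [k = 0] it is a
    copy of [A], and [ker dh] in column [k], [D k], [ker dh] in column [k + 1] form a short exact
    sequence, whose connecting maps move cohomology from column to column. *)
Definition row_cocycle k p (x : D k p) := dv x = 0 /\ dh x = 0.
Definition row_coboundary k p : D k p -> Prop :=
  match p with
  | 0 => fun x => x = 0
  | m.+1 => fun x => exists y : D k m, dh y = 0 /\ x = dv y
  end.

(** Below degree [n] the obstruction [dh x] is a [dv]-coboundary. Its primitive [t] has the same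
    defect one degree lower and one column further, so the zigzag ends in degree 0. *)
Lemma low_adjust j k (x : D k j) : (j < n)%N -> dv (dh x) = 0 ->
  exists2 x1, dv x1 = dv x & dh x1 = 0.
Proof.
elim: j k x => [|j IHj] k x jn /(D_ex (ltn_neq jn)) /=; first by exists x.
move=> [t xt]; have [|t1 dt1 ht1] := IHj _ t (ltnW jn).
  by rewrite -dh_d -xt dh_dh.
have [y ty] := dh_ex ht1; exists (x - dv y).
  by rewrite raddfB /= differentialK subr0.
by rewrite dhB dh_d -ty dt1 xt subrr.
Qed.

Lemma low_exact j k (x : D k j) : (j < n)%N -> row_cocycle x -> row_coboundary x.
Proof.
move=> jn [dx hx]; have := D_ex (ltn_neq jn) dx.
case: j x jn dx hx => [|j] x jn dx hx //= [y xy].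
have [|y1 dy1 hy1] := low_adjust (x := y) (ltnW jn); first by rewrite -dh_d -xy hx.
by exists y1; rewrite dy1.
Qed.

(** In degree [n] the first step of [low_adjust] fails and becomes a hypothesis. The last conclusion
    keeps the class of [y], hence its image under [pi] when [y] is a cocycle. *)
Lemma top_adjust p k (y : D k p) : (p <= n)%N -> is_coboundary (dh y) ->
  exists y1, [/\ dv y1 = dv y, dh y1 = 0 & is_coboundary (y - y1)].
Proof.
case: p y => [|m] y mn /=; first by exists y; rewrite subrr.
move=> [t yt]; have [|t1 dt1 ht1] := low_adjust (x := t) mn.
  by rewrite -dh_d -yt dh_dh.
have [x tx] := dh_ex ht1; exists (y - dv x); split.
- by rewrite raddfB /= differentialK subr0.
- by rewrite dhB dh_d -tx dt1 yt subrr.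
- by exists x; rewrite subKr.
Qed.

Lemma row_coboundaryP p k (x : D k p) : (p <= n)%N -> row_cocycle x ->
  row_coboundary x <-> is_coboundary x.
Proof.
case: p x => [|m] x mn [dx hx] //=; split=> [[y [_ ->]]|[y xy]]; first by exists y.
have [|y1 dy1 hy1] := low_adjust (x := y) mn; first by rewrite -dh_d -xy hx.
by exists y1; rewrite dy1.
Qed.

Lemma pi_coboundary q (x : D q n) : is_coboundary x -> pi x = 0.
Proof. by move=> bx; apply/pi_ker => //; exact: coboundary_cocycle. Qed.

(** The connecting map: [z = dv x] is sent to [dh x]. Exactness of [D k] in degrees [j] and [j + 1]
    makes it bijective on cohomology. *)
Lemma row_shift k j : j != n -> j.+1 != n ->
  corr (@row_cocycle k j.+1) (@row_coboundary k j.+1)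
       (@row_cocycle k.+1 j) (@row_coboundary k.+1 j).
Proof.
move=> jn jn1; exists (fun z y => dh z = 0 /\ exists2 x : D k j, dv x = z & dh x = y).
split.
- move=> c z y z' y' [hz [x xz xy]] [hz' [x' xz' xy']]; split.
    by rewrite dh_lin hz hz' scaler0 addr0.
  by exists (c *: x + x'); rewrite ?dh_lin ?linearP /= ?xz ?xz' ?xy ?xy'.
- move=> z [dz hz]; have [x zx] : exists x, z = dv x.
    exact: (D_ex jn1).
  by exists (dh x); split=> //; exists x.
- move=> y [dy hy]; have [x yx] := dh_ex hy; exists (dv x); split.
    by rewrite dh_d -yx.
  by exists x.
- move=> z y [hz [x xz xy]]; split.
  + by split=> //; rewrite -xz differentialK.
  + by split; [rewrite -xy -dh_d xz|rewrite -xy dh_dh].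
  + subst z y; split=> [[x' [hx' dx']]|].
      have : dv (x - x') = 0 by rewrite raddfB /= dx' subrr.
      move=> /(D_ex jn).
      have -> : dh x = dh (x - x') by rewrite dhB hx' subr0.
      move: (x - x') => {dx' hx' x' hz x}; case: j {jn jn1} => [|j] x /=.
        by move=> ->; rewrite dh0.
      by move=> [u ->]; exists (dh u); rewrite dh_dh dh_d.
    case: j {jn jn1} x hz => [|j] x hz /=; first by exists x.
    move=> [u [hu xu]]; have [v uv] := dh_ex hu; exists (x - dv v); split.
      by rewrite dhB dh_d xu uv subrr.
    by rewrite raddfB /= differentialK subr0.
Qed.

(** The connecting map into degree [n]. As [D k] has cohomology [W k] there, it is bijective only
    modulo the image of [W k], which supplies the coboundaries of [W]. *)
Lemma row_last k :
  corr (@row_cocycle k n.+1) (@row_coboundary k n.+1)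
       (fun w => differential W k.+1 w = 0) (is_coboundary (n := k.+1)).
Proof.
exists (fun z w => dh z = 0 /\ exists2 x : D k n, dv x = z & pi (dh x) = w).
split.
- move=> c z y z' y' [hz [x xz xy]] [hz' [x' xz' xy']]; split.
    by rewrite dh_lin hz hz' scaler0 addr0.
  exists (c *: x + x'); first by rewrite linearP /= xz xz'.
  by rewrite dh_lin pi_lin ?xy ?xy' // -dh_d ?xz ?xz'.
- move=> z [dz hz]; have [x zx] : exists x, z = dv x.
    by apply: (D_ex (j := n.+1)) => //; rewrite gtn_eqF.
  by exists (pi (dh x)); split=> //; exists x.
- move=> w dw; have [y dy yw] := pi_surj w.
  have [|y1 [dy1 hy1 by1]] := top_adjust (y := y) (leqnn n).
    by apply/pi_ker; rewrite ?pi_d // ?yw // -dh_d dy dh0.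
  have [x yx] := dh_ex hy1; exists (dv x); split.
    by rewrite dh_d -yx dy1.
  exists x => //; rewrite -yx; apply/eqP; rewrite -yw eq_sym -subr_eq0 -piB ?dy1 //.
  by rewrite pi_coboundary.
- move=> z w [hz [x xz xw]]; split.
  + by split=> //; rewrite -xz differentialK.
  + by rewrite -xw -pi_d ?dh_dh ?pi0 // -dh_d xz.
  + subst z w; split=> [[x' [hx' dx']]|/= [w' xw']].
      exists (pi (x - x')); rewrite -pi_d ?dhB ?hx' ?subr0 //.
      by rewrite raddfB /= dx' subrr.
    have [u du uw] := pi_surj w'.
    have [|y1 [dy1 hy1 _]] := top_adjust (y := x - u) (leqnn n).
      apply/pi_ker; first by rewrite -dh_d raddfB /= du subr0 hz.
      rewrite dhB piB; first by rewrite xw' -uw pi_d // subrr.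
        by rewrite -dh_d.
      by rewrite -dh_d du dh0.
    by exists y1; split=> //; rewrite dy1 raddfB /= du subr0.
Qed.

Lemma row_first :
  corr (@row_cocycle 0 n) (@row_coboundary 0 n)
       (fun w => differential W 0 w = 0) (is_coboundary (n := 0)).
Proof.
exists (fun z w => row_cocycle z /\ pi z = w); split.
- move=> c z y z' y' [[dz hz] <-] [[dz' hz'] <-]; split; last by rewrite pi_lin.
  split; last by rewrite dh_lin hz hz' scaler0 addr0.
  by rewrite linearP /= dz dz' scaler0 addr0.
- by move=> z rz; exists (pi z).
- move=> w dw; have [y dy yw] := pi_surj w.
  have [|y1 [dy1 hy1 by1]] := top_adjust (y := y) (leqnn n).
    by apply/pi_ker; rewrite ?pi_d // ?yw // -dh_d dy dh0.
  exists y1; split; first by split=> //; rewrite dy1.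
  apply/eqP; rewrite -yw eq_sym -subr_eq0 -piB ?dy1 //.
  by rewrite pi_coboundary.
- move=> z w [[dz hz] zw]; split=> //.
    by rewrite -zw -pi_d // hz pi0.
  by rewrite /= -zw (row_coboundaryP (leqnn n)) // pi_ker.
Qed.

(** [s] shifts bring degree [s + 1 + n] down to [n + 1], where [row_last] applies. The index [m] is
    tied by an equation so that the recursion may regroup the sum. *)
Lemma row_chain s k m : m = (k + s.+1)%N ->
  corr (@row_cocycle k (s.+1 + n)) (@row_coboundary k (s.+1 + n))
       (fun w => differential W m w = 0) (is_coboundary (n := m)).
Proof.
elim: s k m => [|s IHs] k m mE.
  by rewrite addn1 in mE; subst m; exact: row_last.
apply: corr_trans (IHs k.+1 m _); last by rewrite mE addSnnS.
by apply: row_shift; rewrite gtn_eqF // ?addSn ltnS ?leq_addl // ltnW // ltnS leq_addl.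
Qed.

Lemma augmentation_corr p :
  corr (fun a => differential A p a = 0) (is_coboundary (n := p))
       (@row_cocycle 0 p) (@row_coboundary 0 p).
Proof.
exists (fun a x => differential A p a = 0 /\ x = eps a); split.
- move=> c a x a' x' [da ->] [da' ->]; split; last by rewrite eps_lin.
  by rewrite linearP /= da da' scaler0 addr0.
- by move=> a da; exists (eps a).
- move=> x [dx /eps_ex[a xa]]; exists a; split=> //.
  by apply: eps_inj; rewrite eps_d -xa.
- move=> a x [da {x}->]; split=> //.
    by split; [rewrite -eps_d da eps0|exact: dh_eps].
  case: p a da => [|p] a da /=.
    by split=> [->|/eps_inj //]; exact: eps0.
  split=> [[b ->]|[y [/eps_ex[b ->] aE]]].
    by exists (eps b); rewrite eps_d dh_eps.
  exists b; apply/eqP; rewrite -subr_eq0; apply/eqP/eps_inj.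
  have := eps_lin (-1) (differential A p b) a; rewrite !scaleN1r ![- _ + _]addrC.
  by move=> ->; rewrite aE eps_d subrr.
Qed.

Theorem double_complex_low j : (j < n)%N -> exact_at A j.
Proof.
move=> jn a da; have [R [_ Rt _ RP]] := augmentation_corr j.
have [x Rax] := Rt a da; have [_ cx ->] := RP _ _ Rax.
exact: low_exact.
Qed.

Theorem double_complex_iso r : liso (cohomology A (r + n)) (cohomology W r).
Proof.
apply: corr_liso; apply: corr_trans (augmentation_corr _) _.
case: r => [|r]; first exact: row_first.
exact: row_chain.
Qed.
End DoubleComplex.

(** * Torsion in the cobar resolution *)

Section SubspaceElements.
Variables (K : fieldType) (V : lmodType K) (W : subspace V).

Definition sub_mk (x : V) : subspace_type W :=
  if pselect (W x) is left h then Sub x (asboolT h) else 0.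

Lemma sub_mkE x : W x -> val (sub_mk x) = x.
Proof. by rewrite /sub_mk; case: pselect. Qed.

Lemma sub_valP (x : subspace_type W) : W (val x).
Proof. exact: (asboolW (valP x)). Qed.
End SubspaceElements.

(** * Long exact sequence arguments *)

Section ShortExact.
Variables (K : fieldType) (C' C C'' : cochain_complex K).
Variables (f : forall n, C' n -> C n) (g : forall n, C n -> C'' n).
Hypothesis f_lin : forall n k x y, @f n (k *: x + y) = k *: f x + f y.
Hypothesis g_lin : forall n k x y, @g n (k *: x + y) = k *: g x + g y.
Hypothesis f_d : forall n x, f (differential C' n x) = differential C n (f x).
Hypothesis g_d : forall n x, g (differential C n x) = differential C'' n (g x).
Hypothesis f_inj : forall n x, @f n x = 0 -> x = 0.
Hypothesis g_surj : forall n y, exists x, @g n x = y.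
Hypothesis gf : forall n x, g (@f n x) = 0.
Hypothesis fg_ex : forall n x, @g n x = 0 -> exists y, x = f y.

Let f0 n : @f n 0 = 0.
Proof. by have := f_lin (-1) (0 : C' n) 0; rewrite scaler0 addr0 scaleN1r addNr. Qed.
Let g0 n : @g n 0 = 0.
Proof. by have := g_lin (-1) (0 : C n) 0; rewrite scaler0 addr0 scaleN1r addNr. Qed.
Let fB n x y : @f n (x - y) = f x - f y.
Proof. by have := f_lin (-1) y x; rewrite !scaleN1r ![- _ + _]addrC. Qed.
Let gB n x y : @g n (x - y) = g x - g y.
Proof. by have := g_lin (-1) y x; rewrite !scaleN1r ![- _ + _]addrC. Qed.

Lemma ses_mid j : exact_at C' j -> exact_at C'' j -> exact_at C j.
Proof.
move=> ex' ex'' x dx; have : differential C'' j (g x) = 0 by rewrite -g_d dx g0.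
move=> /ex''; case: j ex' {ex''} x dx => [|j] ex' x dx /=.
  move=> /fg_ex[y xy]; rewrite xy -[RHS](f0 0); congr f.
  by apply: (ex'); apply: f_inj; rewrite f_d -xy.
move=> [z gz]; have [y yz] := g_surj z.
have [u uE] : exists u, x - differential C j y = f u.
  by apply: fg_ex; rewrite gB g_d yz gz subrr.
have /ex'[v vE] : differential C' j.+1 u = 0.
  by apply: f_inj; rewrite f_d -uE raddfB /= dx differentialK subrr.
exists (y + f v); rewrite raddfD /= -f_d -vE -uE.
by rewrite addrC subrK.
Qed.

(** The connecting map into degree [j] starts at the cohomology of [C''] in degree [j - 1]. The
    premise goes through [j = i.+1] because for [j = 0] nothing has to vanish. *)
Lemma ses_inj j x : (forall i, j = i.+1 -> exact_at C'' i) ->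
  differential C' j x = 0 -> is_coboundary (f x) -> is_coboundary x.
Proof.
move=> ex'' dx; case: j x dx ex'' => [|j] x dx ex'' /=; first exact: f_inj.
move=> [y fy].
have : differential C'' j (g y) = 0 by rewrite -g_d -fy gf.
move=> /(ex'' _ erefl).
have end_ (u : C' j) z : f u = y - z -> differential C j z = 0 ->
    exists v, x = differential C' j v.
  move=> uE dz; exists u; apply/eqP; rewrite -subr_eq0; apply/eqP/f_inj.
  by rewrite fB f_d uE raddfB /= dz subr0 fy subrr.
case: j x dx ex'' y fy end_ => [|j] x dx ex'' y fy end_ /=.
  by move=> /fg_ex[u uE]; apply: (end_ u 0); rewrite ?subr0 ?raddf0.
move=> [z gz]; have [t tz] := g_surj z.
have [u uE] : exists u, y - differential C j t = f u.
  by apply: fg_ex; rewrite gB g_d tz gz subrr.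
by apply: end_ (esym uE) _; rewrite differentialK.
Qed.

Lemma ses_left j : exact_at C j -> (forall i, j = i.+1 -> exact_at C'' i) ->
  exact_at C' j.
Proof.
move=> ex ex'' x dx; apply: ses_inj => //; apply: ex.
by rewrite -f_d dx f0.
Qed.

End ShortExact.

Section TorsionCobar.
Variables (K : fieldType) (G : zmodType) (A : comAlgType K) (deg : grading G A).
Variable (I : set A).
Implicit Types M N P E : graded_module deg.

Lemma torsion_alin M N (f : M -> N) x : alin f -> torsion I x -> torsion I (f x).
Proof.
by move=> lf [n xn]; exists n => r Ir; rewrite -(alinZ lf) xn // (klin0 (alin_klin lf)).
Qed.

Program Definition strand (a : G) M : subspace (restrict_scalars (GRing.in_alg A) M) :=
  {| subspace_set x := torsion I (x : M) /\ module_part a (x : M) |}.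
Next Obligation. by move=> a M; split; [exact: torsion0|exact: module_part0]. Qed.
Next Obligation.
move=> a M x y [x1 x2] [y1 y2].
by split; [exact: torsionD|exact: module_partD].
Qed.
Next Obligation.
move=> a M k x [x1 x2]; split; first exact: torsionZ.
exact: module_partK.
Qed.

Definition strand_val a M (x : subspace_type (strand a M)) : M := val x.

Lemma strand_valP a M (x : subspace_type (strand a M)) :
  torsion I (strand_val x) /\ module_part a (strand_val x).
Proof. exact: (sub_valP x). Qed.

Definition strand_mk a M (x : M) : subspace_type (strand a M) :=
  sub_mk (strand a M) x.

Lemma strand_mkE a M (x : M) : torsion I x -> module_part a x ->
  strand_val (strand_mk a x) = x.
Proof. by move=> tx ax; exact: (@sub_mkE K _ (strand a M) x (conj tx ax)). Qed.

Lemma strand_eq a M (x y : subspace_type (strand a M)) :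
  strand_val x = strand_val y -> x = y.
Proof. exact: val_inj. Qed.

Lemma strand_valL a M k (x y : subspace_type (strand a M)) :
  strand_val (k *: x + y) = k%:A *: strand_val x + strand_val y.
Proof. by []. Qed.

Lemma strand_valZ a M k (x : subspace_type (strand a M)) :
  strand_val (k *: x) = k%:A *: strand_val x.
Proof. by []. Qed.

Lemma strand_valD a M (x y : subspace_type (strand a M)) :
  strand_val (x + y) = strand_val x + strand_val y.
Proof. by []. Qed.

Lemma strand_val_sum a M (J : Type) (r : seq J) (P : pred J)
    (F : J -> subspace_type (strand a M)) :
  strand_val (\sum_(i <- r | P i) F i) = \sum_(i <- r | P i) strand_val (F i).
Proof. by apply: (big_morph (@strand_val a M)). Qed.

Section StrandMap.
Variables (a b : G) (M N : graded_module deg) (f : M -> N).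
Hypotheses (lf : alin f) (gf : gmap (b - a) f).

Definition strand_map (x : subspace_type (strand a M)) : subspace_type (strand b N) :=
  strand_mk b (f (strand_val x)).

Lemma strand_mapE x : strand_val (strand_map x) = f (strand_val x).
Proof.
have [tx ax] := strand_valP x; apply: strand_mkE; first exact: torsion_alin.
by have := gf.2 _ _ ax; rewrite addrC subrK.
Qed.

Lemma strand_map_lin k x y :
  strand_map (k *: x + y) = k *: strand_map x + strand_map y.
Proof. by apply: strand_eq; rewrite strand_valL !strand_mapE strand_valL lf. Qed.
End StrandMap.

Lemma gmap_same a M N (f : M -> N) : gmap 0 f -> gmap (a - a) f.
Proof. by rewrite subrr. Qed.

Section TorsionComplex.
Variables (a : G) (M : graded_module deg).

Let d_gmap n := gmap_same a (cobar_d_gmap M n).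

Definition cobar_strand_d n : subspace_type (strand a (cobar M n.+1)) ->
    subspace_type (strand a (cobar M n.+2)) :=
  strand_map a (@cobar_d _ _ _ _ M n.+1).

Lemma cobar_strand_dE n x :
  strand_val (@cobar_strand_d n x) = cobar_d (strand_val x).
Proof. exact: (strand_mapE (@cobar_d_alin _ _ _ _ M n.+1) (d_gmap n.+1)). Qed.

Fact cobar_strand_d_linear n : linear (@cobar_strand_d n).
Proof. exact: (strand_map_lin (@cobar_d_alin _ _ _ _ M n.+1) (d_gmap n.+1)). Qed.

HB.instance Definition _ n := GRing.isLinear.Build K _ _ _ (@cobar_strand_d n)
  (@cobar_strand_d_linear n).

Fact cobar_strand_dK n x : @cobar_strand_d n.+1 (@cobar_strand_d n x) = 0.
Proof. by apply: strand_eq; rewrite !cobar_strand_dE cobar_dK. Qed.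

(* As cobar M 0 is M itself, the resolving objects start at cobar M 1. *)
Definition torsion_cobar : cochain_complex K :=
  {| cochain := fun n => subspace_type (strand a (cobar M n.+1));
     differential := fun n => @cobar_strand_d n;
     differentialK := @cobar_strand_dK |}.

Lemma torsion_cobar_dE n (x : torsion_cobar n) :
  strand_val (differential torsion_cobar n x) = cobar_d (strand_val x).
Proof. exact: cobar_strand_dE. Qed.
End TorsionComplex.

Section TorsionCobarMap.
Variables (a b : G) (M N : graded_module deg) (f : M -> N).
Hypothesis gf : gmap (b - a) f.

(** [f] is only K-linear, of degree [b - a]. From cobar degree 1 on [cobar_map f] is A-linear, hence
    keeps torsion; A-linearity of [f] itself enters in [tmap_d], to commute with the
    differential. *)
Definition tmap n : torsion_cobar a M n -> torsion_cobar b N n :=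
  strand_map b (@cobar_map _ _ _ _ M N f n.+1).

Lemma tmapE n x : strand_val (@tmap n x) = cobar_map f (strand_val x).
Proof. exact: (strand_mapE (@cobar_map_alin _ _ _ _ _ _ _ _ n gf) (cobar_map_gmap n.+1 gf)). Qed.

Lemma tmap_lin n k x y : @tmap n (k *: x + y) = k *: tmap x + tmap y.
Proof. exact: (strand_map_lin (@cobar_map_alin _ _ _ _ _ _ _ _ n gf) (cobar_map_gmap n.+1 gf)). Qed.

Lemma tmap_additive n : {morph @tmap n : x y / x + y}.
Proof. by move=> x y; have := tmap_lin 1 x y; rewrite !scale1r. Qed.

Lemma tmap_zero n : @tmap n 0 = 0.
Proof. by apply: (addrI (tmap 0)); rewrite -tmap_additive !addr0. Qed.

Lemma tmap_d n x : alin f -> 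
  @tmap n.+1 (differential (torsion_cobar a M) n x) =
  differential (torsion_cobar b N) n (tmap x).
Proof.
move=> lf; apply: strand_eq; rewrite tmapE !torsion_cobar_dE tmapE.
by rewrite (cobar_d_natural lf gf).
Qed.
End TorsionCobarMap.

Arguments tmap a b [M N] f [n] _.

Lemma tmap_comp a b c M N P (f : M -> N) (f' : N -> P) n
    (x : torsion_cobar a M n) :
  gmap (b - a) f -> gmap (c - b) f' ->
  tmap a c (f' \o f) x = tmap b c f' (tmap a b f x).
Proof.
move=> gf gf'; apply: strand_eq; rewrite (tmapE gf') (tmapE gf) tmapE.
  exact: (cobar_map_comp gf gf').
by have := gmap_comp gf gf'; rewrite [_ - a + _]addrC addrA subrK.
Qed.

Lemma tmap_comp0 a M N P (f : M -> N) (f' : N -> P) n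
    (x : torsion_cobar a M n) :
  gmap 0 f -> gmap 0 f' -> tmap a a (f' \o f) x = tmap a a f' (tmap a a f x).
Proof. by move=> gf gf'; apply: tmap_comp; exact: gmap_same. Qed.

Lemma eq_tmap a b M N (f f' : M -> N) n (x : torsion_cobar a M n) :
  f =1 f' -> tmap a b f x = tmap a b f' x.
Proof. by move=> /funext ->. Qed.

Lemma tmap_id a M n (x : torsion_cobar a M n) : tmap a a id x = x.
Proof.
apply: strand_eq; rewrite tmapE ?cobar_map_id //.
exact/gmap_same/gmap_id.
Qed.

Lemma tmapD a b M N (f f' : M -> N) n (x : torsion_cobar a M n) :
  gmap (b - a) f -> gmap (b - a) f' ->
  tmap a b (fun x => f x + f' x) x = tmap a b f x + tmap a b f' x.
Proof.
move=> gf gf'; apply: strand_eq.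
rewrite strand_valD (tmapE gf) (tmapE gf') (tmapE (gmap_add gf gf')).
exact: (cobar_mapD gf gf').
Qed.

Lemma tmap0 a b M N n (x : torsion_cobar a M n) :
  tmap a b (fun _ : M => 0 : N) x = 0.
Proof.
by apply: strand_eq; rewrite (tmapE (gmap_0 _ M N)) cobar_map0.
Qed.

Lemma tmapZ a (k : K) M N (f : M -> N) n (x : torsion_cobar a M n) : gmap 0 f ->
  tmap a a (fun x => k%:A *: f x) x = k *: tmap a a f x.
Proof.
move=> gf; apply: strand_eq.
have gk : gmap 0 (fun x => k%:A *: f x).
  exact: (gmap_comp0 gf (gmap_scale N (deg_scalar deg k))).
rewrite strand_valZ (tmapE (gmap_same a gf)).
rewrite (tmapE (gmap_same a gk)).
exact: (cobar_mapZ k gf).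
Qed.

Lemma tmap_sum a M N (J : Type) (r : seq J) (f : J -> M -> N) n
    (x : torsion_cobar a M n) : (forall j, gmap 0 (f j)) ->
  tmap a a (fun x => \sum_(j <- r) f j x) x = \sum_(j <- r) tmap a a (f j) x.
Proof.
move=> gf; elim: r => [|j r IHr].
  rewrite big_nil -[RHS](@tmap0 a a M N n x).
  by apply: eq_tmap => y; rewrite big_nil.
rewrite big_cons -IHr -tmapD.
- by apply: eq_tmap => y; rewrite big_cons.
- exact: gmap_same.
- apply: gmap_same; elim: r {IHr} => [|i r IHr].
    have -> : (fun x => \sum_(j <- [::]) f j x) = (fun=> 0).
      by apply/funext => y; rewrite big_nil.
    exact: gmap_0.
  have -> : (fun x => \sum_(j <- i :: r) f j x) =
      (fun x => f i x + \sum_(j <- r) f j x).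
    by apply/funext => y; rewrite big_cons.
  exact: gmap_add.
Qed.

Section Exactness.
Variables (a : G) (M N P : graded_module deg) (f : M -> N) (g : N -> P).
Hypotheses (gf : gmap 0 f) (gg : gmap 0 g).

Lemma tmap_inj n (x : torsion_cobar a M n) :
  (forall y, f y = 0 -> y = 0) -> tmap a a f x = 0 -> x = 0.
Proof.
move=> injf fx; have [s [gs sP]] := graded_pseudo_inverse gf.
have -> : x = tmap a a s (tmap a a f x); last first.
  by rewrite fx; exact: (tmap_zero (gmap_same a gs)).
rewrite -tmap_comp0 // -[LHS]tmap_id; apply: eq_tmap => y /=.
apply/eqP; rewrite eq_sym -subr_eq0; apply/eqP/injf.
by rewrite (klinB gf.1) sP subrr.
Qed.

Lemma tmap_surj n (y : torsion_cobar a P n) :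
  (forall y, exists x, g x = y) -> exists x, tmap a a g x = y.
Proof.
move=> surj; have [s [gs sP]] := graded_pseudo_inverse gg.
exists (tmap a a s y); rewrite -tmap_comp0 // -[RHS]tmap_id.
by apply: eq_tmap => z /=; have [x <-] := surj z.
Qed.

(** Taking torsion is not exact in general, but the identity of [N] splits through K-linear graded
    maps, and [tmap] is functorial in those. *)
Lemma tmap_exact n (y : torsion_cobar a N n) :
  (forall y, g y = 0 -> exists x, y = f x) ->
  tmap a a g y = 0 -> exists x, y = tmap a a f x.
Proof.
move=> ex gy; have [s [t [gs gt st]]] := exact_splitting gf gg ex.
exists (tmap a a s y).
transitivity (tmap a a (fun y => (f \o s) y + (t \o g) y) y).
  by rewrite -[LHS]tmap_id; apply: eq_tmap.
rewrite tmapD; [|exact/gmap_same/gmap_comp0..].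
by rewrite (tmap_comp0 _ gs gf) (tmap_comp0 _ gg gt) gy (tmap_zero (gmap_same a gt)) addr0.
Qed.
End Exactness.

(** Vanishing of the degree [a] part of the [j]-th local cohomology of [M], read off the cobar
    complex. *)
Definition TZ M a j := exact_at (torsion_cobar a M) j.

Section ShortExactModules.
Variables (a : G) (M N P : graded_module deg) (f : M -> N) (g : N -> P).
Hypotheses (lf : alin f) (lg : alin g) (gf : gmap 0 f) (gg : gmap 0 g).
Hypothesis f_inj : forall y, f y = 0 -> y = 0.
Hypothesis g_surj : forall y, exists x, g x = y.
Hypothesis gf0 : forall x, g (f x) = 0.
Hypothesis fg_ex : forall y, g y = 0 -> exists x, y = f x.

Let tf n := @tmap a a M N f n.
Let tg n := @tmap a a N P g n.
Let tf_lin := tmap_lin (gmap_same a gf).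
Let tg_lin := tmap_lin (gmap_same a gg).
Let tf_d n x := @tmap_d a a M N f (gmap_same a gf) n x lf.
Let tg_d n x := @tmap_d a a N P g (gmap_same a gg) n x lg.
Let tf_inj n x := @tmap_inj a M N f gf n x f_inj.
Let tg_surj n x := @tmap_surj a N P g gg n x g_surj.
Let tfg_ex n x := @tmap_exact a M N P f g gf gg n x fg_ex.
Let tgf n x : tg (@tf n x) = 0.
Proof.
rewrite /tg /tf -tmap_comp0 // -[RHS](@tmap0 a a M P n x).
by apply: eq_tmap => y /=.
Qed.

Lemma TZ_mid j : TZ M a j -> TZ P a j -> TZ N a j.
Proof. exact: (ses_mid tf_lin tg_lin tf_d tg_d tf_inj tg_surj tfg_ex). Qed.
Lemma TZ_left j : TZ N a j -> (forall i, j = i.+1 -> TZ P a i) -> TZ M a j.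
Proof. exact: (ses_left tf_lin tg_lin tf_d tg_d tf_inj tg_surj tgf tfg_ex). Qed.
Lemma tmap_ses_inj j (x : torsion_cobar a M j) : (forall i, j = i.+1 -> TZ P a i) ->
  differential (torsion_cobar a M) j x = 0 ->
  is_coboundary (tmap a a f x : torsion_cobar a N j) -> is_coboundary x.
Proof. exact: (ses_inj tf_lin tg_lin tf_d tg_d tf_inj tg_surj tgf tfg_ex). Qed.
End ShortExactModules.

Lemma TZ_iso M N a b j (f : M -> N) (g : N -> M) :
  alin f -> alin g -> gmap (b - a) f -> gmap (a - b) g -> cancel f g -> cancel g f ->
  TZ M a j -> TZ N b j.
Proof.
move=> lf lg gf gg fK gK ex y dy.
have gfx n (x : torsion_cobar b N n) : tmap a b f (tmap b a g x) = x.
  rewrite -(tmap_comp (b := a)) // -[RHS]tmap_id; apply: eq_tmap.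
  exact: gK.
have : differential (torsion_cobar a M) j (tmap b a g y) = 0.
  by rewrite -tmap_d // dy tmap_zero.
move=> /ex; rewrite -[in is_coboundary y](gfx _ y).
case: j {ex} y dy => [|j] y dy.
  move=> ->; exact: (@tmap_zero _ _ _ _ _ gf 0).
by move=> [x ->]; exists (tmap a b f x); rewrite tmap_d.
Qed.
End TorsionCobar.

Arguments tmap {K G A deg} I a b {M N} f {n} _.
Arguments tmap_lin {K G A deg} I {a b M N f} gf {n} k x y.
Arguments tmap_d {K G A deg} I {a b M N f} gf {n} x _.
Arguments tmapE {K G A deg} I {a b M N f} gf {n} x.
Arguments tmap_zero {K G A deg} I {a b M N f} gf n.
Arguments eq_tmap {K G A deg I a b M N f f' n x} _.
Arguments strand_mk {K G A deg} I a {M} x.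

(** * Comparison with injective resolutions *)

Section Comparison.
Variables (K : fieldType) (G : zmodType) (A : comAlgType K) (deg : grading G A).
Variable (I : set A).
Implicit Types M N P : graded_module deg.

Lemma linear_alin M N (f : {linear M -> N}) : alin f.
Proof. by move=> r x y; rewrite linearP. Qed.

Lemma graded_hom_gmap M N (f : {linear M -> N}) : graded_hom f -> gmap 0 f.
Proof.
move=> gf; split; first exact: alin_klin (linear_alin f).
by move=> g x gx; rewrite addr0; exact: gf.
Qed.

(** An injective [E] is a retract of [CI E], and the contraction built from an A-linear retraction
    stays inside the torsion part. *)
Lemma injective_TZ E a j : graded_injective E -> j != 0 -> TZ I (E : graded_module deg) a j.
Proof.
move=> /injective_retract[rho [rl rg rK]]; case: j => // j _ x dx.
have dx0 : cobar_d (strand_val x) = 0 by rewrite -torsion_cobar_dE dx.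
have [tx ax] := strand_valP x.
have := retract_homotopy rl rg rK (strand_val x).
rewrite dx0 (klin0 (retract_gmap rg _).1) => /esym/eqP.
rewrite addr_eq0 => /eqP xE.
have [ld gd] := (cobar_d_alin (M := E) (n := j.+1), cobar_d_gmap E j.+1).
pose y := retract rho (strand_val x).
have ty : torsion I y by apply: torsion_alin tx; exact: retract_alin.
have ay : module_part a y by rewrite -[a]addr0; apply: (retract_gmap rg _).2.
(* For a cocycle the homotopy formula reads [0 = d y + (-1)^(j+2) x]. *)
exists (- ((-1) ^+ j.+2) *: strand_mk I a y).
apply: strand_eq; rewrite torsion_cobar_dE strand_valZ strand_mkE //.
rewrite (alinZ ld) xE.
rewrite -in_algE rmorphN rmorphXn rmorphN rmorph1 scalerN scaleNr opprK scalerA.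
by rewrite -exprMn mulrNN mulr1 expr1n scale1r.
Qed.

Variables (M : graded_module deg) (E : injective_resolution M) (a : G).

Let aug := resolution_aug E.
Let aug_gmap : gmap 0 aug.
Proof. exact/graded_hom_gmap/resolution_aug_graded. Qed.
Let rd := resolution_diff E.
Let rd_gmap n : gmap 0 (rd n).
Proof. exact/graded_hom_gmap/resolution_diff_graded. Qed.

(** Identifies degree 0 cohomology with the torsion of [N]: as [eta] is A-linear and injective,
    whatever kills [eta w] kills [w]. *)
Lemma degree0_cocycle N (x : torsion_cobar I a N 0) :
  differential (torsion_cobar I a N) 0 x = 0 ->
  [/\ strand_val x = eta (ev 1 (strand_val x)), torsion I (ev 1 (strand_val x)) &
      module_part a (ev 1 (strand_val x))].
Proof.
move=> dx; have dx0 : cobar_d (strand_val x) = 0 by rewrite -torsion_cobar_dE dx.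
have xE := cobar_exact dx0; have [[k tx] ax] := strand_valP x; split=> //.
  exists k => r /tx; rewrite {1}xE -(alinZ (@eta_alin _ _ _ _ N)).
  exact: cobar_d0_inj.
have := (ev_gmap N (degree_part1 deg)).2 _ _ ax.
by rewrite addr0.
Qed.

Lemma degree0_surj N (w : N) : torsion I w -> module_part a w ->
  exists x : torsion_cobar I a N 0,
    differential (torsion_cobar I a N) 0 x = 0 /\ ev 1 (strand_val x) = w.
Proof.
move=> tw aw.
have te : torsion I (eta w) by apply: torsion_alin tw; exact: eta_alin.
have ae : module_part a (eta w) by rewrite -[a]addr0; apply: (eta_gmap N).2.
exists (strand_mk I a (eta w : cobar N 1)); split.
  by apply: strand_eq; rewrite torsion_cobar_dE strand_mkE // (cobar_dK (n := 0)).
by rewrite strand_mkE // /ev etaE scale1r.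
Qed.

(** Column [q] of the double complex is the torsion cobar complex of [E q]. Rows are exact because
    the resolution splits over K, columns are exact off degree 0 because [E q] is injective, and
    their degree 0 cohomology is the torsion of [E q]. *)
Theorem local_cohomology_cobar i :
  liso (local_cohomology I E i a) (cohomology (torsion_cobar I a M) i).
Proof.
apply: liso_sym.
pose pi q (x : torsion_cobar I a (E q) 0) : torsion_complex I E a q :=
  sub_mk (torsion_strand I E a q) (ev 1 (strand_val x)).
have piE q (x : torsion_cobar I a (E q) 0) :
    differential (torsion_cobar I a (E q)) 0 x = 0 ->
    val (pi q x) = ev 1 (strand_val x).
  by move=> /degree0_cocycle[_ tx ax]; apply: sub_mkE.
have := @double_complex_iso K (torsion_cobar I a M) (torsion_complex I E a)
  (fun q => torsion_cobar I a (E q)) (fun p => @tmap _ _ _ _ I a a _ _ aug p)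
  (fun q p => @tmap _ _ _ _ I a a _ _ (rd q) p)
  _ _ _ _ _ _ _ _ _ 0 _ pi _ _ _ _ i.
rewrite addn0; apply.
- by move=> p k x y; exact: (tmap_lin I (gmap_same a aug_gmap)).
- by move=> q p k x y; exact: (tmap_lin I (gmap_same a (rd_gmap q))).
- by move=> p x; exact: (tmap_d I (gmap_same a aug_gmap) _ (linear_alin aug)).
- by move=> q p x; exact: (tmap_d I (gmap_same a (rd_gmap q)) _ (linear_alin (rd q))).
- move=> p x; apply: (tmap_inj aug_gmap) => y ay; apply: (@resolution_aug_inj _ _ _ _ _ E).
  by rewrite raddf0.
- move=> p x; rewrite -(tmap_comp0 _ aug_gmap (rd_gmap 0)).
  rewrite -[RHS](@tmap0 _ _ _ _ I a a M (E 1%N) p x); apply: eq_tmap => y /=.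
  by apply/(resolution_exact0 (i := E)); exists y.
- move=> q p x; rewrite -(tmap_comp0 _ (rd_gmap q) (rd_gmap q.+1)).
  rewrite -[RHS](@tmap0 _ _ _ _ I a a (E q) (E q.+2) p x); apply: eq_tmap => y /=.
  by apply/(resolution_exactS (i := E)); exists y.
- move=> p x; apply: (tmap_exact aug_gmap (rd_gmap 0)) => y.
  by move=> /(resolution_exact0 (i := E)).
- move=> q p x; apply: (tmap_exact (rd_gmap q) (rd_gmap q.+1)) => y.
  by move=> /(resolution_exactS (i := E)).
- move=> q j j0; apply: injective_TZ j0; exact: resolution_injective.
- move=> q k x y dx dy; apply: val_inj; rewrite piE; last first.
    by rewrite linearP /= dx dy scaler0 addr0.
  transitivity (k%:A *: val (pi q x) + val (pi q y) : E q) => //.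
  by rewrite !piE // strand_valL (ev_gmap _ (degree_part1 deg)).1.
- move=> q w; have [tw aw] := sub_valP w.
  have [x [dx xw]] := degree0_surj tw aw; exists x => //.
  by apply: val_inj; rewrite piE.
- move=> q x dx; split=> [px|/= ->].
    have [xE _ _] := degree0_cocycle dx.
    apply: strand_eq; rewrite xE -(piE _ _ dx) px.
    exact: (klin0 (eta_gmap (E q)).1).
  apply: val_inj; rewrite piE ?raddf0 //.
- move=> q x dx; apply: val_inj; rewrite piE.
    rewrite (tmapE I (gmap_same a (rd_gmap q))).
    rewrite /= piE // /ev.
    exact: (ci_mapE (rd_gmap q)).
  rewrite -(tmap_d I (gmap_same a (rd_gmap q)) _ (linear_alin (rd q))) dx.
  exact: (tmap_zero I (gmap_same a (rd_gmap q))).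
Qed.
End Comparison.

(** * Nilpotent action of the ideal on local cohomology *)

Section Nilpotency.
Variables (K : fieldType) (G : zmodType) (A : comAlgType K) (deg : grading G A).
Variable (I : set A).
Implicit Types M N P : graded_module deg.

Lemma deg_expr e (r : A) k : deg e r -> deg (e *+ k) (r ^+ k).
Proof.
move=> er; elim: k => [|k IHk]; first exact: degree_part1.
by rewrite exprS mulrS; exact: degree_partM.
Qed.

Lemma ideal_exp_expr (r : A) k : I r -> ideal_exp I k (r ^+ k).
Proof.
move=> Ir; elim: k => //= k IHk; exists [:: (r, r ^+ k)].
  by move=> p; rewrite inE => /eqP ->.
by rewrite big_seq1 exprS.
Qed.

(* Multiplication by r^k on M and on the cobar resolution of M are homotopic,
   and the latter kills a given torsion element for large k. *)
Lemma inner_nilpotent M a e (r : A) j (x : torsion_cobar I a M j) :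
  I r -> deg e r -> differential (torsion_cobar I a M) j x = 0 ->
  exists k, forall b, b = a + e *+ k ->
    is_coboundary (tmap I a b (fun y : M => r ^+ k *: y) x : torsion_cobar I b M j).
Proof.
move=> Ir er dx; have [[k tx] ax] := strand_valP x; exists k => b bE.
have dx0 : cobar_d (strand_val x) = 0 by rewrite -torsion_cobar_dE dx.
have ek := deg_expr k er; have rx := tx _ (ideal_exp_expr k Ir).
have gk : gmap (b - a) (fun y : M => r ^+ k *: y).
  by rewrite bE addrAC subrr add0r; exact: gmap_scale.
case: j x dx tx ax dx0 rx => [|j] x dx tx ax dx0 rx.
  apply: strand_eq; rewrite (tmapE I gk).
  have := homotopy0 ek (strand_val x).
  rewrite rx dx0 (klin0 (homotopy_spec ek M 0).2.1) add0r => /eqP.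
  by rewrite oppr_eq0 => /eqP.
have [lh gh] := homotopy_spec ek M j.
pose y := - homotopy (r ^+ k) (strand_val x).
have ty : torsion I y.
  have th : torsion I (homotopy (r ^+ k) (strand_val x)).
    by apply: torsion_alin lh _; exists k.
  by rewrite /y -scaleN1r; exact: torsionZ.
have ay : module_part b y by rewrite bE; apply: module_partN; exact: gh.2.
exists (strand_mk I b y); apply: strand_eq.
rewrite (tmapE I gk) torsion_cobar_dE strand_mkE //.
have := homotopyP ek (strand_val x).
rewrite rx dx0 (klin0 (homotopy_spec ek M j.+1).2.1) addr0 add0r => /eqP.
by rewrite eqr_oppLR -(klinN (cobar_d_gmap M j.+1).1) => /eqP.
Qed.

(** Multiplication by [r] is [f], injective on cohomology in the degrees of [Q], followed by the
    isomorphism [g] of degree [e]. So it is injective there, and by [inner_nilpotent] some power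
    kills each class. [Q] has to be stable because degrees rise by [e]. *)
Lemma TZ_nilpotent M N (f : M -> N) (g : N -> M) (g' : M -> N) (e : G) (r : A)
    (Q : G -> Prop) j :
  gmap 0 f -> alin g -> gmap e g -> alin g' -> gmap (- e) g' ->
  cancel g g' -> cancel g' g ->
  I r -> deg e r -> (forall x, g (f x) = r *: x) ->
  (forall b, Q b -> Q (b + e)) ->
  (forall b (x : torsion_cobar I b M j), Q b -> differential (torsion_cobar I b M) j x = 0 ->
     is_coboundary (tmap I b b f x : torsion_cobar I b N j) -> is_coboundary x) ->
  forall b, Q b -> TZ I M b j.
Proof.
move=> gf lg gg lg' gg' gK g'K Ir er gfr Qe inj b Qb x dx.
have [k] := inner_nilpotent Ir er dx.
elim: k b Qb x dx => [|k IHk] b Qb x dx bk.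
  have := bk b; rewrite mulr0n addr0 => /(_ erefl).
  by rewrite (eq_tmap (f' := id)) ?tmap_id // => y; rewrite expr0 scale1r.
have gr : gmap (b + e - b) (fun y : M => r *: y).
  by rewrite addrAC subrr add0r; exact: gmap_scale.
have gge : gmap (b + e - b) g by rewrite addrAC subrr add0r.
have gge' : gmap (b - (b + e)) g' by rewrite opprD addrA subrr add0r.
apply: inj => //.
have : is_coboundary (tmap I b (b + e) (fun y : M => r *: y) x :
    torsion_cobar I (b + e) M j).
  apply: IHk; first exact: Qe.
    by rewrite -(tmap_d I gr) ?dx ?(tmap_zero I gr) // => s y z; rewrite scalerDr !scalerA mulrC.
  move=> c cE; rewrite -(tmap_comp (b := b + e)) //.
    rewrite (eq_tmap (f' := fun y => r ^+ k.+1 *: y)).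
      by apply: bk; rewrite cE mulrS addrA.
    by move=> y /=; rewrite scalerA -exprSr.
  by rewrite cE addrAC subrr add0r; apply: gmap_scale; exact: deg_expr.
have -> : tmap I b (b + e) (fun y : M => r *: y) x = tmap I b (b + e) g (tmap I b b f x).
  rewrite -tmap_comp //; last exact: gmap_same.
  by apply: eq_tmap => y /=; rewrite gfr.
set z := tmap I b b f x.
have -> : is_coboundary z = is_coboundary (tmap I (b + e) b g' (tmap I b (b + e) g z) : torsion_cobar I b N j).
  congr is_coboundary; rewrite -tmap_comp //; rewrite -[LHS]tmap_id.
  by apply: eq_tmap => y /=; rewrite gK.
move: (tmap I b (b + e) g z) => {bk z dx x}.
case: j {IHk} => [|j] u.
  by move=> ->; exact: (tmap_zero I gge' 0).
by move=> [v ->]; exists (tmap I (b + e) b g' v); rewrite (tmap_d I gge').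
Qed.
End Nilpotency.

(** * Modules with a monomial basis *)

Section MonomialModules.
Variables (R : realType) (d : nat) (S : fan R d) (K : fieldType).
Local Notation pt := ('rV[int]_d).

(* A module with basis the pairs (l, p) with [mono_pt l p], in degree p, where
   x^s (l, p) is (l, p + s) if [mono_ok l s p], and 0 otherwise. *)
Record mono_data (L : finType) := MonoData {
  mono_pt : L -> pt -> bool;
  mono_ok : L -> pt -> pt -> bool;
  mono_okD : forall l s p, mono_pt l p -> support_point S s ->
    mono_ok l s p -> mono_pt l (p + s);
  mono_ok0 : forall l p, mono_pt l p -> mono_ok l 0 p;
  mono_okM : forall l s t p, mono_pt l p -> support_point S s ->
    support_point S t -> mono_ok l s p && mono_ok l t (p + s) =
    in_common_cone S s t && mono_ok l (s + t) p }.

Section Module.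
Variables (L : finType) (D : mono_data L).

Definition mono_basis : Type := {x : L * pt | mono_pt D x.1 x.2}.
HB.instance Definition _ := Choice.on mono_basis.
HB.instance Definition _ := SubChoice.on mono_basis.

Definition mono_elt (l : L) (p : pt) : {malg K[mono_basis]} :=
  if insub (l, p) is Some b then << b >> else 0.

Lemma mono_eltE (b : mono_basis) : mono_elt (val b).1 (val b).2 = << b >>.
Proof. by rewrite /mono_elt -surjective_pairing valK. Qed.

(** Coordinates are indexed by all pairs and vanish off the basis, so that identities between maps
    need no membership proofs. *)
Definition lcoef (l : L) (p : pt) (x : {malg K[mono_basis]}) : K :=
  if insub (l, p) is Some b then x@_b else 0.

Lemma lcoefP l p k x y : lcoef l p (k *: x + y) = k * lcoef l p x + lcoef l p y.
Proof.
rewrite /lcoef; case: insubP => [b _ _|_]; last by rewrite mulr0 addr0.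
by rewrite mcoeffD mcoeffZ.
Qed.

Lemma lcoef0 l p : lcoef l p 0 = 0.
Proof. by have := lcoefP l p (-1) 0 0; rewrite scaler0 addr0 mulN1r addNr. Qed.

Lemma lcoefD l p x y : lcoef l p (x + y) = lcoef l p x + lcoef l p y.
Proof. by have := lcoefP l p 1 x y; rewrite scale1r mul1r. Qed.

Lemma lcoefZ l p k x : lcoef l p (k *: x) = k * lcoef l p x.
Proof. by have := lcoefP l p k x 0; rewrite lcoef0 !addr0. Qed.

Lemma lcoef_out l p x : ~~ mono_pt D l p -> lcoef l p x = 0.
Proof. by move=> lp; rewrite /lcoef insubN. Qed.

Lemma lcoef_elt l p l' p' :
  lcoef l p (mono_elt l' p') = ((l' == l) && (p' == p) && mono_pt D l p)%:R.
Proof.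
rewrite /lcoef; case: insubP => [b lp bE|/negbTE /= ->]; last by rewrite andbF.
rewrite /= in lp; rewrite lp andbT /mono_elt; case: insubP => [b' lp' bE'|/= lp'].
  by rewrite mcoeffU -(inj_eq val_inj) bE bE'.
rewrite mcoeff0; case: eqP => // l'l; case: eqP => // p'p.
by rewrite l'l p'p lp in lp'.
Qed.

Lemma lcoef_sum l p (J : Type) (r : seq J) (F : J -> {malg K[mono_basis]}) :
  lcoef l p (\sum_(i <- r) F i) = \sum_(i <- r) lcoef l p (F i).
Proof. exact: (big_morph (lcoef l p) (lcoefD l p) (lcoef0 l p)). Qed.

Lemma lcoef_inj x y : (forall l p, lcoef l p x = lcoef l p y) -> x = y.
Proof.
move=> xy; apply/malgP => b; have := xy (val b).1 (val b).2.
by rewrite /lcoef -surjective_pairing valK.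
Qed.

Definition mono_mul (s : pt) (x : {malg K[mono_basis]}) : {malg K[mono_basis]} :=
  linear_ext (fun b : mono_basis => if mono_ok D (val b).1 s (val b).2
    then mono_elt (val b).1 ((val b).2 + s) else 0) x.

Lemma mono_mulP s k x y : mono_mul s (k *: x + y) = k *: mono_mul s x + mono_mul s y.
Proof. exact: linearP. Qed.

Lemma lcoef_mul l q s x : support_point S s -> lcoef l q (mono_mul s x) =
  if mono_pt D l (q - s) && mono_ok D l s (q - s) then lcoef l (q - s) x else 0.
Proof.
move=> sS; elim/malg_basis_ind: x => [|k x y IHx IHy|b].
- by rewrite /mono_mul raddf0 !lcoef0 if_same.
- rewrite mono_mulP lcoefP IHx IHy lcoefP.
  by case: ifP => // _; rewrite mulr0 addr0.
rewrite /mono_mul linear_extU -mono_eltE lcoef_elt.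
case: b => -[m p] /= mp.
have [/andP[/eqP ml /eqP pq]|ne] := boolP ((m == l) && (p + s == q)).
  subst m q; rewrite addrK mp eqxx eqxx /=; case: ifP => // ok.
    by rewrite lcoef_elt !eqxx (mono_okD mp sS ok).
  by rewrite lcoef0.
have pq : (p + s == q) = (p == q - s) by rewrite [RHS]eq_sym subr_eq eq_sym.
rewrite -pq (negbTE ne) if_same.
case: ifP => // _; last by rewrite lcoef0.
by rewrite lcoef_elt (negbTE ne).
Qed.

Definition mono_act (f : face_ring S K) (x : {malg K[mono_basis]}) :
    {malg K[mono_basis]} :=
  linear_ext (fun s : support_points S => mono_mul (val s) x) f.

Lemma mono_actDl k f g x : mono_act (k *: f + g) x = k *: mono_act f x + mono_act g x.
Proof. exact: linearP. Qed.

Lemma mono_actDr k f x y : mono_act f (k *: x + y) = k *: mono_act f x + mono_act f y.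
Proof.
rewrite /mono_act -linear_ext_comb; congr linear_ext.
by apply/funext => s; exact: mono_mulP.
Qed.

Lemma mono_act0l x : mono_act 0 x = 0.
Proof. exact: linear0. Qed.

Lemma mono_actU s x : mono_act << s >> x = mono_mul (val s) x.
Proof. exact: linear_extU. Qed.

Lemma mono_act_monomial s x : support_point S s ->
  mono_act (face_monomial S K s) x = mono_mul s x.
Proof. by move=> sS; rewrite /face_monomial insubT mono_actU. Qed.

Lemma mono_mulM s t x : support_point S s -> support_point S t ->
  mono_mul t (mono_mul s x) =
  if in_common_cone S s t then mono_mul (s + t) x else 0.
Proof.
move=> sS tS; apply: lcoef_inj => l q; rewrite lcoef_mul // lcoef_mul //.
have [st|st] := boolP (in_common_cone S s t); last first.
  rewrite lcoef0; case: ifP => // /andP[_ ok2]; case: ifP => // /andP[pt1 ok1].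
  by have := mono_okM pt1 sS tS; rewrite subrK ok1 ok2 (negbTE st).
rewrite lcoef_mul; last exact: in_common_coneD.
rewrite opprD addrA [q - s - t]addrAC.
have [pt1|pt1] := boolP (mono_pt D l (q - t - s)); last by rewrite /= if_same.
have := mono_okM pt1 sS tS; rewrite st subrK /= => <-.
case ok1: (mono_ok D l s (q - t - s)) => //=; last by rewrite if_same.
by have := mono_okD pt1 sS ok1; rewrite subrK => ->.
Qed.

Definition mono_carrier : Type := {malg K[mono_basis]}.
HB.instance Definition _ := GRing.Zmodule.on mono_carrier.

Fact mono_actA f g (x : mono_carrier) : mono_act f (mono_act g x) = mono_act (f * g) x.
Proof.
rewrite -[f * g]/(face_mul f g).
elim/malg_basis_ind: f => [|c f1 f2 IH1 IH2|a].
- by rewrite face_mul0l !mono_act0l.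
- by rewrite face_mulDl !mono_actDl IH1 IH2.
have act0 h : mono_act h 0 = 0.
  by have := mono_actDr (-1) h 0 0; rewrite scaler0 addr0 scaleN1r addNr.
elim/malg_basis_ind: g => [|c g1 g2 IH1 IH2|b].
- by rewrite face_mul0r mono_act0l act0.
- by rewrite face_mulDr !mono_actDl mono_actDr IH1 IH2.
rewrite face_mulU !mono_actU mono_mulM ?(valP a) ?(valP b) //.
rewrite /face_monomial_mul in_common_coneC; case: ifP => ab.
  rewrite mono_act_monomial; last exact: in_common_coneD.
  by rewrite [val a + _]addrC.
by rewrite mono_act0l.
Qed.

Fact mono_act1 : left_id 1 mono_act.
Proof.
move=> x; rewrite -[1]/(face_monomial S K 0) mono_act_monomial ?support_point0 //.
apply: lcoef_inj => l q; rewrite lcoef_mul ?support_point0 // subr0.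
have [lq|lq] := boolP (mono_pt D l q); first by rewrite mono_ok0.
by rewrite lcoef_out.
Qed.

Fact mono_act_addr : right_distributive mono_act +%R.
Proof. by move=> f x y; have := mono_actDr 1 f x y; rewrite !scale1r. Qed.

Fact mono_act_addl x : {morph mono_act^~ x : f g / f + g}.
Proof. by move=> f g; have := mono_actDl 1 f g x; rewrite !scale1r. Qed.

HB.instance Definition _ := GRing.Zmodule_isLmodule.Build (face_ring S K) mono_carrier
  mono_actA mono_act1 mono_act_addr mono_act_addl.

Definition mono_deg (b : mono_basis) : pt := (val b).2.

Definition mono_part (g : pt) (x : mono_carrier) : Prop :=
  forall l p, lcoef l p x != 0 -> p = g.

Lemma mono_partE g x : mono_part g x <-> malg_part mono_deg g x.
Proof.
split=> gx.
  move=> b xb; apply: (gx (val b).1 (val b).2).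
  by rewrite /lcoef -surjective_pairing valK.
by move=> l p; rewrite /lcoef; case: insubP => [b _ bE /gx|]; rewrite ?eqxx // /mono_deg bE.
Qed.

Fact mono_part0 g : mono_part g 0.
Proof. by move=> l p; rewrite lcoef0 eqxx. Qed.

Fact mono_partD g x y : mono_part g x -> mono_part g y -> mono_part g (x + y).
Proof. by move=> /mono_partE gx /mono_partE gy; apply/mono_partE/malg_partD. Qed.

Lemma face_ring_ind (P : face_ring S K -> Prop) : P 0 ->
  (forall c f g, P f -> P g -> P (c *: f + g)) ->
  (forall s, support_point S s -> P (face_monomial S K s)) -> forall f, P f.
Proof.
move=> P0 PD Ps; elim/malg_basis_ind => // s.
by rewrite -face_monomialE; exact: Ps (valP s).
Qed.

Lemma mono_scale_monomial s (x : mono_carrier) : support_point S s ->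
  (face_monomial S K s : face_ring S K) *: x = mono_mul s x.
Proof. exact: mono_act_monomial. Qed.

Fact mono_partZ g h f (x : mono_carrier) :
  face_grading S K g f -> mono_part h x -> mono_part (g + h) (f *: x).
Proof.
move=> gf hx; rewrite -[f *: x]/(mono_act f x) /mono_act linear_ext.unlock.
have sumP (J : eqType) (r : seq J) (F : J -> mono_carrier) :
    (forall i, i \in r -> mono_part (g + h) (F i)) -> mono_part (g + h) (\sum_(i <- r) F i).
  move=> hF; apply/mono_partE/malg_part_sum => i ir; exact/mono_partE/hF.
apply: sumP => s sf; rewrite -mcoeff_neq0 in sf; have <- := gf s sf.
move=> l q; rewrite lcoefZ lcoef_mul ?(valP s) //.
rewrite mulf_eq0 negb_or => /andP[_]; case: ifP => [_ /hx <-|]; last by rewrite eqxx.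
by rewrite addrC subrK.
Qed.

Lemma mono_part_direct : direct_decomposition mono_part.
Proof.
have [d1 d2] := malg_part_direct K mono_deg; split.
  move=> x; have [s [y [gy ->]]] := d1 x; exists s, y; split=> // g.
  exact/mono_partE.
by move=> s y us gy y0; apply: d2 us _ y0 => g; exact/mono_partE.
Qed.

Definition mono_module : graded_module (face_grading S K) :=
  @GradedModule K pt (face_ring S K) (face_grading S K) mono_carrier mono_part
    mono_part0 mono_partD mono_partZ mono_part_direct.

Lemma mono_scaleK (k : K) (x : mono_module) : (k%:A : face_ring S K) *: x = 
  (k *: (x : {malg K[mono_basis]}) : {malg K[mono_basis]}).
Proof.
rewrite -[LHS]/(mono_act (k *: 1) x).
have := mono_actDl k 1 0 x; rewrite addr0 mono_act0l addr0 => ->.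
by rewrite mono_act1.
Qed.
End Module.
End MonomialModules.

Section Transfers.
Variables (R : realType) (d : nat) (S : fan R d) (K : fieldType).
Local Notation pt := ('rV[int]_d).

Lemma alin_monomial (M N : graded_module (face_grading S K)) (f : M -> N) :
  klin f -> (forall s, support_point S s -> forall x,
    f ((face_monomial S K s : face_ring S K) *: x) =
    (face_monomial S K s : face_ring S K) *: f x) -> alin f.
Proof.
move=> lf fs; suff fZ (r : face_ring S K) x : f (r *: x) = r *: f x.
  by move=> r x y; rewrite (klinD lf) fZ.
elim/face_ring_ind: r => [|c r r' IHr IHr'|s sS]; last exact: fs.
- by rewrite !scale0r (klin0 lf).
- have cE : c *: r = c%:A * r by rewrite mulr_algl.
  rewrite cE !scalerDl -!scalerA (klinD lf) (klinZ lf).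
  by rewrite IHr IHr'.
Qed.

Section Transfer.
Variables (L L' : finType) (D : mono_data S L) (D' : mono_data S L').
Variables (e : pt) (kappa : L -> L' -> pt -> K).
Local Notation M := (mono_module K D).
Local Notation M' := (mono_module K D').

(** The map of degree [e] with matrix [kappa]. Target pairs outside the basis of [D'] are dropped,
    since [mono_elt] is 0 there; inclusions, projections and translations are all of this kind. *)
Definition transfer (x : M) : M' :=
  linear_ext (fun b : mono_basis D => \sum_l'
    kappa (val b).1 l' (val b).2 *: mono_elt K D' l' ((val b).2 + e)) x.

Lemma transferP k (x y : {malg K[mono_basis D]}) :
  transfer (k *: x + y) =
  k *: (transfer x : {malg K[mono_basis D']}) + (transfer y : {malg K[mono_basis D']}).
Proof. exact: linearP. Qed.

Lemma lcoef_transfer l' q x : lcoef l' q (transfer x) =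
  if mono_pt D' l' q then \sum_l kappa l l' (q - e) * lcoef l (q - e) x else 0.
Proof.
elim/malg_basis_ind: x => [|k x y IHx IHy|b].
- rewrite /transfer raddf0 lcoef0; case: ifP => // _.
  by rewrite big1 // => l _; rewrite lcoef0 mulr0.
- rewrite transferP lcoefP IHx IHy.
  case: ifP => _; last by rewrite mulr0 addr0.
  rewrite mulr_sumr -big_split; apply: eq_bigr => l _ /=.
  by rewrite lcoefP mulrDr mulrCA.
rewrite /transfer linear_extU lcoef_sum.
rewrite (bigD1 l') //= big1 ?addr0; last first.
  by move=> l /negbTE ll'; rewrite lcoefZ lcoef_elt ll' mulr0.
rewrite lcoefZ lcoef_elt eqxx /=; case: ifP => l'q; last by rewrite andbF mulr0.
rewrite andbT (bigD1 (val b).1) //= big1 ?addr0; last first.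
  move=> l ll'; rewrite -mono_eltE lcoef_elt [_ == l]eq_sym (negbTE ll').
  by rewrite mulr0.
rewrite -mono_eltE lcoef_elt eqxx /=.
have -> : ((val b).2 + e == q) = ((val b).2 == q - e).
  by rewrite [RHS]eq_sym subr_eq eq_sym.
by case: eqP => [<-|_]; rewrite ?mulr0 // (valP b).
Qed.

Lemma transfer_gmap : gmap e transfer.
Proof.
split.
  move=> k x y; rewrite !mono_scaleK; exact: linearP.
move=> g x gx l q; rewrite lcoef_transfer; case: ifP => _; last by rewrite eqxx.
move=> /eqP nz; apply: contrapT => qg; apply: nz; apply: big1 => l' _.
have [->|/gx qe] := eqVneq (lcoef l' (q - e) x) 0; first by rewrite mulr0.
by case: qg; rewrite -qe subrK.
Qed.

(** The hypothesis compares the coefficient at [(l', p + e + s)] for both orders: transfer before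
    multiplication on the left, after it on the right. *)
Lemma transfer_alin :
  (forall s l l' p, support_point S s -> mono_pt D l p ->
    (if mono_pt D' l' (p + e) && mono_ok D' l' s (p + e) then kappa l l' p else 0) =
    (if mono_ok D l s p && mono_pt D' l' (p + e + s) then kappa l l' (p + s) else 0)) ->
  alin transfer.
Proof.
move=> H; apply: (alin_monomial transfer_gmap.1) => s sS x.
rewrite !mono_scale_monomial //; apply: lcoef_inj => l' q.
rewrite lcoef_mul // !lcoef_transfer.
transitivity (\sum_l (if mono_pt D' l' (q - s) && mono_ok D' l' s (q - s) then
    kappa l l' (q - e - s) else 0) * lcoef l (q - e - s) x); last first.
  case: ifP => [/andP[-> _]|_].
    by apply: eq_bigr => l _; rewrite [q - s - e]addrAC.
  by apply: big1 => l _; rewrite mul0r.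
transitivity (\sum_l (if mono_pt D' l' q then kappa l l' (q - e) else 0) *
    lcoef l (q - e) (mono_mul s x)).
  case: ifP => // _; by rewrite big1 // => l _; rewrite mul0r.
apply: eq_bigr => l _; rewrite lcoef_mul //.
have [pl|pl] := boolP (mono_pt D l (q - e - s)); last first.
  by rewrite /= [in RHS]lcoef_out // !mulr0.
have := H s l l' (q - e - s) sS pl.
rewrite [q - e - s + e]addrAC !subrK => ->.
by rewrite /=; case: (mono_ok D l s _) => //=; rewrite mulr0 mul0r.
Qed.
End Transfer.

Lemma in_cone_add (C : face_poset S) a b : in_common_cone S a b ->
  in_cone C (a + b) = in_cone C a && in_cone C b.
Proof.
move=> /asboolP[D [DS Da Db]]; apply/idP/andP.
  move=> /asboolP; rewrite real_pointD => Cab.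
  by have [] := fan_addP DS (valP C) Da Db Cab; split; apply/asboolP.
move=> [/asboolP Ca /asboolP Cb]; apply/asboolP; rewrite real_pointD.
by apply: rational_coneD => //; exact: fan_rational (valP C).
Qed.

Lemma in_common_coneP (C : face_poset S) a b : in_cone C a -> in_cone C b ->
  in_common_cone S a b.
Proof.
by move=> /asboolP Ca /asboolP Cb; apply/asboolP; exists (val C); split=> //; exact: valP.
Qed.

Lemma in_cone_support (C : face_poset S) a : in_cone C a -> support_point S a.
Proof. by move=> /asboolP Ca; apply/asboolP; exists (val C) => //; exact: valP. Qed.

Lemma in_cone_addL (C : face_poset S) a b : in_cone C a -> in_cone C b ->
  in_cone C (a + b).
Proof. by move=> Ca Cb; rewrite (in_cone_add C (in_common_coneP Ca Cb)) Ca. Qed.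

Section ConeData.
Variables (C : face_poset S) (X : pt -> bool).
(** Makes the span of [X] a module: multiplying by two monomials of the cone may not leave [X] and
    come back, so acting in two steps agrees with acting by the product. *)
Definition cone_convex := forall p s t, in_cone C s -> in_cone C t ->
  X p -> X (p + s + t) -> X (p + s).
Hypothesis X_convex : cone_convex.

Program Definition cone_data : mono_data S unit :=
  {| mono_pt := fun _ p => X p; mono_ok := fun _ s p => in_cone C s && X (p + s) |}.
Next Obligation. by move=> _ s p /= _ _ /andP[]. Qed.
Next Obligation. by move=> _ p /=; rewrite addr0 in_cone0. Qed.
Next Obligation.
move=> _ s t p /= Xp sS tS; apply/idP/idP => [/andP[/andP[Cs Xs] /andP[Ct Xt]]|].
  by rewrite (in_common_coneP Cs Ct) in_cone_addL // addrA.
move=> /andP[st /andP[]]; rewrite (in_cone_add C st) addrA => /andP[Cs Ct] Xst.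
by rewrite Cs Ct Xst (X_convex Cs Ct).
Qed.
End ConeData.

Section ChainData.
Variable q : nat.
Definition in_chain (c : chain (face_poset S) q) (s : pt) := [forall i, in_cone (val c i) s].

Lemma in_chainD c s t : in_common_cone S s t ->
  in_chain c (s + t) = in_chain c s && in_chain c t.
Proof.
move=> st; apply/forallP/andP => [H|[/forallP Hs /forallP Ht] i].
  by split; apply/forallP => i; have := H i; rewrite (in_cone_add _ st) => /andP[].
by rewrite (in_cone_add _ st) Hs Ht.
Qed.

(** For [q = 0] the condition on chains is empty and this is the face ring. For [q > 0] it is the
    direct sum, over the chains, of the rings of their smallest cones. *)
Program Definition chain_data : mono_data S (chain (face_poset S) q) :=
  {| mono_pt := fun c p => support_point S p && in_chain c p;
     mono_ok := fun c s p => in_common_cone S s p && in_chain c s |}.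
Next Obligation.
move=> c s p /= /andP[pS cp] sS /andP[sp cs].
by rewrite addrC (in_common_coneD sp) in_chainD // cs cp.
Qed.
Next Obligation.
move=> c p /= /andP[pS _]; rewrite in_common_cone0 //=.
by apply/forallP => i; exact: in_cone0.
Qed.
Next Obligation.
move=> c s t p /= _ _ _.
have A : in_common_cone S s p && in_common_cone S t (p + s) =
    in_common_cone S s t && in_common_cone S (s + t) p.
  rewrite (in_common_coneC _ s p) (in_common_coneC _ t) in_common_coneA.
  by rewrite (in_common_coneC _ p).
rewrite andbACA A; have [st|] := boolP (in_common_cone S s t); last by [].
by rewrite in_chainD // !andbA.
Qed.
End ChainData.
End Transfers.

Lemma torsion_cobar_liso (K : fieldType) (G : zmodType) (A : comAlgType K)
    (deg : grading G A) (I : set A) (M N : graded_module deg) (f : M -> N) (g : N -> M) a i :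
  alin f -> alin g -> gmap 0 f -> gmap 0 g -> cancel f g -> cancel g f ->
  liso (cohomology (torsion_cobar I a M) i) (cohomology (torsion_cobar I a N) i).
Proof.
move=> lf lg gf gg fK gK; have gf' := gmap_same a gf; have gg' := gmap_same a gg.
have gfx n (x : torsion_cobar I a M n) : tmap I a a g (tmap I a a f x) = x.
  by rewrite -tmap_comp0 // -[RHS]tmap_id; apply: eq_tmap.
have fgx n (x : torsion_cobar I a N n) : tmap I a a f (tmap I a a g x) = x.
  by rewrite -tmap_comp0 // -[RHS]tmap_id; apply: eq_tmap.
apply: corr_liso.
exists (fun x y => differential (torsion_cobar I a M) i x = 0 /\ y = tmap I a a f x).
split.
- move=> k x y x' y' [dx ->] [dx' ->]; rewrite (tmap_lin I gf'); split=> //.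
  by rewrite linearP /= dx dx' scaler0 addr0.
- by move=> x dx; exists (tmap I a a f x).
- move=> y dy; exists (tmap I a a g y); rewrite fgx -(tmap_d I gg') // dy.
  by rewrite (tmap_zero I gg').
- move=> x y [dx ->]; split=> //; first by rewrite -(tmap_d I gf') // dx (tmap_zero I gf').
  case: i x dx {y} => [|i] x dx.
    split=> [->|fx]; first exact: (tmap_zero I gf' 0).
    by rewrite -[x]gfx fx; exact: (tmap_zero I gg' 0).
  split=> [[y ->]|[y fx]].
    by exists (tmap I a a f y); rewrite (tmap_d I gf').
  by exists (tmap I a a g y); rewrite -(tmap_d I gg') // -fx gfx.
Qed.

(** * The face ring and the cone rings as monomial modules *)

Section Isomorphisms.
Variables (R : realType) (d : nat) (S : fan R d) (K : fieldType).
Local Notation pt := ('rV[int]_d).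

Lemma klin_scale_comb (M N : graded_module (face_grading S K)) (f : M -> N)
    (r : face_ring S K) (k : K) x y : klin f -> f (r *: x) = r *: f x ->
  f (r *: y) = r *: f y -> f (r *: (k%:A *: x + y)) = r *: f (k%:A *: x + y).
Proof.
move=> lf fx fy; rewrite (klinD lf) (klinZ lf) !scalerDr (klinD lf) fy.
by rewrite !scalerA [r * k%:A]mulrC -!scalerA (klinZ lf) fx.
Qed.

Lemma mono_elt_basis (L : finType) (D : mono_data S L) l p : mono_pt D l p ->
  exists2 b : mono_basis D, mono_elt K D l p = << b >> & val b = (l, p).
Proof. by move=> lp; rewrite /mono_elt insubT; eexists; first by []. Qed.

Lemma mono_mul_elt (L : finType) (D : mono_data S L) l p s : mono_pt D l p ->
  mono_mul s (mono_elt K D l p) = if mono_ok D l s p then mono_elt K D l (p + s) else 0.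
Proof.
by move=> /mono_elt_basis[b -> bE]; rewrite /mono_mul linear_extU bE.
Qed.

Lemma mono_part_elt (L : finType) (D : mono_data S L) l p :
  mono_part p (mono_elt K D l p).
Proof.
by move=> l' p'; rewrite lcoef_elt; case: (p =P p') => [->|_] //; rewrite andbF eqxx.
Qed.

Lemma graded_malg (B : choiceType) (deg : B -> pt) (L : finType) (D : mono_data S L)
    (g : B -> {malg K[mono_basis D]}) (x : {malg K[B]}) a :
  (forall b, mono_part (deg b) (g b)) ->
  malg_part deg a x -> mono_part a (linear_ext g x).
Proof.
move=> gdeg ax; apply/mono_partE; rewrite linear_ext.unlock.
apply: malg_part_sum => s sx; apply: malg_partZ; apply/mono_partE.
by rewrite -mcoeff_neq0 in sx; rewrite -(ax _ sx).
Qed.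

Lemma face_scale_basis (s : pt) (b : support_points S) : support_point S s ->
  (face_monomial S K s : face_ring S K) *: (<< b >> : face_module S K) =
  (if in_common_cone S s (val b) then face_monomial S K (s + val b) else 0).
Proof.
move=> sS; rewrite -[LHS]/(face_mul (face_monomial S K s) << b >>).
by rewrite /face_monomial insubT face_mulU.
Qed.

Lemma face_scaleK (k : K) (x : face_module S K) :
  (k%:A : face_ring S K) *: x = (k *: (x : {malg K[support_points S]})).
Proof. by rewrite -[LHS]/(k%:A * (x : face_ring S K)) mulr_algl. Qed.

Lemma empty_chain_subproof (Q : finPOrderType set_display) (x : {ffun 'I_0 -> Q}) :
  [forall i : 'I_0, forall j : 'I_0, (i < j)%N ==> (x i < x j)%O].
Proof. by apply/forallP => -[]. Qed.

Definition empty_chain : chain (face_poset S) 0 :=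
  Sub (ffun0 (card_ord 0)) (empty_chain_subproof _).

Lemma empty_chainE (c : chain (face_poset S) 0) : c = empty_chain.
Proof. by apply: val_inj; apply/ffunP => -[]. Qed.

Lemma in_empty_chain (c : chain (face_poset S) 0) s : in_chain c s.
Proof. by apply/forallP => -[]. Qed.

Definition face_to_mono (x : face_module S K) : mono_module K (chain_data S 0) :=
  linear_ext (fun b : support_points S => mono_elt K (chain_data S 0) empty_chain (val b))
    (x : {malg K[support_points S]}).

Definition mono_to_face (x : mono_module K (chain_data S 0)) : face_module S K :=
  linear_ext (fun b : mono_basis (chain_data S 0) => face_monomial S K (val b).2) x.

Lemma face_to_monoP k (x y : {malg K[support_points S]}) :
  face_to_mono (k *: x + y) = k *: (face_to_mono x : {malg K[mono_basis (chain_data S 0)]})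
    + face_to_mono y :> {malg K[mono_basis (chain_data S 0)]}.
Proof. exact: linearP. Qed.

Lemma mono_to_faceP k (x y : {malg K[mono_basis (chain_data S 0)]}) :
  mono_to_face (k *: x + y) = k *: (mono_to_face x : {malg K[support_points S]})
    + mono_to_face y :> {malg K[support_points S]}.
Proof. exact: linearP. Qed.

Lemma face_to_mono_elt p : support_point S p ->
  face_to_mono (face_monomial S K p) = mono_elt K (chain_data S 0) empty_chain p.
Proof. by move=> pS; rewrite /face_to_mono /face_monomial insubT linear_extU. Qed.

Lemma mono_to_face_elt c p : support_point S p ->
  mono_to_face (mono_elt K (chain_data S 0) c p) = face_monomial S K p.
Proof.
move=> pS; have [|b -> bE] := @mono_elt_basis _ (chain_data S 0) c p.
  by rewrite /= pS in_empty_chain.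
by rewrite /mono_to_face linear_extU bE.
Qed.

Lemma face_to_monoK : cancel face_to_mono mono_to_face.
Proof.
elim/malg_basis_ind => [|k x y IHx IHy|b].
- by rewrite /face_to_mono /mono_to_face !raddf0.
- by rewrite face_to_monoP mono_to_faceP IHx IHy.
by rewrite -face_monomialE face_to_mono_elt ?(valP b) // mono_to_face_elt // (valP b).
Qed.

Lemma mono_to_faceK : cancel mono_to_face face_to_mono.
Proof.
elim/malg_basis_ind => [|k x y IHx IHy|b].
- by rewrite /face_to_mono /mono_to_face !raddf0.
- by rewrite mono_to_faceP face_to_monoP IHx IHy.
have /andP[bS _] := valP b.
by rewrite -mono_eltE mono_to_face_elt // face_to_mono_elt // [in RHS](empty_chainE (val b).1).
Qed.

Lemma face_to_mono_gmap : gmap 0 face_to_mono.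
Proof.
split.
  move=> k x y; rewrite face_scaleK mono_scaleK; exact: face_to_monoP.
move=> g x gx; rewrite addr0; apply: graded_malg gx => b; exact: mono_part_elt.
Qed.

Lemma face_to_mono_alin : alin face_to_mono.
Proof.
apply: (alin_monomial face_to_mono_gmap.1) => s sS.
elim/malg_basis_ind => [|k x y IHx IHy|b].
- by rewrite scaler0 (klin0 face_to_mono_gmap.1) scaler0.
- rewrite -face_scaleK; exact: (klin_scale_comb k face_to_mono_gmap.1 IHx IHy).
rewrite face_scale_basis // -face_monomialE face_to_mono_elt ?(valP b) //.
rewrite (mono_scale_monomial _ sS) mono_mul_elt; last first.
  by rewrite /= in_empty_chain (valP b).
rewrite /= in_empty_chain andbT; case: ifP => sb; last exact: (klin0 face_to_mono_gmap.1).
by rewrite face_to_mono_elt ?in_common_coneD // addrC.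
Qed.

Lemma mono_to_face_gmap : gmap 0 mono_to_face.
Proof.
split.
  move=> k x y; rewrite mono_scaleK face_scaleK; exact: mono_to_faceP.
move=> g x /mono_partE gx; rewrite addr0 /mono_to_face.
rewrite -[module_part _ _]/(malg_part _ _ _) linear_ext.unlock.
apply: malg_part_sum => s sx; apply: malg_partZ.
rewrite -mcoeff_neq0 in sx; rewrite -(gx _ sx).
exact: face_monomial_part.
Qed.

Lemma can_alin (M N : graded_module (face_grading S K)) (f : M -> N) (g : N -> M) :
  alin f -> cancel f g -> cancel g f -> alin g.
Proof.
by move=> lf fK gK r x y; apply: (can_inj fK); rewrite gK lf !gK.
Qed.

Lemma cone_convexT (C : face_poset S) : cone_convex C (in_cone C).
Proof. by move=> p s t Cs Ct Cp _; exact: in_cone_addL. Qed.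

Variable C : face_poset S.
Local Notation CD := (cone_data (@cone_convexT C)).

Definition cone_to_mono (x : cone_module C K) : mono_module K CD :=
  linear_ext (fun b : cone_points C => mono_elt K CD tt (val b)) (x : {malg K[cone_points C]}).

Definition mono_to_cone (x : mono_module K CD) : cone_module C K :=
  linear_ext (fun b : mono_basis CD => cone_monomial C K (val b).2) x.

Lemma cone_to_monoP k (x y : {malg K[cone_points C]}) :
  cone_to_mono (k *: x + y) = k *: (cone_to_mono x : {malg K[mono_basis CD]})
    + cone_to_mono y :> {malg K[mono_basis CD]}.
Proof. exact: linearP. Qed.

Lemma mono_to_coneP k (x y : {malg K[mono_basis CD]}) :
  mono_to_cone (k *: x + y) = k *: (mono_to_cone x : {malg K[cone_points C]})
    + mono_to_cone y :> {malg K[cone_points C]}.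
Proof. exact: linearP. Qed.

Lemma cone_to_mono_elt p : in_cone C p ->
  cone_to_mono (cone_monomial C K p) = mono_elt K CD tt p.
Proof. by move=> pS; rewrite /cone_to_mono /cone_monomial insubT linear_extU. Qed.

Lemma mono_to_cone_elt c p : in_cone C p ->
  mono_to_cone (mono_elt K CD c p) = cone_monomial C K p.
Proof.
move=> pC; have [//|b -> bE] := @mono_elt_basis _ CD c p.
by rewrite /mono_to_cone linear_extU bE.
Qed.

Lemma cone_to_monoK : cancel cone_to_mono mono_to_cone.
Proof.
elim/malg_basis_ind => [|k x y IHx IHy|b].
- by rewrite /cone_to_mono /mono_to_cone !raddf0.
- by rewrite cone_to_monoP mono_to_coneP IHx IHy.
by rewrite -cone_monomialE cone_to_mono_elt ?(valP b) // mono_to_cone_elt // (valP b).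
Qed.

Lemma mono_to_coneK : cancel mono_to_cone cone_to_mono.
Proof.
elim/malg_basis_ind => [|k x y IHx IHy|b].
- by rewrite /cone_to_mono /mono_to_cone !raddf0.
- by rewrite mono_to_coneP cone_to_monoP IHx IHy.
have bS : in_cone C (val b).2 := valP b.
by rewrite -mono_eltE mono_to_cone_elt // cone_to_mono_elt //; case: (val b).1.
Qed.

Lemma cone_scaleK (k : K) (x : cone_module C K) :
  (k%:A : face_ring S K) *: x = (k *: (x : {malg K[cone_points C]})).
Proof.
rewrite -[LHS]/(cone_proj C (k *: 1) * (x : cone_ring C K)).
have := cone_projP C k (1 : face_ring S K) 0; rewrite !addr0 raddf0 addr0 => ->.
by rewrite rmorph1 -scalerAl mul1r.
Qed.

Lemma cone_to_mono_gmap : gmap 0 cone_to_mono.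
Proof.
split.
  move=> k x y; rewrite cone_scaleK mono_scaleK; exact: cone_to_monoP.
move=> g x gx; rewrite addr0; apply: graded_malg gx => b; exact: mono_part_elt.
Qed.

Lemma cone_scale_basis (s : pt) (b : cone_points C) : support_point S s ->
  (face_monomial S K s : face_ring S K) *: (<< b >> : cone_module C K) =
  (if in_cone C s then cone_monomial C K (s + val b) else 0).
Proof.
move=> sS; rewrite -[LHS]/(cone_proj C (face_monomial S K s) * (<< b >> : cone_ring C K)).
rewrite cone_proj_monomial // -cone_monomialE.
have bC : in_cone C (val b) := valP b.
rewrite cone_monomialM ?(in_cone_support bC) //; case: ifP => [sb|/negbT sb].
  by case: ifP => // sC; rewrite cone_monomial_out // in_cone_add // sC.
by case: ifP => // sC; rewrite (in_common_coneP sC bC) in sb.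
Qed.

Lemma cone_to_mono_alin : alin cone_to_mono.
Proof.
apply: (alin_monomial cone_to_mono_gmap.1) => s sS.
elim/malg_basis_ind => [|k x y IHx IHy|b].
- by rewrite scaler0 (klin0 cone_to_mono_gmap.1) scaler0.
- rewrite -cone_scaleK; exact: (klin_scale_comb k cone_to_mono_gmap.1 IHx IHy).
have bC : in_cone C (val b) := valP b.
rewrite cone_scale_basis // -cone_monomialE cone_to_mono_elt //.
rewrite (mono_scale_monomial _ sS) mono_mul_elt //=.
case: ifP => [sC|/negbT sC].
  by rewrite (in_cone_addL bC sC) cone_to_mono_elt ?in_cone_addL // addrC.
exact: (klin0 cone_to_mono_gmap.1).
Qed.

Lemma mono_to_cone_gmap : gmap 0 mono_to_cone.
Proof.
split.
  move=> k x y; rewrite mono_scaleK cone_scaleK; exact: mono_to_coneP.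
move=> g x /mono_partE gx; rewrite addr0 /mono_to_cone.
rewrite -[module_part _ _]/(malg_part _ _ _) linear_ext.unlock.
apply: malg_part_sum => s sx; apply: malg_partZ.
rewrite -mcoeff_neq0 in sx; rewrite -(gx _ sx).
exact: cone_monomial_part.
Qed.
End Isomorphisms.

(** * Acyclicity of torsion modules *)

Section LatticeBox.
Variable d : nat.

Definition lattice_box (N : nat) : seq 'rV[int]_d :=
  [seq \row_j ((f j)%:Z - N%:Z) | f : {ffun 'I_d -> 'I_(N + N).+1}].

Lemma lattice_boxP N (p : 'rV[int]_d) :
  (forall j, (`|p 0 j| <= N%:Z)) -> p \in lattice_box N.
Proof.
move=> pN; apply/mapP.
have lt (j : 'I_d) : (absz (p 0%R j + N%:Z)%R < (N + N).+1)%N by have := pN j; lia.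
exists [ffun j => Ordinal (lt j)]; first by rewrite mem_enum.
apply/rowP => j; rewrite !mxE ffunE /=.
by have := pN j; lia.
Qed.
End LatticeBox.

Section Generators.
Variables (R : realType) (d : nat) (S : fan R d) (K : fieldType).
Local Notation pt := ('rV[int]_d).

(** A form of Gordan's lemma. In [p = sum c_i v_i] either some [c_i >= 1] with [v_i] nonzero, and
    [v_i] can be split off, or all relevant coefficients are below 1 and [p] itself is bounded. *)
Lemma cone_bound (C : set 'rV[R]_d) : rational_cone C -> exists N : nat, forall p : pt,
  p != 0 -> C (real_point R p) -> exists g : pt, [/\ g != 0, C (real_point R g),
    C (real_point R (p - g)) & g \in lattice_box d N].
Proof.
move=> ratC; have C0 := rational_cone0 ratC; have CD := rational_coneD ratC.
have [n [v CE]] := ratC.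
(* [N] bounds the coordinates of each generator and of each combination with coefficients between 0
   and 1. *)
pose w i (j : 'I_d) := absz (v i 0 j); pose N := (\sum_i \sum_j w i j)%N.
have wN i j : (w i j <= N)%N.
  rewrite /N (bigD1 i) //= (bigD1 j) //=; lia.
have wjN j : (\sum_i w i j <= N)%N.
  by apply: leq_sum => i _; rewrite (bigD1 j) //= leq_addr.
exists N => p p0 Cp; have := Cp; rewrite {1}CE => -[c c0 pE].
have [[i [ci vi]]|small] := pselect (exists i, 1 <= c i /\ v i != 0).
  exists (v i); split=> //.
  - rewrite CE; exists (fun k => (k == i)%:R); first by move=> k; rewrite ler0n.
    rewrite (bigD1 i) //= eqxx scale1r big1 ?addr0 // => k /negbTE ->.
    by rewrite scale0r.
  - rewrite CE; exists (fun k => c k - (k == i)%:R).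
      by move=> k; case: eqP => [->|_]; rewrite ?subr0 // subr_ge0.
    rewrite /real_point raddfB /= -/(real_point R p) pE.
    under [RHS]eq_bigr do rewrite scalerBl.
    rewrite sumrB; congr (_ - _).
    rewrite (bigD1 i) //= eqxx scale1r big1 ?addr0 // => k /negbTE ->.
    by rewrite scale0r.
  - by apply: lattice_boxP => j; have := wN i j; rewrite /w; lia.
exists p; split=> //; first by rewrite subrr real_point0.
apply: lattice_boxP => j.
have le1 i : c i * `|(v i 0 j)%:~R : R| <= (w i j)%:R.
  have -> : (w i j)%:R = `|(v i 0 j)%:~R : R|.
    by rewrite /w -intr_norm pmulrn abszE.
  have [vi|vi] := eqVneq (v i) 0; first by rewrite vi mxE normr0 mulr0.
  rewrite ler_piMl //; rewrite leNgt; apply/negP => ci.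
  by apply: small; exists i; split=> //; exact: ltW.
have : `|(p 0 j)%:~R : R| <= (\sum_i w i j)%:R.
  have -> : (p 0 j)%:~R = \sum_i c i * (v i 0 j)%:~R :> R.
    have := congr1 (fun z : 'rV[R]_d => z 0 j) pE; rewrite mxE summxE => ->.
    by apply: eq_bigr => i _; rewrite !mxE.
  apply: le_trans (ler_norm_sum _ _ _) _; rewrite natr_sum; apply: ler_sum => i _.
  by rewrite normrM (ger0_norm (c0 i)).
rewrite -intr_norm pmulrn ler_int => /le_trans; apply.
by rewrite lez_nat.
Qed.

Lemma monomial_generators : exists gens : seq pt, [/\ uniq gens,
  forall g, g \in gens -> support_point S g /\ g != 0 &
  forall (C : face_poset S) s, s != 0 -> in_cone C s ->
    exists g, [/\ g \in gens, in_cone C g & in_cone C (s - g)]].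
Proof.
have bound (C : face_poset S) : exists N : nat, forall p : pt,
    p != 0 -> in_cone C p -> exists g : pt, [/\ g != 0, in_cone C g,
    in_cone C (p - g) & g \in lattice_box d N].
  have [N NP] := cone_bound (fan_rational (valP C)).
  exists N => p p0 /asboolP Cp; have [g [g0 Cg Cpg gN]] := NP p p0 Cp.
  by exists g; split=> //; exact/asboolP.
pose N C := sval (cid (bound C)); have NP C := svalP (cid (bound C)).
pose all_pts := flatten [seq lattice_box d (N C) | C : face_poset S].
exists (undup [seq g <- all_pts | support_point S g && (g != 0)]).
split; first exact: undup_uniq.
  by move=> g; rewrite mem_undup mem_filter => /andP[/andP[]].
move=> C s s0 Cs; have [g [g0 Cg Csg gN]] := NP C s s0 Cs.
exists g; split=> //; rewrite mem_undup mem_filter (in_cone_support Cg) g0 /=.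
by apply/flattenP; exists (lattice_box d (N C)) => //; apply/mapP; exists C; rewrite ?mem_enum.
Qed.
End Generators.

(** * Torsion tested on generating monomials *)

Section TorsionByMonomials.
Variables (R : realType) (d : nat) (S : fan R d) (K : fieldType).
Local Notation pt := ('rV[int]_d).
Local Notation A := (face_ring S K).
Local Notation I := (graded_maximal_ideal (S := S) (K := K)).
Implicit Types M X : graded_module (face_grading S K).

Definition mon (s : pt) : A := face_monomial S K s.

Lemma monM s t : support_point S s -> support_point S t ->
  mon s * mon t = if in_common_cone S s t then mon (s + t) else 0.
Proof.
move=> sS tS.
have monE p (pS : support_point S p) : mon p = << (Sub p pS : support_points S) >>.
  by rewrite /mon /face_monomial insubT.
by rewrite (monE s sS) (monE t tS) -[LHS]/(face_mul << _ >> << _ >>) face_mulU.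
Qed.

Lemma mon_deg s : face_grading S K s (mon s).
Proof. exact: face_monomial_part. Qed.

Lemma in_common_cone_muln (s : pt) m n : support_point S s ->
  in_common_cone S (s *+ m) (s *+ n).
Proof.
move=> /asboolP[D DS Ds]; pose C : face_poset S := [` DS]%fset.
have Cn k : in_cone C (s *+ k).
  elim: k => [|k IHk]; first exact: in_cone0.
  by rewrite mulrS in_cone_addL //; exact/asboolP.
exact: in_common_coneP (Cn m) (Cn n).
Qed.

Lemma support_muln (s : pt) n : support_point S s -> support_point S (s *+ n).
Proof.
by move=> sS; have := in_common_coneD (in_common_cone_muln n 0 sS); rewrite mulr0n addr0.
Qed.

Lemma monMn s m n : support_point S s -> mon (s *+ m) * mon (s *+ n) = mon (s *+ (m + n)).
Proof.
by move=> sS; rewrite monM ?support_muln // in_common_cone_muln // mulrnDr.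
Qed.

Lemma mon0 : mon 0 = 1. Proof. by []. Qed.

Lemma monX s n : support_point S s -> mon s ^+ n = mon (s *+ n).
Proof.
move=> sS; elim: n => [|n IHn]; first by rewrite expr0 mulr0n mon0.
by rewrite exprS IHn -[X in mon X * _]mulr1n monMn.
Qed.

Lemma mon_ideal s : support_point S s -> s != 0 -> I (mon s).
Proof.
move=> sS s0 b; rewrite /mon /face_monomial insubT mcoeffU.
case: (_ =P b) => [<- _|_]; [exact: s0|by rewrite mulr0n eqxx].
Qed.

Lemma malgZU (B : choiceType) (k : K) (b : B) :
  k *: (<< b >> : {malg K[B]}) = << k *g b >>.
Proof. by apply/malgP => c; rewrite mcoeffZ !mcoeffU mulr_natr. Qed.

Lemma face_ring_sum (f : A) : f = \sum_(s <- msupp f) (f@_s)%:A * mon (val s).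
Proof.
have monE (k : K) (s : support_points S) : k%:A * mon (val s) = << k *g s >> :> A.
  rewrite -scalerAl mul1r /mon face_monomialE; exact: malgZU.
by rewrite {1}[f]monalgE; apply: eq_bigr => s _; rewrite monE.
Qed.

(** Torsion for only some of the generating monomials, which permits an induction over the list. *)
Definition torsion_by (gs : seq pt) M (x : M) :=
  exists N, forall g, g \in gs -> mon (g *+ N) *: x = 0.

Lemma torsion_byW M (x : M) N g : support_point S g ->
  mon (g *+ N) *: x = 0 -> forall N', (N <= N')%N -> mon (g *+ N') *: x = 0.
Proof.
by move=> gS xN N' /subnK <-; rewrite -monMn // -scalerA xN scaler0.
Qed.

Section Fixed.
Variable gens : seq pt.
Hypothesis gens_uniq : uniq gens.
Hypothesis gensS : forall g, g \in gens -> support_point S g /\ g != 0.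
Hypothesis gensP : forall (C : face_poset S) s, s != 0 -> in_cone C s ->
    exists g, [/\ g \in gens, in_cone C g & in_cone C (s - g)].

Lemma torsion_by_sub (gs : seq pt) M (x : M) : {subset gs <= gens} ->
  torsion I x -> torsion_by gs x.
Proof.
move=> sub [N xN]; exists N => g /sub/gensS[gS g0]; rewrite -monX //.
by apply: xN; apply: ideal_exp_expr; exact: mon_ideal.
Qed.

(** Pigeonhole, by induction on [k]: each monomial of a factor from the ideal is divisible by a
    generator [g], and after multiplying [x] by that generator one power of it fewer is needed. *)
Lemma ideal_exp_kill k (n : pt -> nat) M (x : M) :
  (forall g, g \in gens -> mon (g *+ n g) *: x = 0) ->
  (\sum_(g <- gens) n g <= k)%N ->
  forall r, ideal_exp I k.+1 r -> r *: x = 0.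
Proof.
elim/ltn_ind: k n x => k IHk n x xn nk r [s sP ->]; rewrite scaler_suml big_seq big1 // => p ps.
have [p1 p2] := sP p ps; rewrite [p.1]face_ring_sum mulr_suml scaler_suml.
rewrite big_seq big1 // => b bp.
have b0 : val b != 0 by apply: p1; rewrite mcoeff_neq0.
have /asboolP[D DS Db] := valP b; pose C : face_poset S := [` DS]%fset.
have Cb : in_cone C (val b) by apply/asboolP.
have [g [gG Cg Cbg]] := gensP b0 Cb.
have -> : mon (val b) = mon (val b - g) * mon g.
  rewrite monM ?(in_cone_support Cg) ?(in_cone_support Cbg) //.
  by rewrite (in_common_coneP Cbg Cg) subrK.
rewrite -!mulrA [mon g * _]mulrC -!scalerA.
have [n0|n0] := posnP (n g).
  have := xn g gG; rewrite n0 mulr0n mon0 scale1r => ->.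
  by rewrite !scaler0.
suff -> : p.2 *: (mon g *: x) = 0 by rewrite !scaler0.
have sum_g : (\sum_(h <- gens) n h = n g + \sum_(h <- gens | h != g) n h)%N.
  by rewrite (bigD1_seq g).
case: k IHk nk p2 {sP} => [|k] IHk nk p2; first by move: nk; rewrite sum_g leqn0 addn_eq0 eqn0Ngt n0.
apply: (IHk k (ltnSn k) (fun h => if h == g then (n g).-1 else n h)) p2.
  move=> h hG; rewrite scalerA; case: eqP => [->|_]; last first.
    by rewrite mulrC -scalerA xn // scaler0.
  rewrite -[X in _ * mon X]mulr1n monMn ?(gensS gG).1 //.
  by rewrite addn1 prednK // xn.
rewrite (bigD1_seq g) //= eqxx (eq_bigr n) => [|h /negbTE -> //].
by move: nk; rewrite sum_g -{1}(prednK n0) addSn ltnS.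
Qed.

Lemma torsion_byP M (x : M) : torsion I x <-> torsion_by gens x.
Proof.
split=> [|[N xN]]; first exact: torsion_by_sub.
exists (\sum_(g <- gens) N).+1; apply: (ideal_exp_kill (n := fun=> N)) => //.
Qed.

Definition divisible (u s : pt) : bool :=
  `[< exists C : face_poset S, in_cone C u /\ in_cone C (s - u) >].

Lemma halving (p q s : pt) : p + p + s - q - p + (p + p + s - q - p) =
  p + p + s - (q + q) + s.
Proof. by apply/rowP => j; rewrite !mxE; ring. Qed.

Lemma rational_coneZ (C : set 'rV[R]_d) x c : rational_cone C -> 0 <= c -> C x -> C (c *: x).
Proof.
move=> [n [v ->]] c0 [b b0 ->]; exists (fun i => c * b i).
  by move=> i; rewrite mulr_ge0.
by rewrite scaler_sumr; apply: eq_bigr => i _; rewrite scalerA.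
Qed.

Lemma in_cone_half (C : face_poset S) t : in_cone C (t + t) -> in_cone C t.
Proof.
move=> /asboolP; rewrite real_pointD => Ct; apply/asboolP.
have -> : real_point R t = 2^-1 *: (real_point R t + real_point R t).
  by rewrite -mulr2n -scaler_nat scalerA mulVf ?scale1r // pnatr_eq0.
apply: rational_coneZ => //; first exact: fan_rational (valP C).
by rewrite invr_ge0.
Qed.

(* With u = x^(M v), this gives e' with u^2 e' = u e in a cofree module; that the
   torsion is preserved is seen by halving: if s - 2 M v and s - 2 N g lie in a
   cone, then so does s - M v - N g. *)
Lemma cofree_divide (gs : seq pt) X (a v : pt) m (phi : CI X) :
  {subset gs <= gens} -> support_point S v -> module_part a phi -> torsion_by gs phi ->
  exists psi : CI X, [/\ module_part (a - v *+ m) psi, torsion_by gs psi &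
    mon (v *+ (m + m)) *: psi = mon (v *+ m) *: phi].
Proof.
move=> sub vS aphi [N phiN].
pose V : lmodType K := restrict_scalars (GRing.in_alg A) X.
(* [psi] sends [x^s] to [phi (x^(s - m v))] if [x^(2 m v)] divides [x^s], and to 0 otherwise.
   Divisibility by the square leaves the room that halving needs. *)
pose h (s : support_points S) : V :=
  if divisible (v *+ (m + m)) (val s) then (phi : coind X) (mon (val s - v *+ m)) else 0.
pose psi0 (f : A) : X := linear_ext h f.
have psi0_lin (k : K) r r' : psi0 (k *: r + r') = k%:A *: psi0 r + psi0 r'.
  exact: (linear_ext_linear h k r r').
have psi0_mon s : support_point S s -> psi0 (mon s) =
    if divisible (v *+ (m + m)) s then (phi : coind X) (mon (s - v *+ m)) else 0.
  by move=> sS; rewrite /psi0 /mon /face_monomial insubT linear_extU.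
have psi0_sum f : psi0 f = \sum_(s <- msupp f) (f@_s)%:A *: psi0 (mon (val s)).
  rewrite {1}/psi0 linear_ext.unlock; apply: eq_bigr => s _.
  by rewrite psi0_mon ?(valP s).
have psi0_part : homog (a - v *+ m) psi0.
  split=> // b r br; rewrite psi0_sum big_seq; apply: module_part_sum => s sr.
  apply: module_partK; rewrite -mcoeff_neq0 in sr; rewrite -(br _ sr).
  rewrite psi0_mon ?(valP s) //; case: ifP => _; last exact: module_part0.
  by rewrite addrCA addrC; apply: aphi.2; exact: mon_deg.
have psiE := coind_mkE (coind_pred_homog psi0_part).
have eq_mon (f g : A -> X) : (forall (k : K) r r', f (k *: r + r') = k%:A *: f r + f r') ->
    (forall (k : K) r r', g (k *: r + r') = k%:A *: g r + g r') ->
    (forall s, support_point S s -> f (mon s) = g (mon s)) -> forall r, f r = g r.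
  move=> lf lg fg; have f0 : f 0 = 0.
    by have := lf (-1) 0 0; rewrite scaler0 addr0 !scaleN1r addNr.
  have g0 : g 0 = 0.
    by have := lg (-1) 0 0; rewrite scaler0 addr0 !scaleN1r addNr.
  elim/face_ring_ind => [|c r r' IHr IHr'|s sS]; [by rewrite f0 g0| |exact: fg].
  by rewrite lf lg IHr IHr'.
have mul_lin (f : A -> X) u : (forall (k : K) r r', f (k *: r + r') = k%:A *: f r + f r') ->
    forall (k : K) r r', f (u * (k *: r + r')) = k%:A *: f (u * r) + f (u * r').
  by move=> lf k r r'; rewrite mulrDr -scalerAr lf.
have vmS k : support_point S (v *+ k) by exact: support_muln.
have in_coneMn (C : face_poset S) p k : in_cone C p -> in_cone C (p *+ k).
  by move=> Cp; elim: k => [|k IHk]; rewrite ?mulr0n ?in_cone0 // mulrS in_cone_addL.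
exists (coind_mk psi0); split.
- split=> [k r r'|h' r hr]; first by rewrite !psiE.
  by rewrite psiE; exact: psi0_part.2.
- exists (N + N)%N => g gG; have [gS g0] := gensS (sub _ gG).
  apply: coind_eq => r; rewrite coindZ psiE; move: r.
  apply: (eq_mon _ (fun=> 0)); [exact: mul_lin|by move=> *; rewrite scaler0 addr0|].
  move=> s sS; rewrite monM ?support_muln //; case: ifP => gs_; last first.
    by have := psi0_lin (-1) 0 0; rewrite scaler0 addr0 !scaleN1r addNr.
  rewrite psi0_mon ?in_common_coneD //; case: ifP => // /asboolP[C [Cv Cs]].
  have : in_cone C (g *+ (N + N) + s).
    by rewrite -[_ + s](subrK (v *+ (m + m))) in_cone_addL.
  rewrite in_cone_add // => /andP[Cg2 Cs'].
  have Cg : in_cone C (g *+ N).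
    by move: Cg2; rewrite mulrnDr in_cone_add ?in_common_cone_muln // => /andP[].
  pose t := g *+ (N + N) + s - v *+ m - g *+ N.
  have Ct : in_cone C t.
    apply: in_cone_half.
    have -> : t + t = (g *+ (N + N) + s - v *+ (m + m)) + s.
      by rewrite /t !mulrnDr halving.
    exact: in_cone_addL.
  have -> : g *+ (N + N) + s - v *+ m = g *+ N + t.
    by rewrite /t [RHS]addrC subrK.
  have -> : mon (g *+ N + t) = mon (g *+ N) * mon t.
    by rewrite monM ?(in_cone_support Cg) ?(in_cone_support Ct) // (in_common_coneP Cg Ct).
  by rewrite -coindZ phiN.
- apply: coind_eq => r; rewrite !coindZ psiE; move: r.
  apply: eq_mon; [exact: mul_lin|by apply: mul_lin; exact: coindL|].
  move=> s sS; rewrite !monM //.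
  have [/asboolP[D [DS Du Ds]]|nc] := boolP (in_common_cone S (v *+ (m + m)) s).
    pose C : face_poset S := [` DS]%fset.
    have Cu : in_cone C (v *+ (m + m)) by exact/asboolP.
    have Cs : in_cone C s by exact/asboolP.
    have Cv : in_cone C (v *+ m).
      by move: Cu; rewrite mulrnDr in_cone_add ?in_common_cone_muln // => /andP[].
    rewrite (in_common_coneP Cv Cs) psi0_mon ?in_common_coneD ?(in_common_coneP Cu Cs) //.
    have -> : divisible (v *+ (m + m)) (v *+ (m + m) + s).
      by apply/asboolP; exists C; rewrite addrAC subrr add0r.
    congr ((phi : coind X) (mon _)).
    by rewrite mulrnDr -(addrA (v *+ m)) [LHS]addrC addKr.
  case: ifP => [/asboolP[D [DS Dv Ds]]|_]; last first.
    have := psi0_lin (-1) 0 0; rewrite scaler0 addr0 !scaleN1r addNr => ->.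
    by rewrite coind0r.
  pose C : face_poset S := [` DS]%fset.
  case/negP: nc; apply: (in_common_coneP (C := C)); last exact/asboolP.
  by rewrite mulrnDr in_cone_addL //; exact/asboolP.
Qed.
End Fixed.
End TorsionByMonomials.

(** * Torsion modules have no higher local cohomology *)

Section TorsionAcyclic.
Variables (R : realType) (d : nat) (S : fan R d) (K : fieldType).
Local Notation pt := ('rV[int]_d).
Local Notation A := (face_ring S K).
Local Notation I := (graded_maximal_ideal (S := S) (K := K)).
Implicit Types M : graded_module (face_grading S K).

Lemma torsion_by_alin gs M (N : graded_module (face_grading S K)) (f : M -> N) x :
  alin f -> torsion_by gs x -> torsion_by gs (f x).
Proof.
move=> lf [k xk]; exists k => g gG.
by rewrite -(alinZ lf) xk // (klin0 (alin_klin lf)).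
Qed.

Lemma torsion_by_scale gs M (r : A) (x : M) : torsion_by gs x -> torsion_by gs (r *: x).
Proof. by move=> [k xk]; exists k => g gG; rewrite scalerA mulrC -scalerA xk ?scaler0. Qed.

Lemma torsion_by_sub2 gs M (x y : M) : {in gs, forall g, support_point S g} ->
  torsion_by gs x -> torsion_by gs y -> torsion_by gs (x - y).
Proof.
move=> gS [k xk] [l yl]; exists (maxn k l) => g gG.
rewrite scalerBr (torsion_byW (gS _ gG) (xk _ gG)) ?leq_maxl //.
by rewrite (torsion_byW (gS _ gG) (yl _ gG)) ?leq_maxr // subrr.
Qed.

Lemma torsion_by_cons gs g M (x : M) k : {in g :: gs, forall g, support_point S g} ->
  torsion_by gs x -> mon S K (g *+ k) *: x = 0 -> torsion_by (g :: gs) x.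
Proof.
move=> gS [l xl] xk; exists (maxn k l) => h; rewrite inE => /orP[/eqP ->|hG].
  by rewrite (torsion_byW _ xk) ?leq_maxl // gS // mem_head.
by rewrite (torsion_byW _ (xl _ hG)) ?leq_maxr // gS // inE hG orbT.
Qed.

Section Fixed.
Variable gens : seq pt.
Hypothesis gensS : forall g, g \in gens -> support_point S g /\ g != 0.
Variable M : graded_module (face_grading S K).
Hypothesis M_torsion : forall x : M, torsion_by gens x.

(** Induction over the list. Let [z = d y] with [y] torsion for the tail, and let [u], a power of
    the new monomial, kill [z]. Then [u y] is a cocycle, so [u y = d y2] by induction; division
    gives [u^2 y3 = u y2], and [u^2] kills [y - d y3]. In the lowest degree [u y] comes from [M],
    which is torsion. *)
Lemma torsion_acyclic gs : {subset gs <= gens} -> forall n a (z : cobar M n.+2),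
  module_part a z -> torsion_by gs z -> cobar_d z = 0 ->
  exists y : cobar M n.+1, [/\ module_part a y, torsion_by gs y & z = cobar_d y].
Proof.
elim: gs => [|g gs IHgs] sub n a z az tz dz.
  exists (ev 1 z); split; [|by exists 0%N|exact: cobar_exact].
  by have := (ev_gmap (cobar M n.+1) (degree_part1 (face_grading S K))).2 _ _ az; rewrite addr0.
have sub' : {subset gs <= gens} by move=> h hG; apply: sub; rewrite inE hG orbT.
have gG : g \in gens by apply: sub; rewrite mem_head.
have gS := (gensS gG).1.
have allS : {in g :: gs, forall g, support_point S g} by move=> h /sub/gensS[].
have [m zm] := tz.
have tz' : torsion_by gs z by exists m => h hG; apply: zm; rewrite inE hG orbT.
have zg : mon S K (g *+ m) *: z = 0 by apply: zm; rewrite mem_head.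
have [y [ay ty zy]] := IHgs sub' n a z az tz' dz.
have dl n' := cobar_d_alin (M := M) (n := n').
have dgy : cobar_d (mon S K (g *+ m) *: y) = 0 by rewrite (alinZ (dl n.+1)) -zy.
case: n z az tz dz zm tz' zg y ay ty zy dgy => [|n] z az tz dz zm tz' zg y ay ty zy dgy.
  exists y; split=> //; have yE := cobar_exact dgy.
  have [k mk] := M_torsion (ev 1 (mon S K (g *+ m) *: y)).
  apply: (torsion_by_cons (k := (k + m)%N)) => //.
  by rewrite -monMn // -scalerA yE -(alinZ (dl 0%N)) mk // (klin0 (cobar_d_gmap M 0).1).
have [y2 [ay2 ty2 y2E]] := IHgs sub' n (g *+ m + a) _
  (module_partZ (@mon_deg _ _ S K (g *+ m)) ay) (torsion_by_scale _ ty) dgy.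
have [y3 [ay3 ty3 y3E]] := @cofree_divide _ _ S K gens gensS gs
  (cobar M n) _ g m y2 sub' gS ay2 ty2.
have gdy3 : module_part a (cobar_d (y3 : cobar M n.+1)).
  rewrite (_ : a = g *+ m + a - g *+ m + 0); first exact: (cobar_d_gmap M n.+1).2.
  by rewrite addr0 addrAC subrr add0r.
exists (y - cobar_d (y3 : cobar M n.+1)); split.
- exact: module_partB.
- apply: (torsion_by_cons (k := (m + m)%N)) => //.
    apply: torsion_by_sub2 => //.
      by move=> h hG; apply: allS; rewrite inE hG orbT.
    exact: (@torsion_by_alin gs (cobar M n.+1) (cobar M n.+2) _ y3 (dl n.+1) ty3).
  rewrite scalerBr -(alinZ (dl n.+1)) y3E (alinZ (dl n.+1)) -y2E scalerA monMn //.
  exact: subrr.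
- by rewrite (klinB (cobar_d_gmap M n.+2).1) cobar_dK subr0.
Qed.
End Fixed.

Theorem torsion_TZ M a j : (forall x : M, torsion I x) -> TZ I M a j.+1.
Proof.
have [gens [gU gS gP]] := monomial_generators S.
move=> tM x dx; have [tx ax] := strand_valP x.
have tM' (y : M) : torsion_by gens y by apply/(torsion_byP gU gS gP).
have dx0 : cobar_d (strand_val x) = 0 by rewrite -torsion_cobar_dE dx.
have [|y [ay ty yE]] := torsion_acyclic gS tM' (fun g h => h) ax _ dx0.
  exact/(torsion_byP gU gS gP).
exists (strand_mk I a y); apply: strand_eq.
by rewrite torsion_cobar_dE strand_mkE //; apply/(torsion_byP gU gS gP).
Qed.
End TorsionAcyclic.

(** * Geometry of rational cones *)

Section Farkas.
Variables (R : realFieldType) (d : nat).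
Implicit Types (x a b : 'rV[R]_d) (u : 'cV[R]_d) (s : seq 'rV[R]_d).

Definition dot x u : R := (x *m u) 0 0.

Lemma dotD x y u : dot (x + y) u = dot x u + dot y u.
Proof. by rewrite /dot mulmxDl mxE. Qed.
Lemma dotN x u : dot (- x) u = - dot x u.
Proof. by rewrite /dot mulNmx mxE. Qed.
Lemma dotZ c x u : dot (c *: x) u = c * dot x u.
Proof. by rewrite /dot -scalemxAl mxE. Qed.
Lemma dot0 u : dot 0 u = 0.
Proof. by rewrite /dot mul0mx mxE. Qed.
Lemma dotBr x u u' c : dot x (u - c *: u') = dot x u - c * dot x u'.
Proof. by rewrite /dot mulmxBr -scalemxAr !mxE. Qed.
Lemma dot_sum (I : Type) (r : seq I) (F : I -> 'rV[R]_d) u :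
  dot (\sum_(i <- r) F i) u = \sum_(i <- r) dot (F i) u.
Proof. by apply: (big_morph (dot^~ u)) => [x y|]; rewrite ?dotD ?dot0. Qed.

Fixpoint conic s b : Prop :=
  if s is a :: s' then exists2 t, 0 <= t & conic s' (b - t *: a) else b = 0.

(** Since [f] is nonpositive on [s], undoing the projection adds a nonnegative multiple of [a]. *)
Lemma conic_project s a (f : 'rV[R]_d -> R) b : (forall x, x \in s -> f x <= 0) ->
  conic [seq x - f x *: a | x <- s] b -> exists2 t, 0 <= t & conic s (b - t *: a).
Proof.
elim: s b => [|x s IHs] b fs /=; first by move=> ->; exists 0; rewrite ?scale0r ?subr0.
move=> [t t0 /IHs[|t' t'0 c]]; first by move=> y ys; apply: fs; rewrite inE ys orbT.
exists (t' - t * f x).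
  by rewrite addr_ge0 // oppr_ge0 mulr_ge0_le0 // fs ?mem_head.
exists t => //; move: c; congr conic.
rewrite scalerBr scalerBl scalerA; move: (t *: x) ((t * f x) *: a) (t' *: a) => p q r.
by apply/rowP => j; rewrite !mxE; ring.
Qed.

(** Induction on the number of vectors. If [u] separates [b] from [s] but is negative on [a],
    everything is projected along [a] to the hyperplane [u = 0]. A combination of projections lifts
    by [conic_project]; a functional separating the projections is corrected to vanish on [a]. *)
Lemma farkas s b : conic s b \/
  exists u, (forall a, a \in s -> 0 <= dot a u) /\ dot b u < 0.
Proof.
move: {2}(size s) (leqnn (size s)) => n; elim: n s b => [|n IHn] [|a s] b //= sn.
1,2: have [->|b0] := eqVneq b 0; first by left.
1,2: have [j bj] : exists j, b 0 j != 0 by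
  (apply: contrapT => nex; move/eqP: b0; apply; apply/rowP => j; rewrite mxE;
   apply: contrapT => /eqP bj; apply: nex; exists j).
1,2: right; exists (- b 0 j *: delta_mx j 0); split=> //.
1,2: rewrite /dot -scalemxAr mxE mulNr oppr_lt0 (_ : (b *m _) 0 0 = b 0 j) ?lt_neqAle;
  [by rewrite eq_sym mulf_eq0 negb_or bj -expr2 sqr_ge0|
   rewrite mxE (bigD1 j) //= big1 ?addr0 => [|k /negbTE kj]; rewrite mxE ?kj ?eqxx ?mulr0 ?mulr1 //].
have [c|[u [us ub]]] := IHn s b sn.
  by left; exists 0; rewrite // scale0r subr0.
have [ua|ua] := leP 0 (dot a u).
  by right; exists u; split=> // x; rewrite inE => /orP[/eqP ->|/us].
pose f x := dot x u / dot a u.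
have fs x : x \in s -> f x <= 0.
  by move=> /us xu; rewrite /f ler_ndivrMr // mul0r.
have fb : 0 < f b by rewrite /f ltr_ndivlMr // mul0r.
have [|c|[w [ws wb]]] := IHn [seq x - f x *: a | x <- s] (b - f b *: a).
- by rewrite size_map.
- have [t t0 ct] := conic_project fs c; left; exists (f b + t).
    by rewrite addr_ge0 // ltW.
  by move: ct; rewrite scalerDl opprD addrA.
have swap z : dot a w / dot a u * dot z u = f z * dot a w.
  by rewrite /f mulrAC [RHS]mulrAC [X in X / _]mulrC.
right; exists (w - (dot a w / dot a u) *: u); split=> [x|].
  rewrite inE dotBr => /orP[/eqP ->|xs].
    by rewrite divfK ?subrr // lt_eqF.
  have := ws _ (map_f (fun x => x - f x *: a) xs).
  by rewrite dotD dotN dotZ swap.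
by move: wb; rewrite dotBr dotD dotN dotZ swap.
Qed.
End Farkas.

(** * Relative interiors of the cones of a fan *)

Section FanGeometry.
Variables (R : realType) (d : nat) (S : fan R d).
Local Notation pt := ('rV[int]_d).
Implicit Types (C D E F : face_poset S) (x y z : 'rV[R]_d).

Lemma cone_rational C : rational_cone (val C).
Proof. exact: fan_rational (valP C). Qed.

Lemma cone0 C : val C 0.
Proof. exact: rational_cone0 (cone_rational C). Qed.

Lemma coneD C x y : val C x -> val C y -> val C (x + y).
Proof. exact: rational_coneD (cone_rational C). Qed.

Lemma coneZ C c x : 0 <= c -> val C x -> val C (c *: x).
Proof. exact: rational_coneZ (cone_rational C). Qed.

Lemma cone_sum C (J : Type) (r : seq J) (P : pred J) (f : J -> 'rV[R]_d) :
  (forall j, P j -> val C (f j)) -> val C (\sum_(j <- r | P j) f j).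
Proof. by move=> Cf; elim/big_ind: _ => //; [exact: cone0|exact: coneD]. Qed.

Lemma cone_gens C : exists n (v : 'I_n -> pt), (forall i, val C (real_point R (v i))) /\
  forall x, val C x -> exists2 c : 'I_n -> R, forall i, 0 <= c i &
    x = \sum_i c i *: real_point R (v i).
Proof.
have [n [v CE]] := cone_rational C; exists n, v; split=> [i|x]; last by rewrite {1}CE.
rewrite CE; exists (fun k => (k == i)%:R); first by move=> k; rewrite ler0n.
rewrite (bigD1 i) //= eqxx scale1r big1 ?addr0 // => k /negbTE ->.
by rewrite scale0r.
Qed.

Lemma conic_cone C s x : (forall b, b \in s -> val C b) -> conic s x -> val C x.
Proof.
elim: s x => [|b s IHs] x sC /=; first by move=> ->; exact: cone0.
move=> [t t0 c]; rewrite -[x](subrK (t *: b)); apply: coneD.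
  by apply: IHs c => b' b's; apply: sC; rewrite inE b's orbT.
by apply: coneZ t0 _; apply: sC; rewrite mem_head.
Qed.

Lemma cone_face C D x y : val C x -> val C y -> val D (x + y) -> val D x /\ val D y.
Proof. exact: fan_addP (valP C) (valP D). Qed.

Lemma cone_pointed C x : val C x -> val C (- x) -> x = 0.
Proof. exact: fan_pointed (valP C) x. Qed.

Lemma cone_leP C D : reflect (val C `<=` val D) (C <= D)%O.
Proof. by rewrite face_posetE; exact: asboolP. Qed.

Lemma cone_inter C D : exists E, [/\ val E = val C `&` val D, (E <= C)%O & (E <= D)%O].
Proof.
have [f1 _] := fan_inter (valP C) (valP D).
have ES : val C `&` val D \in cones S.
  by apply/(fan_face (valP C)) => // x [].
exists [` ES]%fset; split=> //; apply/cone_leP => x [] //.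
Qed.

(** The relative interior of [C], described combinatorially: the cones of the fan strictly below [C]
    are its proper faces. *)
Definition cint C : set 'rV[R]_d :=
  [set x | val C x /\ forall D, (D < C)%O -> ~ val D x].

Lemma cint_sub C x : cint C x -> val C x.
Proof. by case. Qed.

Lemma cint_le C D x : cint C x -> val D x -> (C <= D)%O.
Proof.
move=> [Cx Cint] Dx; have [E [EE EC ED]] := cone_inter C D.
have [<- //|EneC] := eqVneq E C.
by case: (Cint E); rewrite ?lt_neqAle ?EneC // EE.
Qed.

Lemma cint_uniq C D x : cint C x -> cint D x -> C = D.
Proof.
move=> Cx Dx; apply/eqP; rewrite eq_le (cint_le Cx (cint_sub Dx)).
exact: cint_le Dx (cint_sub Cx).
Qed.

(** A rank on the fan: extremal values in a family give minimal or maximal cones, and it serves as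
    induction measure. *)
Definition below C : nat := #|[pred D | (D < C)%O]|.

Lemma below_lt C D : (C < D)%O -> (below C < below D)%N.
Proof.
move=> CD; apply: proper_card; apply/properP; split.
  by apply/fintype.subsetP => E; move=> EC; exact: (@lt_trans _ _ C E D EC CD).
by exists C; [exact: CD|rewrite unfold_in /= ltxx].
Qed.

Lemma cint_exists C x : val C x -> exists2 D, (D <= C)%O & cint D x.
Proof.
move=> Cx; pose P D := (D <= C)%O && `[< val D x >].
have PC : P C by rewrite /P lexx; exact/asboolP.
case: (arg_minnP below PC) => D /andP[DC /asboolP Dx] Dmin.
exists D => //; split=> // E ED Ex; have := below_lt ED.
rewrite ltnNge Dmin // /P (le_trans (ltW ED) DC); exact/asboolP.
Qed.

Lemma cint_add C x y : cint C x -> val C y -> cint C (x + y).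
Proof.
move=> [Cx Cint] Cy; split; first exact: coneD.
by move=> D DC Dxy; apply: (Cint D) => //; have [] := cone_face Cx Cy Dxy.
Qed.

Lemma cint_scale C c x : 0 < c -> cint C x -> cint C (c *: x).
Proof.
move=> c0 [Cx Cint]; split; first exact: coneZ (ltW c0) Cx.
move=> D DC Dx; apply: (Cint D) => //.
have -> : x = c^-1 *: (c *: x) by rewrite scalerA mulVf ?gt_eqF // scale1r.
by apply: coneZ Dx; rewrite invr_ge0 ltW.
Qed.

Lemma real_point_sum (J : Type) (r : seq J) (f : J -> pt) :
  real_point R (\sum_(j <- r) f j) = \sum_(j <- r) real_point R (f j).
Proof. by rewrite /real_point raddf_sum. Qed.

(** The sum of the generators is interior: a face containing it contains every generator. *)
Lemma cint_lattice C : exists v : pt, cint C (real_point R v).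
Proof.
have [n [v [Cv Cgen]]] := cone_gens C.
exists (\sum_i v i); rewrite real_point_sum; split; first exact: cone_sum.
move=> D DC Dv; have : (C <= D)%O; last by move=> CD; have := le_lt_trans CD DC; rewrite ltxx.
apply/cone_leP => x /Cgen[c c0 ->]; apply: cone_sum => i _.
apply: coneZ => //; move: Dv; rewrite (bigD1 i) //=.
by case/(@cone_face C D) => //; exact: cone_sum.
Qed.

(** The topological meaning of interior, obtained from Farkas. For a generator [a i], either
    [t y - a i] lies in [C] for some [t >= 0], or some [u] nonnegative on [C] vanishes at [y] and is
    positive at [a i], cutting out a proper face through [y]. *)
Lemma cint_absorb C y z : cint C y -> val C z -> exists2 e, 0 < e & val C (y - e *: z).
Proof.
move=> [Cy Cint]; have [n [v [Ca Cgen]]] := cone_gens C.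
pose a i := real_point R (v i).
pose good z := exists2 e, 0 < e & val C (y - e *: z).
have gen i : good (a i).
  have [[t t0 c]|[u [us ub]]] := farkas (- y :: [seq a i | i : 'I_n]) (- a i).
    have Ct : val C (t *: y - a i).
      have Cs b : b \in [seq a i | i : 'I_n] -> val C b by case/mapP => k _ ->; exact: Ca.
      by have := conic_cone Cs c; rewrite scalerN opprK addrC.
    (* [t = 0] puts both [a i] and [- a i] in [C], so [a i = 0] as [C] is pointed. *)
    have [t00|t00] := eqVneq t 0.
      have -> : a i = 0.
        by apply: (cone_pointed (Ca i)); rewrite t00 scale0r add0r in Ct.
      by exists 1; rewrite // scaler0 subr0.
    have tp : 0 < t by rewrite lt_neqAle eq_sym t00.
    exists t^-1; first by rewrite invr_gt0.
    have -> : y - t^-1 *: a i = t^-1 *: (t *: y - a i).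
      by rewrite scalerBr scalerA mulVf // scale1r.
    by apply: coneZ => //; rewrite invr_ge0 ltW.
  have uC x : val C x -> 0 <= dot x u.
    move=> /Cgen[c c0 ->]; rewrite dot_sum; apply: sumr_ge0 => k _.
    rewrite dotZ mulr_ge0 // us // inE; apply/orP; right.
    by apply/mapP; exists k; rewrite ?mem_enum.
  have uy : dot y u = 0.
    apply/eqP; rewrite eq_le uC // andbT -oppr_ge0 -dotN.
    by apply: us; rewrite mem_head.
  pose F := [set x | val C x /\ dot x u = 0].
  have FS : F \in cones S.
    by apply/(fan_face (valP C)); [move=> x []|exists u].
  case: (Cint [` FS]%fset); last by split.
  rewrite lt_neqAle; apply/andP; split; last by apply/cone_leP => x [].
  apply/eqP => FC; have FE : F = val C by rewrite -FC.
  have : F (a i) by rewrite FE; exact: Ca i.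
  by case=> _ ai0; rewrite dotN ai0 oppr0 ltxx in ub.
have goodW w e : val C (y - e *: w) -> 0 < e -> forall e', 0 <= e' <= e -> val C (y - e' *: w).
  move=> Cw e0 e' /andP[e'0 e'e].
  have -> : y - e' *: w = (1 - e' / e) *: y + (e' / e) *: (y - e *: w).
    rewrite scalerBl scale1r scalerBr scalerA divfK ?gt_eqF // addrA subrK.
    by [].
  apply: coneD; apply: coneZ => //; last exact: divr_ge0 e'0 (ltW e0).
  by rewrite subr_ge0 ler_pdivrMr // mul1r.
have goodD w w' : good w -> good w' -> good (w + w').
  move=> [e e0 Ce] [e' e'0 Ce']; pose m := Order.min e e'.
  have m0 : 0 < m by rewrite lt_min e0.
  exists (m / 2); first by rewrite divr_gt0.
  have -> : y - (m / 2) *: (w + w') = 2^-1 *: (y - m *: w) + 2^-1 *: (y - m *: w').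
    by apply/rowP => j; rewrite !mxE; field.
  by apply: coneD; apply: coneZ; rewrite ?invr_ge0 //; [apply: goodW Ce _ _ _|apply: goodW Ce' _ _ _];
    rewrite // ltW //= ge_min lexx ?orbT.
have goodZ c w : 0 <= c -> good w -> good (c *: w).
  move=> c0 [e e0 Ce]; have [->|cn0] := eqVneq c 0.
    by exists 1; rewrite // scale0r scaler0 subr0.
  have cp : 0 < c by rewrite lt_neqAle eq_sym cn0.
  exists (e / c); first by rewrite divr_gt0.
  by rewrite scalerA divfK.
move=> /Cgen[c c0 ->].
change (good (\sum_i c i *: a i)).
elim/big_ind: _ => //; first by exists 1; rewrite // scaler0 subr0.
by move=> i _; exact: goodZ.
Qed.
End FanGeometry.

(** * Facets and dimension *)

Section Facets.
Variables (R : realType) (d : nat) (S : fan R d).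
Local Notation pt := ('rV[int]_d).
Implicit Types (C D E F G : face_poset S) (x y z : 'rV[R]_d).

Lemma zero_cone : exists Z : face_poset S,
  [/\ forall x, val Z x <-> x = 0, cint Z 0 & forall C, (Z <= C)%O].
Proof.
have /fset0Pn[C CS] := fan_neq0 S.
have [Z _ Z0] := cint_exists (cone0 ([` CS]%fset : face_poset S)).
exists Z; split=> //; last by move=> D; apply: cint_le Z0 (cone0 D).
move=> x; split=> [Zx|->]; last exact: cone0.
have [e e0 Ze] := cint_absorb Z0 Zx.
apply: (cone_pointed Zx).
have -> : - x = e^-1 *: (0 - e *: x).
  by rewrite sub0r scalerN scalerA mulVf ?gt_eqF // scale1r.
by apply: coneZ => //; rewrite invr_ge0 ltW.
Qed.

Definition fker (u : 'cV[R]_d) : {vspace 'rV[R]_d} := lker (linfun (mulmxr u : 'rV[R]_d -> 'rV[R]_1)).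

Lemma fkerP u x : (x \in fker u) = (dot x u == 0).
Proof.
rewrite memv_ker lfunE /=; apply/eqP/eqP => [xu|xu].
  by rewrite /dot xu mxE.
by apply/matrixP => i j; rewrite [RHS]mxE !ord1; exact: xu.
Qed.

(** The functional is a coordinate of the projection away from [U] that is nonzero at [x]. *)
Lemma separate (U : {vspace 'rV[R]_d}) x : x \notin U ->
  exists w, (forall y, y \in U -> dot y w = 0) /\ dot x w != 0.
Proof.
move=> xU; pose f : 'End('rV[R]_d) := (\1 - projv U)%VF.
pose M := lin1_mx f.
have dotE y j : dot y (col j M) = f y 0 j.
  rewrite -(mul_rV_lin1 f y) /dot !mxE.
  by apply: eq_bigr => k _; rewrite [in LHS]mxE.
have fE y : f y = y - projv U y by rewrite /f !lfunE /= lfunE /= lfunE.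
have [j xj] : exists j, f x 0 j != 0.
  apply: contrapT => nex; move/negP: xU; apply.
  have fx : f x = 0.
    apply/rowP => j; rewrite [RHS]mxE; apply: contrapT => /eqP xj.
    by apply: nex; exists j.
  have -> : x = projv U x by apply/eqP; rewrite -subr_eq0 -fE fx.
  exact: memv_proj.
exists (col j M); split=> [y yU|]; last by rewrite dotE.
by rewrite dotE fE projv_id // subrr mxE.
Qed.

Lemma hullP C : is_linear_hull (val C) (xget 0%VS (is_linear_hull (val C))).
Proof.
have [n [v [Cv Cgen]]] := cone_gens C.
suff : is_linear_hull (val C) <<[seq real_point R (v i) | i : 'I_n]>>%VS.
  by move=> h; exact: (xgetPex 0%VS (ex_intro _ _ h)).
split=> [x|U' CU'].
  move=> /Cgen[c c0 ->]; apply: memv_suml => i _; apply: memvZ.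
  by apply: memv_span; apply: map_f; rewrite mem_enum.
by apply/span_subvP => _ /mapP[i _ ->]; exact: CU'.
Qed.

Lemma cone_dim_zero C : (forall x, val C x -> x = 0) -> cone_dim (val C) = 0%N.
Proof.
move=> C0; apply/eqP; rewrite /cone_dim dimv_eq0 -subv0.
by apply: (hullP C).2 => x /C0 ->; exact: mem0v.
Qed.

(** For a maximal proper face [G], cut out by [u], the span of [G] is the part of the span of [C] on
    which [u = 0], and rank-nullity gives the dimension. Otherwise a functional [w] vanishing on [G]
    but not on that part would produce a face strictly between. *)
Lemma facet_exists C : (exists2 x, val C x & x != 0) -> exists G,
  [/\ (G < C)%O, forall D, (G < D)%O -> ~ (D < C)%O &
      cone_dim (val C) = (cone_dim (val G)).+1].
Proof.
move=> [x0 Cx0 x00]; have [Z [ZE _ Zle]] := zero_cone.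
have ZC : (Z < C)%O.
  rewrite lt_neqAle Zle andbT; apply/eqP => ZC.
  by move: Cx0; rewrite -ZC => /ZE /eqP; rewrite (negbTE x00).
case: (arg_maxnP (@below R d S) (P := fun D => (D < C)%O) ZC) => G GC Gmax.
have Gmax' D : (G < D)%O -> ~ (D < C)%O.
  by move=> /below_lt GD DC; have : (below D <= below G)%N := Gmax D DC; rewrite leqNgt GD.
exists G; split=> //.
have GsubC : val G `<=` val C by apply/cone_leP/ltW.
have [u [uC GE]] := (fan_face (valP C) GsubC).2 (valP G).
have GE' x : val G x <-> val C x /\ dot x u = 0 by rewrite GE.
have uC' x : val C x -> 0 <= dot x u by exact: uC.
have [C1 C2] := hullP C; have [G1 G2] := hullP G.
rewrite /cone_dim; set UC := xget _ _ in C1 C2 *; set UG := xget _ _ in G1 G2 *.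
have [n [v [Ca Cgen]]] := cone_gens C.
pose a i := real_point R (v i); have {}Ca i : val C (a i) by exact: Ca.
have genC (D : face_poset S) : (forall i, val D (a i)) -> (C <= D)%O.
  move=> Da; apply/cone_leP => x /Cgen[c c0 ->].
  by apply: cone_sum => i _; apply: coneZ; [exact: c0|exact: Da].
have [i0 ui0] : exists i, 0 < dot (a i) u.
  apply: contrapT => nex; have : (C <= G)%O.
    apply: genC => i; apply/GE'; split=> //; apply/eqP; rewrite eq_le uC' // andbT.
    by rewrite leNgt; apply/negP => ai; apply: nex; exists i.
  by move=> CG; have := lt_le_trans GC CG; rewrite ltxx.
have hullE : UG = (UC :&: fker u)%VS.
  apply/eqP; rewrite eqEsubv; apply/andP; split.
    apply: G2 => x /GE'[Cx xu]; rewrite memv_cap C1 // fkerP xu.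
    exact: eqxx.
  apply/subvP => x; rewrite memv_cap fkerP => /andP[xC /eqP xu].
  apply: contrapT => /negP /separate[w [wG xw]].
  (* [lam] is the largest value with [w - lam *: u] nonnegative on [C]. This functional vanishes at
     the minimising generator, so its face is larger than [G]; it does not vanish at [x], so its
     face is proper. *)
  case: (@arg_minP _ _ _ i0 (fun i => 0 < dot (a i) u)
    (fun i => dot (a i) w / dot (a i) u) ui0) => i ui imin.
  set lam := dot (a i) w / dot (a i) u in imin.
  pose u' := w - lam *: u.
  have u'a k : 0 <= dot (a k) u'.
    rewrite /u' dotBr subr_ge0; have := uC' _ (Ca k).
    rewrite le_eqVlt => /orP[/eqP uk|uk]; last by rewrite -ler_pdivlMr // imin.
    rewrite -uk mulr0 wG //; apply: G1; apply/GE'; split=> //.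
  pose G' := [set x | val C x /\ dot x u' = 0].
  have G'S : G' \in cones S.
    apply/(fan_face (valP C)); first by move=> z [].
    exists u'; split=> // z /Cgen[c c0 ->].
    rewrite -[X in 0 <= X]/(dot _ u') dot_sum; apply: sumr_ge0 => k _.
    by rewrite dotZ; apply: mulr_ge0; [exact: c0|exact: u'a].
  pose G1' : face_poset S := [` G'S]%fset.
  apply: (Gmax' G1').
    rewrite lt_neqAle; apply/andP; split.
      apply/eqP => GG'; have : val G (a i).
        rewrite GG'; split=> //; rewrite /u' dotBr /lam divfK ?subrr // gt_eqF //.
      by move=> /GE'[_ ai]; rewrite ai ltxx in ui.
    apply/cone_leP => z Gz; have [Cz zu] := (GE' z).1 Gz; split=> //.
    by rewrite /u' dotBr zu mulr0 subr0 wG // G1.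
  rewrite lt_neqAle; apply/andP; split; last by apply/cone_leP => z [].
  apply/eqP => G'C; move/eqP: xw; apply.
  have : x \in fker u'.
    move: x xC {xu}; apply/subvP; apply: C2 => z Cz; rewrite fkerP.
    have : val G1' z by rewrite G'C.
    by case=> _ ->.
  by rewrite fkerP /u' dotBr xu mulr0 subr0 => /eqP.
rewrite hullE -(limg_ker_dim (linfun (mulmxr u : 'rV[R]_d -> 'rV[R]_1)) UC) -/(fker u).
rewrite -[RHS]addn1; congr addn; apply/eqP; rewrite eqn_leq; apply/andP; split.
  apply: leq_trans (dimvS (subvf _)) _.
  by rewrite dimvf /dim /= muln1.
rewrite lt0n dimv_eq0; apply/eqP => im0.
have : linfun (mulmxr u : 'rV[R]_d -> 'rV[R]_1) (a i0) \in 0%VS.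
  by rewrite -im0; apply: memv_img; apply: C1.
rewrite memv0 lfunE /= => /eqP /matrixP /(_ 0 0).
by rewrite [RHS]mxE => /eqP; rewrite -[X in X == _]/(dot (a i0) u) gt_eqF.
Qed.
End Facets.

(** * Modules of lattice points in convex sets *)

Lemma TZ_zero (K : fieldType) (G : zmodType) (A : comAlgType K) (deg : grading G A)
    (I : set A) (M : graded_module deg) a j : (forall x : M, x = 0) -> TZ I M a j.
Proof.
move=> M0 x _; have -> : x = 0.
  apply: etrans (esym (tmap_id x)) _; apply: etrans (@tmap0 _ _ _ _ I a a M M j x).
  by apply: eq_tmap => y; rewrite (M0 y).
case: j {x} => [|j]; first by [].
by exists 0; rewrite raddf0.
Qed.

Section ConvexSets.
Variables (R : realType) (d : nat) (S : fan R d) (K : fieldType) (C0 : face_poset S).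
Local Notation pt := ('rV[int]_d).
Local Notation I := (graded_maximal_ideal (S := S) (K := K)).

Record cset := CSet { cset_pt :> pt -> bool; cset_convex : cone_convex C0 cset_pt }.

Lemma cset_ext (X X' : cset) : X =1 X' -> X = X'.
Proof.
case: X X' => [X hX] [X' hX'] /= XX'.
have e : X = X' by apply/funext.
subst X'.
by rewrite (Prop_irrelevance hX hX').
Qed.

Definition cmod (X : cset) : graded_module (face_grading S K) :=
  mono_module K (cone_data (@cset_convex X)).

Definition CZ (X : cset) b j := TZ I (cmod X) b j.

Lemma cmod_eq0 (X : cset) : (forall p, ~~ X p) -> forall x : cmod X, x = 0.
Proof.
by move=> X0 x; apply: lcoef_inj => l p; rewrite lcoef0 lcoef_out //; exact: X0.
Qed.

Lemma CZ_empty (X : cset) b j : (forall p, ~~ X p) -> CZ X b j.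
Proof. by move=> X0; apply: TZ_zero; exact: cmod_eq0. Qed.

Lemma lcoef_ctransfer e (X X' : cset) (x : cmod X) l p :
  lcoef l p (transfer (cone_data (@cset_convex X')) e (fun _ _ _ => 1 : K) x) =
  if X' p then lcoef tt (p - e) x else 0.
Proof.
rewrite lcoef_transfer /=; case: ifP => // _.
by rewrite (bigD1 tt) //= big1 ?addr0 ?mul1r // => -[]; rewrite eqxx.
Qed.

Section Sequence.
Variables (X' X X'' : cset).
Hypothesis Xsum : forall p, X p = X' p || X'' p.
Hypothesis Xdisj : forall p, X' p -> ~~ X'' p.
Hypothesis X'up : forall p s, in_cone C0 s -> X' p -> X (p + s) -> X' (p + s).

Let f : cmod X' -> cmod X := transfer (cone_data (@cset_convex X)) 0 (fun _ _ _ => 1).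
Let g : cmod X -> cmod X'' := transfer (cone_data (@cset_convex X'')) 0 (fun _ _ _ => 1).

(** [X'] is closed upwards in [X], hence spans a submodule, with quotient spanned by [X'']. *)
Lemma cmod_incl_alin : alin f.
Proof.
apply: transfer_alin => s [] [] p sS /= X'p; rewrite !addr0 Xsum X'p /=.
have [Cs|] //= := boolP (in_cone C0 s); have [Xps|Xps] := boolP (X (p + s)).
  by rewrite (X'up Cs X'p Xps).
by rewrite andbF.
Qed.

Lemma cmod_proj_alin : alin g.
Proof.
apply: transfer_alin => s [] [] p sS /= Xp; rewrite !addr0.
have [Cs|] //= := boolP (in_cone C0 s); last by rewrite andbF.
have [Xps|Xps] := boolP (X'' (p + s)); last by rewrite !andbF.
rewrite !andbT Xsum Xps orbT; suff -> : X'' p by [].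
have := Xp; rewrite Xsum => /orP[X'p|//].
have := X'up Cs X'p; rewrite Xsum Xps orbT => /(_ isT) /Xdisj.
by rewrite Xps.
Qed.

Let gf : gmap 0 f := transfer_gmap _ _ _ _.
Let gg : gmap 0 g := transfer_gmap _ _ _ _.

Let fP (x : cmod X') p : lcoef tt p (f x) = if X p then lcoef tt p x else 0.
Proof. by rewrite lcoef_ctransfer subr0. Qed.
Let gP (x : cmod X) p : lcoef tt p (g x) = if X'' p then lcoef tt p x else 0.
Proof. by rewrite lcoef_ctransfer subr0. Qed.

Let f_inj x : f x = 0 -> x = 0.
Proof.
move=> fx; apply: lcoef_inj => -[] p; have := fP x p; rewrite fx !lcoef0.
case: ifP => // Xp _; rewrite lcoef_out //= .
by apply: contraFN Xp => X'p; rewrite Xsum X'p.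
Qed.

Let g_surj y : exists x, g x = y.
Proof.
exists (transfer (cone_data (@cset_convex X)) 0 (fun _ _ _ => 1 : K) y).
apply: lcoef_inj => -[] p; rewrite gP lcoef_ctransfer subr0.
case: ifP => [X''p|/negbT X''p]; first by rewrite Xsum X''p orbT.
by rewrite lcoef_out.
Qed.

Let g_f x : g (f x) = 0.
Proof.
apply: lcoef_inj => -[] p; rewrite gP fP lcoef0.
case: ifP => // X''p; case: ifP => // _; rewrite lcoef_out //=.
by apply: contraL X''p; exact: Xdisj.
Qed.

Let fg_ex y : g y = 0 -> exists x, y = f x.
Proof.
move=> gy; exists (transfer (cone_data (@cset_convex X')) 0 (fun _ _ _ => 1 : K) y).
apply: lcoef_inj => -[] p; rewrite fP lcoef_ctransfer subr0.
have := gP y p; rewrite gy lcoef0.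
case: ifP => X''p; first by move=> <-; rewrite !if_same.
move=> _; case: ifP => [Xp|/negbT Xp]; last by rewrite lcoef_out.
by rewrite Xsum X''p orbF in Xp; rewrite Xp.
Qed.

Lemma CZ_mid b j : CZ X' b j -> CZ X'' b j -> CZ X b j.
Proof. exact: (TZ_mid cmod_incl_alin cmod_proj_alin gf gg f_inj g_surj fg_ex). Qed.

Lemma CZ_left b j : CZ X b j -> (forall i, j = i.+1 -> CZ X'' b i) -> CZ X' b j.
Proof. exact: (TZ_left cmod_incl_alin cmod_proj_alin gf gg f_inj g_surj g_f fg_ex). Qed.

Lemma cmod_incl_coboundary b j (x : torsion_cobar I b (cmod X') j) :
  (forall i, j = i.+1 -> CZ X'' b i) -> differential (torsion_cobar I b (cmod X')) j x = 0 ->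
  is_coboundary (tmap I b b f x : torsion_cobar I b (cmod X) j) -> is_coboundary x.
Proof. exact: (tmap_ses_inj cmod_incl_alin cmod_proj_alin gf gg f_inj g_surj g_f fg_ex). Qed.
End Sequence.
End ConvexSets.

(** * Lattice points met by a moving cone *)

Section Jumps.
Variables (R : realType) (d : nat) (S : fan R d).
Local Notation pt := ('rV[int]_d).
Implicit Types (C D E F G : face_poset S) (x y z : 'rV[R]_d).

Lemma cone_separate C x : ~ val C x ->
  exists u, (forall y, val C y -> 0 <= dot y u) /\ dot x u < 0.
Proof.
have [n [v [Cv Cgen]]] := cone_gens C; move=> Cx.
have [c|[u [us ux]]] := farkas [seq real_point R (v i) | i : 'I_n] x.
  by case: Cx; apply: conic_cone c => _ /mapP[i _ ->]; exact: Cv.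
exists u; split=> // y /Cgen[c c0 ->]; rewrite dot_sum; apply: sumr_ge0 => i _.
by rewrite dotZ mulr_ge0 // us //; apply/mapP; exists i; rewrite ?mem_enum.
Qed.

Section Line.
Variables (F : face_poset S) (v : 'rV[R]_d).
Hypothesis Fv : cint F v.

Lemma ray_cint z s t : s < t -> val F (z + s *: v) -> cint F (z + t *: v).
Proof.
move=> st Fz; have -> : z + t *: v = (t - s) *: v + (z + s *: v).
  by rewrite scalerBl [RHS]addrCA subrK.
by apply: cint_add => //; apply: cint_scale => //; rewrite subr_gt0.
Qed.

Lemma ray_mono z s t : s <= t -> val F (z + s *: v) -> val F (z + t *: v).
Proof.
rewrite le_eqVlt => /orP[/eqP -> //|st] /(ray_cint st); exact: cint_sub.
Qed.

(** [t0] is the infimum of the times at which the point lies in the cone. It is attained because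
    cones are closed, shown here by separation. The point is not interior at that time, since
    [cint_absorb] would give an earlier one. *)
Lemma first_hit z s t : val F (z + t *: v) -> ~ val F (z + s *: v) ->
  exists t0, [/\ s < t0, t0 <= t, val F (z + t0 *: v), ~ cint F (z + t0 *: v) &
    forall r, r < t0 -> ~ val F (z + r *: v)].
Proof.
move=> Ft Fs; pose B := [set r | val F (z + r *: v)].
have Blb : lbound B s.
  move=> r Br; rewrite leNgt; apply/negP => /ltW rs; apply: Fs; exact: ray_mono rs Br.
have Bn : nonempty B by exists t.
have hB : has_lbound B by exists s.
have below_inf r : r < inf B -> ~ val F (z + r *: v).
  by move=> rB Br; have := ge_inf hB Br; rewrite leNgt rB.
have Finf : val F (z + inf B *: v).
  apply: contrapT => /cone_separate[u [Fu]]; rewrite dotD dotZ => neg.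
  have := Fu _ (cint_sub Fv); rewrite le_eqVlt => /orP[/eqP v0|vp].
    have := Fu _ Ft; rewrite dotD dotZ -v0 mulr0 addr0 leNgt.
    by move: neg; rewrite -v0 mulr0 addr0 => ->.
  have : - dot z u / dot v u <= inf B.
    apply: lb_le_inf => // r /Fu; rewrite dotD dotZ => rp.
    by rewrite ler_pdivrMr // -subr_ge0 opprK addrC.
  rewrite ler_pdivrMr // => H.
  by move: neg; rewrite ltNge -(opprK (dot z u)) addrC subr_ge0 H.
exists (inf B); split=> //.
- rewrite lt_neqAle lb_le_inf // andbT; apply/eqP => sB.
  by apply: Fs; rewrite sB.
- exact: ge_inf.
- move=> /cint_absorb/(_ (cint_sub Fv))[e e0].
  rewrite -addrA -scalerBl; apply: below_inf.
  by rewrite ltrBlDr ltrDl.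
Qed.

(** A boundary point lies on a proper face [G]. Removing the integral parts of its coefficients on
    the generators of [G] gives a lattice point of a bounded box that is on the same face at the
    same time. For each face and box point the time is unique, as the point is interior to [F] at
    any later time. *)
Lemma jump_times (w : 'rV[R]_d) : exists ts : seq R, forall (p : pt) t, 0 <= t <= 1 ->
  val F (real_point R p - w + t *: v) -> ~ cint F (real_point R p - w + t *: v) -> t \in ts.
Proof.
have bound G : (G < F)%O -> exists N : nat, forall (p : pt) t, 0 <= t <= 1 ->
    val G (real_point R p - w + t *: v) ->
    exists2 q : pt, q \in lattice_box d N & val G (real_point R q - w + t *: v).
  move=> GF; have [n [g [Gg Ggen]]] := cone_gens G.
  pose bd (j : 'I_d) := `|w 0 j| + `|v 0 j| + \sum_i `|(g i 0 j)%:~R : R|.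
  have bd0 j : 0 <= bd j by rewrite /bd !addr_ge0 // sumr_ge0.
  pose N := (\sum_j (absz (Num.floor (bd j)) + 1))%N.
  have bdN j : bd j < (N%:Z)%:~R.
    apply: lt_le_trans (floorD1_gt _) _; rewrite ler_int.
    rewrite /N (bigD1 j) //=; have := bd0 j; rewrite -floor_ge0.
    by move: (Num.floor (bd j)) => k; lia.
  exists N => p t /andP[t0 t1] /Ggen[c c0 pE].
  pose fl i : int := Num.floor (c i).
  pose q := p - \sum_i fl i *: g i.
  have fgE i : real_point R (fl i *: g i) = (fl i)%:~R *: real_point R (g i).
    by apply/rowP => j; rewrite !mxE intrM.
  have qE : real_point R q - w + t *: v = \sum_i (c i - (fl i)%:~R) *: real_point R (g i).
    rewrite /q {1}/real_point raddfB /= -/(real_point R p) -/(real_point R _).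
    rewrite real_point_sum -addrA addrAC addrA pE -sumrB; apply: eq_bigr => i _.
    by rewrite fgE scalerBl.
  have frac i : 0 <= c i - (fl i)%:~R <= 1.
    rewrite subr_ge0 floor_le lerBlDr; have := ltW (floorD1_gt (c i)).
    by rewrite intrD addrC.
  exists q; last first.
    rewrite qE; apply: cone_sum => i _; apply: coneZ => //.
    by have /andP[] := frac i.
  apply: lattice_boxP => j.
  have : `|(q 0 j)%:~R : R| <= bd j.
    have -> : (q 0 j)%:~R = w 0 j - t * v 0 j + \sum_i (c i - (fl i)%:~R) * (g i 0 j)%:~R :> R.
      have := congr1 (fun z : 'rV[R]_d => z 0 j) qE.
      have -> : (\sum_i (c i - (fl i)%:~R) *: real_point R (g i)) 0 j =
          \sum_i (c i - (fl i)%:~R) * (g i 0 j)%:~R.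
        by rewrite summxE; apply: eq_bigr => i _; rewrite !mxE.
      move: (\sum_i _) => X; rewrite /real_point !mxE => <-; ring.
    rewrite /bd; apply: le_trans (ler_normD _ _) _; apply: lerD.
      apply: le_trans (ler_normB _ _) _; rewrite lerD2l normrM (ger0_norm t0).
      by rewrite ler_piMl.
    apply: le_trans (ler_norm_sum _ _ _) _; apply: ler_sum => i _.
    have /andP[f0 f1] := frac i.
    by rewrite normrM (ger0_norm f0) ler_piMl.
  move=> /le_lt_trans /(_ (bdN j)); rewrite -intr_norm ltr_int.
  exact: ltW.
pose N G := if pselect (G < F)%O is left h then sval (cid (bound G h)) else 0%N.
(* One time per face and box point. The default 0, for pairs that have none, is harmless: only
   containment is claimed. *)
pose ts := [seq xget 0 [set t | val Gq.1 (real_point R Gq.2 - w + t *: v)] |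
  Gq <- flatten [seq [seq (G, q) | q <- lattice_box d (N G)] | G : face_poset S]].
exists ts => p t t01 Fp nFp.
have [G GF Gp] : exists2 G : face_poset S, (G < F)%O & val G (real_point R p - w + t *: v).
  have [G GF Gp] := cint_exists Fp; exists G; last exact: cint_sub.
  by rewrite lt_neqAle GF andbT; apply/eqP => GF'; apply: nFp; rewrite -GF'.
have : exists2 q : pt, q \in lattice_box d (N G) & val G (real_point R q - w + t *: v).
  by rewrite /N; case: pselect => // h; case: cid => M MP /=; exact: MP p t t01 Gp.
move=> [q qN Gq]; apply/mapP; exists (G, q).
  apply/flattenP; exists [seq (G, q) | q <- lattice_box d (N G)]; last exact: map_f.
  by apply/mapP; exists G; rewrite ?mem_enum.
have uniq r r' : val G (real_point R q - w + r *: v) ->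
    val G (real_point R q - w + r' *: v) -> r < r' -> False.
  move=> Gr Gr' rr'; have Fr : val F (real_point R q - w + r *: v).
    by move: Gr; apply/cone_leP/ltW.
  have [_] := ray_cint rr' Fr.
  by move=> /(_ G GF).
have := xgetPex 0 (ex_intro (fun t => [set t | val G (real_point R q - w + t *: v)] t) t Gq).
move=> /= Gx; apply/eqP; rewrite eq_le !leNgt.
by apply/andP; split; apply/negP; [exact: uniq Gx Gq|exact: uniq Gq Gx].
Qed.
End Line.
End Jumps.

Lemma count_lt (T : eqType) (a b : pred T) (s : seq T) m :
  (forall x, a x -> b x) -> m \in s -> b m -> ~~ a m -> (count a s < count b s)%N.
Proof.
move=> ab ms bm am; elim: s ms => //= x s IHs; rewrite inE.
have [<- _|_ /= /IHs] := eqVneq m x.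
  by rewrite (negbTE am) bm ltnS; exact: sub_count.
by have := ab x; case: (a x) => [->|_] //; case: (b x) => // /ltnW.
Qed.

(** * Filtration of jumps by translated boundaries *)

Section Vanishing.
Variables (R : realType) (d : nat) (S : fan R d) (K : fieldType) (C0 : face_poset S).
Local Notation pt := ('rV[int]_d).
Local Notation I := (graded_maximal_ideal (S := S) (K := K)).
Local Notation rp := (real_point R).
Implicit Types (D F G : face_poset S) (w z : 'rV[R]_d) (b p : pt).

Record rset := RSet {
  rset_set :> 'rV[R]_d -> Prop;
  rset_convex : forall y s t, val C0 s -> val C0 t ->
    rset_set y -> rset_set (y + s + t) -> rset_set (y + s) }.

(** The lattice points of [w + Y]. Keeping [Y] and [w] apart lets splittings be checked once for all
    translates. *)
Definition pts_pred w (Y : rset) p : bool := `[< Y (rp p - w) >].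

Fact pts_convex w Y : cone_convex C0 (pts_pred w Y).
Proof.
move=> p s t /asboolP Cs /asboolP Ct /asboolP Yp /asboolP Yst; apply/asboolP.
rewrite !real_pointD ![_ + _ - w]addrAC in Yst *; exact: rset_convex Cs Ct Yp Yst.
Qed.

Definition pts w Y : cset C0 := CSet (@pts_convex w Y).

Lemma pts_ext w w' (Y Y' : rset) :
  (forall p, Y (rp p - w) <-> Y' (rp p - w')) -> pts w Y = pts w' Y'.
Proof. by move=> YY'; apply: cset_ext => p; apply/asboolP/asboolP => /YY'. Qed.

Definition rsplit (Y' Y Y'' : rset) := [/\ forall z, Y z <-> Y' z \/ Y'' z,
  forall z, Y' z -> ~ Y'' z &
  forall z s, val C0 s -> Y' z -> Y (z + s) -> Y' (z + s)].

Section Split.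
Variables (w : 'rV[R]_d) (Y' Y Y'' : rset).
Hypothesis Ysplit : rsplit Y' Y Y''.

Let Ysum p : pts w Y p = pts w Y' p || pts w Y'' p.
Proof.
have [Ys _ _] := Ysplit; rewrite /= /pts_pred; apply/asboolP/orP.
  by move=> /Ys[]; [left|right]; apply/asboolP.
by case=> /asboolP H; apply/Ys; [left|right].
Qed.

Let Ydisj p : pts w Y' p -> ~~ pts w Y'' p.
Proof.
by have [_ Yd _] := Ysplit; move=> /asboolP Yp; apply/negP => /asboolP; exact: Yd.
Qed.

Let Yup p s : in_cone C0 s -> pts w Y' p -> pts w Y (p + s) -> pts w Y' (p + s).
Proof.
have [_ _ Yu] := Ysplit; move=> /asboolP Cs /asboolP Yp /asboolP Yps; apply/asboolP.
rewrite real_pointD [_ + _ - w]addrAC in Yps *; exact: Yu.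
Qed.

Definition PZ_mid b j : CZ K (pts w Y') b j -> CZ K (pts w Y'') b j -> CZ K (pts w Y) b j :=
  CZ_mid Ysum Ydisj Yup (b := b) (j := j).
Definition PZ_left b j : CZ K (pts w Y) b j ->
    (forall i, j = i.+1 -> CZ K (pts w Y'') b i) -> CZ K (pts w Y') b j :=
  CZ_left Ysum Ydisj Yup (b := b) (j := j).
Definition PZ_coboundary b j := @cmod_incl_coboundary _ _ _ K _ _ _ _ Ysum Ydisj Yup b j.
End Split.

Program Definition union_rset (P : pred (face_poset S)) : rset :=
  {| rset_set := fun z => val C0 z /\ exists2 D, P D & val D z |}.
Next Obligation.
move=> P y s t Cs Ct [Cy _] [_ [D PD Dst]]; split; first exact: coneD.
by exists D => //; have [] := cone_face (coneD Cy Cs) Ct Dst.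
Qed.

Program Definition int_rset F : rset := {| rset_set := fun z => val C0 z /\ cint F z |}.
Next Obligation.
move=> F y s t Cs Ct [Cy Fy] [_ Fst]; split; first exact: coneD.
have [Fys _] := cone_face (coneD Cy Cs) Ct (cint_sub Fst).
by apply: cint_add Fy _; have [] := cone_face Cy Cs Fys.
Qed.

Definition face_rset F := union_rset [pred D | (D <= F)%O].
Definition boundary_rset F := union_rset [pred D | (D < F)%O].

Lemma face_rsetE F z : (F <= C0)%O -> face_rset F z <-> val F z.
Proof.
move=> FC; split=> [[_ [D /= DF Dz]]|Fz]; first by move: Dz; apply/cone_leP.
by split; [move: Fz; apply/cone_leP|exists F => //=].
Qed.

(** Removing a maximal cone [G] from a family closed under faces removes exactly its interior, which
    is closed upwards in the union and so spans the submodule. *)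
Lemma split_union (P : pred (face_poset S)) G : P G ->
  (forall D E, P D -> (E <= D)%O -> P E) -> (forall D, P D -> ~ (G < D)%O) ->
  rsplit (int_rset G) (union_rset P) (union_rset [pred D | P D & D != G]).
Proof.
move=> PG Pdown Gmax; split.
- move=> z; split.
    move=> [Cz [D PD Dz]]; have [E ED Ez] := cint_exists Dz.
    have PE := Pdown _ _ PD ED.
    have [EG|EG] := eqVneq E G; first by left; split; rewrite // -EG.
    by right; split=> //; exists E; [rewrite /= PE|exact: cint_sub].
  case=> [[Cz Gz]|[Cz [D /= /andP[PD _] Dz]]]; split=> //.
    by exists G => //; exact: cint_sub.
  by exists D.
- move=> z [Cz Gz] [_ [D /= /andP[PD DG] Dz]].
  by apply: (Gmax D PD); rewrite lt_neqAle eq_sym DG; exact: cint_le Gz Dz.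
move=> z s Cs [Cz Gz] [Czs [D PD Dzs]]; split=> //.
apply: (cint_add Gz); have [Dz Ds] := cone_face Cz Cs Dzs.
have [DG|DG] := eqVneq D G; first by rewrite -DG.
by case: (Gmax D PD); rewrite lt_neqAle eq_sym DG; exact: cint_le Gz Dz.
Qed.

Lemma union_ext w (P P' : pred (face_poset S)) : P =1 P' ->
  pts w (union_rset P) = pts w (union_rset P').
Proof.
move=> PP'; apply: pts_ext => p.
by split=> -[Cp [D PD Dp]]; split=> //; exists D => //; rewrite ?PP' // -PP'.
Qed.

(** The interior spans the kernel of the passage from the face to its boundary, so the boundary
    enters one degree lower. *)
Lemma int_PZ w G b j : CZ K (pts w (face_rset G)) b j ->
  (forall i, j = i.+1 -> CZ K (pts w (boundary_rset G)) b i) ->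
  CZ K (pts w (int_rset G)) b j.
Proof.
move=> ZG ZdG; apply: (PZ_left (@split_union [pred D | (D <= G)%O] G _ _ _) ZG).
- exact: lexx.
- by move=> D E /= DG ED; exact: le_trans ED DG.
- by move=> D /= DG GD; have := le_lt_trans DG GD; rewrite ltxx.
move=> i /ZdG; congr (CZ K _ b i); apply: union_ext => D /=.
by rewrite lt_neqAle andbC.
Qed.

(** Induction on the number of cones, splitting off the interior of a maximal one. *)
Lemma union_PZ w (P : pred (face_poset S)) b :
  (forall D E, P D -> (E <= D)%O -> P E) ->
  (forall D j, P D -> CZ K (pts w (face_rset D)) b j) ->
  forall j, CZ K (pts w (union_rset P)) b j.
Proof.
move: {2}#|P| (leqnn #|P|) => n; elim: n P => [|n IHn] P Pn Pdown PZ j.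
  apply: CZ_empty => p; apply/negP => /asboolP[_ [D PD _]].
  by move: Pn; rewrite leqn0 => /eqP/card0_eq/(_ D); rewrite unfold_in PD.
have [D0 PD0|P0] := pickP P; last first.
  by apply: CZ_empty => p; apply/negP => /asboolP[_ [D PD _]]; rewrite P0 in PD.
case: (arg_maxnP (@below R d S) PD0) => G PG Gmax.
have Gmax' D : P D -> ~ (G < D)%O.
  by move=> PD /below_lt; have : (below D <= below G)%N := Gmax D PD; rewrite leqNgt => /negP.
have sub (P' : pred (face_poset S)) : {subset P' <= P} -> ~~ P' G ->
    (forall D E, P' D -> (E <= D)%O -> P' E) -> forall j, CZ K (pts w (union_rset P')) b j.
  move=> P'P P'G P'down; apply: IHn => //; last by move=> D i /P'P; exact: PZ.
  rewrite -ltnS; apply: leq_trans Pn; apply: proper_card; apply/properP; split.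
    by apply/fintype.subsetP.
  by exists G.
apply: (PZ_mid (split_union PG Pdown Gmax')).
  apply: int_PZ => [|i _]; first exact: PZ.
  apply: sub => [D /= /ltW|/=|D E /= DG ED]; last exact: le_lt_trans ED DG.
    exact: Pdown.
  by rewrite ltxx.
apply: sub => [D /andP[]//|/=|D E /= /andP[PD DG] ED]; first by rewrite eqxx andbF.
rewrite (Pdown _ _ PD ED); apply/eqP => EG.
by apply: (Gmax' D PD); rewrite lt_neqAle eq_sym DG -EG.
Qed.

Lemma boundary_PZ w F b : (forall D, (D < F)%O -> forall j, CZ K (pts w (face_rset D)) b j) ->
  forall j, CZ K (pts w (boundary_rset F)) b j.
Proof.
move=> DZ; apply: union_PZ => [D E /= DF ED|D j /= DF]; last exact: DZ.
exact: le_lt_trans ED DF.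
Qed.

(** All proper faces other than [G], those of [G] included, vanish in every degree; so do their
    unions, and [G] is needed in degree [j] alone. *)
Lemma facet_PZ w F G b j : (G < F)%O -> (forall D, (G < D)%O -> ~ (D < F)%O) ->
  (forall D, (D < F)%O -> D != G -> forall i, CZ K (pts w (face_rset D)) b i) ->
  CZ K (pts w (face_rset G)) b j -> CZ K (pts w (boundary_rset F)) b j.
Proof.
move=> GF Gmax DZ GZ; have sp : rsplit (int_rset G) (boundary_rset F)
    (union_rset [pred D | (D < F)%O & D != G]).
  apply: split_union => [//|D E /= DF ED|D /= DF GD]; first exact: le_lt_trans ED DF.
  exact: Gmax GD DF.
apply: (PZ_mid sp).
  apply: int_PZ => // i _; apply: boundary_PZ => D DG; apply: DZ.
    exact: lt_trans DG GF.
  by rewrite lt_eqF.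
apply: union_PZ => [D E /= /andP[DF DG] ED|D i /= /andP[DF DG]]; last exact: DZ.
rewrite (le_lt_trans ED DF); apply/eqP => EG; apply: (Gmax D) DF.
by rewrite lt_neqAle eq_sym DG -EG.
Qed.

Section Jump.
Variables (F : face_poset S) (v : 'rV[R]_d).
Hypotheses (FC : (F <= C0)%O) (Fv : cint F v).

Let FsubC z : val F z -> val C0 z.
Proof. by move=> Fz; apply: (elimT (cone_leP F C0) FC). Qed.

(** The translate [F - t v], which grows with [t] because [v] lies in [F]. *)
Program Definition shift_rset (t : R) : rset :=
  {| rset_set := fun z => val F (z + t *: v) |}.
Next Obligation.
move=> t y s s' Cs Cs' /= Fy; rewrite -!addrA addrC !addrA addrC.
rewrite (_ : y + (s + s' + t *: v) = y + t *: v + s + s'); last first.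
  by rewrite addrA addrAC addrA.
move=> Fyss'; rewrite addrAC.
by have [] := cone_face (coneD (FsubC Fy) Cs) Cs' Fyss'.
Qed.

Lemma shift_cone s t z c : s <= t -> val C0 c -> val F (z + s *: v) ->
  val F (z + c + t *: v) -> val F c.
Proof.
move=> st Cc Fs Ft; have Fzt := ray_mono Fv st Fs.
by rewrite addrAC in Ft; have [] := cone_face (FsubC Fzt) Cc Ft.
Qed.

Program Definition jump_rset (s t : R) : rset :=
  {| rset_set := fun z => val F (z + t *: v) /\ ~ val F (z + s *: v) |}.
Next Obligation.
move=> s t y c c' Cc Cc' [Fy nFy] [Fc nFc]; split.
  exact: (@rset_convex (shift_rset t)) Cc Cc' Fy Fc.
move=> Fys; apply: nFc; rewrite addrAC; apply: coneD => //.
have Fcc' : val F (c + c').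
  by apply: (shift_cone (lexx t) (coneD Cc Cc') Fy); rewrite addrA.
by have [] := cone_face Cc Cc' Fcc'.
Qed.

Lemma shift_split s t : s <= t -> rsplit (shift_rset s) (shift_rset t) (jump_rset s t).
Proof.
move=> st; split=> [z|z Fs [_]|z c Cc Fs Ft] //=.
  split=> [Ft|[/(ray_mono Fv st)//|[]//]].
  by have [Fs|nFs] := pselect (val F (z + s *: v)); [left|right].
by rewrite addrAC; apply: coneD (Fs) _; exact: (shift_cone st Cc Fs Ft).
Qed.

Lemma jump_split s r t : s <= r -> r <= t ->
  rsplit (jump_rset s r) (jump_rset s t) (jump_rset r t).
Proof.
move=> sr rt; split=> [z|z [Fr _] [_]|z c Cc [Fr nFs] [Ft nFcs]] //=.
  split=> [[Ft nFs]|[[/(ray_mono Fv rt) Ft //]|[Ft nFr]]].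
    by have [Fr|nFr] := pselect (val F (z + r *: v)); [left|right].
  by split=> // /(ray_mono Fv sr).
by split=> //; rewrite addrAC; apply: coneD (Fr) _; exact: (shift_cone rt Cc Fr Ft).
Qed.

Lemma shift_pts w t : pts w (shift_rset t) = pts (w - t *: v) (face_rset F).
Proof.
apply: pts_ext => p; rewrite opprB [t *: v - w]addrC addrA.
by split=> [H|]; [apply/(face_rsetE _ FC)|move/(face_rsetE _ FC)].
Qed.

Lemma seq_min (s : seq R) : s != [::] -> exists2 m, m \in s & forall r, r \in s -> m <= r.
Proof.
elim: s => // a s IHs _; have [->|/IHs[m ms mmin]] := eqVneq s [::].
  by exists a; rewrite ?mem_head // => r; rewrite inE => /eqP ->.
have [am|ma] := leP a m.
  exists a; rewrite ?mem_head // => r; rewrite inE => /orP[/eqP -> //|/mmin].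
  exact: le_trans.
exists m; first by rewrite inE ms orbT.
by move=> r; rewrite inE => /orP[/eqP ->|/mmin //]; exact: ltW.
Qed.

(** Induction on the number of jump times in the interval, split at the first one, [m]. The points
    gained up to [m] enter the cone exactly at [m], so they form a translate of its boundary. *)
Lemma jump_PZ w b j s t : 0 <= s -> t <= 1 ->
  (forall m, s < m -> m <= t -> CZ K (pts (w - m *: v) (boundary_rset F)) b j) ->
  CZ K (pts w (jump_rset s t)) b j.
Proof.
have [ts tsP] := jump_times Fv w.
move: {2}(count _ ts).+1 (ltnSn (count (fun r => s < r <= t) ts)) => n.
elim: n s => // n IHn s sn s0 t1 Z.
have [E|/seq_min[m]] := eqVneq [seq r <- ts | s < r <= t] [::].
  apply: CZ_empty => p; apply/negP => /asboolP[/= Ft nFs].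
  have [t0 [st0 t0t Ft0 nFt0 _]] := first_hit Fv Ft nFs.
  suff : t0 \in [seq r <- ts | s < r <= t] by rewrite E.
  rewrite mem_filter st0 t0t; apply: tsP Ft0 nFt0.
  by rewrite (le_trans t0t t1) andbT (le_trans s0 (ltW st0)).
rewrite mem_filter => /andP[/andP[sm mt] mts] mmin.
apply: (PZ_mid (jump_split (ltW sm) mt)); last first.
  apply: IHn => //; last first.
  - by move=> r mr rt; apply: Z => //; exact: lt_trans mr.
  - exact: le_trans s0 (ltW sm).
  rewrite -ltnS; apply: leq_trans sn; rewrite ltnS.
  apply: (count_lt (m := m)); rewrite ?sm ?mt ?ltxx // => r /andP[mr ->].
  by rewrite (lt_trans sm mr).
suff -> : pts w (jump_rset s m) = pts (w - m *: v) (boundary_rset F) by exact: Z.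
apply: pts_ext => p; rewrite opprB [m *: v - w]addrC addrA.
split=> [[/= Fm nFs]|[_ [D /= DF Dm]]].
  split; first exact: FsubC.
  have [t0 [st0 t0m Ft0 nFt0 _]] := first_hit Fv Fm nFs.
  have mt0 : m <= t0.
    apply: mmin; rewrite mem_filter st0 (le_trans t0m mt); apply: tsP Ft0 nFt0.
    by rewrite (le_trans s0 (ltW st0)) (le_trans t0m) // (le_trans mt).
  have E : t0 = m by apply/eqP; rewrite eq_le t0m.
  rewrite E in nFt0; have [D DF Dm] := cint_exists Fm; exists D; last exact: cint_sub.
  by rewrite /= lt_neqAle DF andbT; apply/eqP => DF'; apply: nFt0; rewrite -DF'.
split=> /= [|Fs]; first by move: Dm; apply/cone_leP/ltW.
by have [_ /(_ D DF)] := ray_cint Fv sm Fs.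
Qed.
End Jump.
End Vanishing.

(** * Vanishing off the interior and off the dimension *)

Section Vanishing.
Variables (R : realType) (d : nat) (S : fan R d) (K : fieldType) (C0 : face_poset S).
Local Notation pt := ('rV[int]_d).
Local Notation I := (graded_maximal_ideal (S := S) (K := K)).
Local Notation rp := (real_point R).
Implicit Types (D F G : face_poset S) (w z : 'rV[R]_d) (b p : pt).


Lemma real_point_eq0 (x : pt) : rp x = 0 -> x = 0.
Proof.
by move=> /rowP H; apply/rowP => j; have := H j; rewrite !mxE => /eqP; rewrite intr_eq0 => /eqP.
Qed.

Lemma cmod_point_torsion (X : cset C0) w : (forall p, X p -> rp p = w) ->
  forall x : cmod K X, torsion I x.
Proof.
move=> Xw x; have [gens [gU gS gP]] := monomial_generators S.
apply/(torsion_byP gU gS gP); exists 1%N => g /gS[gSup g0].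
rewrite mulr1n mono_scale_monomial //; apply: lcoef_inj => l p.
rewrite lcoef_mul // lcoef0; case: ifP => //= /andP[Xp /andP[_ Xpg]].
case/eqP: g0; apply: real_point_eq0; have := Xw _ Xpg.
by rewrite real_pointD (Xw _ Xp) => /eqP; rewrite -subr_eq0 addrC addKr => /eqP.
Qed.

Lemma CZ_degree0 (X : cset C0) b : ~~ X b -> CZ K X b 0.
Proof.
move=> Xb x /degree0_cocycle[xE _ px]; apply: strand_eq; rewrite xE.
have -> : ev 1 (strand_val x) = 0.
  apply: lcoef_inj => l p; rewrite lcoef0; apply/eqP.
  apply: contraNT Xb => nz; have <- := px _ _ nz.
  by apply: contraNT nz => /= Xp; rewrite lcoef_out.
by rewrite (klin0 (eta_gmap (cmod K X)).1).
Qed.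

(** An instance of [TZ_nilpotent]: the transfer from [X0] to its translate [X1], followed by
    translation by [v], is multiplication by [x^v]. *)
Lemma CZ_translation (X0 X1 : cset C0) v (Q : pt -> Prop) j :
  in_cone C0 v -> v != 0 -> (forall p, X1 p = X0 (p + v)) ->
  (forall b, Q b -> Q (b + v)) ->
  (forall b (x : torsion_cobar I b (cmod K X0) j), Q b ->
    differential (torsion_cobar I b (cmod K X0)) j x = 0 ->
    is_coboundary (tmap I b b (transfer (cone_data (cset_convex (c:=X1))) 0
      (fun _ _ _ => 1)) x : torsion_cobar I b (cmod K X1) j) -> is_coboundary x) ->
  forall b, Q b -> CZ K X0 b j.
Proof.
move=> Cv v0 X1E Qv inj.
apply: (@TZ_nilpotent _ _ _ _ I (cmod K X0) (cmod K X1)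
  (transfer (cone_data (cset_convex (c:=X1))) 0 (fun _ _ _ => 1))
  (transfer (cone_data (cset_convex (c:=X0))) v (fun _ _ _ => 1))
  (transfer (cone_data (cset_convex (c:=X1))) (- v) (fun _ _ _ => 1))
  v (mon S K v)).
- exact: transfer_gmap.
- apply: transfer_alin => s [] [] p sS /= Xp.
  rewrite -X1E Xp [p + v + s]addrAC -X1E /=.
  by rewrite -andbA andbb.
- exact: transfer_gmap.
- apply: transfer_alin => s [] [] p sS /= Xp.
  by rewrite !X1E subrK Xp [p - v + s]addrAC subrK /= -andbA andbb.
- exact: transfer_gmap.
- move=> x; apply: lcoef_inj => -[] p; rewrite !lcoef_ctransfer opprK addrK.
  by rewrite -X1E; have [//|Xp] := boolP (X1 p); rewrite lcoef_out.
- move=> x; apply: lcoef_inj => -[] p; rewrite !lcoef_ctransfer opprK subrK X1E subrK.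
  by have [//|Xp] := boolP (X0 p); rewrite lcoef_out.
- exact: mon_ideal (in_cone_support Cv) v0.
- exact: mon_deg.
- move=> x; rewrite mono_scale_monomial ?(in_cone_support Cv) //.
  apply: lcoef_inj => -[] p; rewrite !lcoef_ctransfer lcoef_mul ?(in_cone_support Cv) //.
  rewrite /= X1E subrK Cv /= subr0; case: (X0 p); rewrite ?andbF ?andbT //.
  by have [//|Xp] := boolP (X0 (p - v)); rewrite lcoef_out.
- exact: Qv.
- exact: inj.
Qed.

Section Step.
Variable F : face_poset S.
Hypothesis FC : (F <= C0)%O.
Hypothesis IH : forall D, (D < F)%O -> forall w b j,
  ~ cint D (w - rp b) \/ j <> cone_dim (val D) -> CZ K (pts w (face_rset C0 D)) b j.

(** At most one lattice point remains, so the module is torsion and only cohomological degree 0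
    survives, in the degree of that point. *)
Lemma CZ_zero_cone w b j : (forall x, val F x -> x = 0) ->
  ~ cint F (w - rp b) \/ j <> cone_dim (val F) -> CZ K (pts w (face_rset C0 F)) b j.
Proof.
move=> F0; have Xw p : pts w (face_rset C0 F) p -> rp p = w.
  by move=> /asboolP/(face_rsetE _ FC)/F0/eqP; rewrite subr_eq0 => /eqP.
rewrite (cone_dim_zero F0); case: j => [|j] H; last first.
  apply: torsion_TZ; exact: cmod_point_torsion Xw.
case: H => // nFb; apply: CZ_degree0; apply/negP => /Xw bw; apply: nFb.
rewrite bw subrr; have [D DF D0] := cint_exists (cone0 F).
suff <- : D = F by [].
apply/eqP; rewrite eq_le DF; apply/cone_leP => x /F0 ->; exact: cone0.
Qed.

Hypothesis F_neq0 : exists2 x, val F x & x != 0.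

Lemma CZ_exterior w b j : ~ cint F (w - rp b) -> CZ K (pts w (face_rset C0 F)) b j.
Proof.
have [v Fv] := cint_lattice F.
have v0 : v != 0.
  apply/eqP => v0; have [x Fx /eqP] := F_neq0; apply.
  have [Z [ZE Z0 _]] := zero_cone S; apply/ZE; move: Fx.
  by rewrite (cint_uniq Z0 (D := F)) // -real_point0 -v0.
have Cv : in_cone C0 v by apply/asboolP; apply: (elimT (cone_leP F C0) FC); exact: cint_sub.
pose X0 := pts w (shift_rset (rp v) FC 0).
pose X1 := pts w (shift_rset (rp v) FC 1).
have X1E p : X1 p = X0 (p + v).
  by apply/asboolP/asboolP; rewrite /= scale0r addr0 scale1r real_pointD addrAC.
suff H b' : ~ cint F (w - rp b') -> CZ K X0 b' j.
  by move=> /H; rewrite /X0 shift_pts // scale0r subr0.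
move: b'; apply: (CZ_translation Cv v0 X1E).
- move=> b' nFb Fb; apply: nFb; rewrite real_pointD opprD addrA in Fb.
  by rewrite -[w - rp b'](subrK (rp v)); apply: cint_add => //; exact: cint_sub.
(* A boundary met at time [m] could contribute only if [w - m v - b'] were interior to a proper
   face; adding [m v] would make [w - b'] interior to [F]. *)
move=> b' x nFb dx; apply: (PZ_coboundary (shift_split FC Fv ler01)) => // i _.
apply: jump_PZ => // m m0 m1; apply: boundary_PZ => D DF i'.
apply: (IH DF); left => Db; apply: nFb.
have -> : w - rp b' = m *: rp v + (w - m *: rp v - rp b').
    by rewrite [w - _ - rp b']addrAC [RHS]addrC subrK.
apply: cint_add; first exact: cint_scale.
by move: (cint_sub Db); apply/cone_leP/ltW.
Qed.

(** [v] is chosen so that at time 1 the point [w - v - b] is interior to the facet [G], hence not to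
    [F]. Before that it stays interior to [F] and no proper face contributes; at time 1 only [G]
    does, in its own dimension, and the connecting map adds one. *)
Lemma CZ_interior w b j : cint F (w - rp b) -> j <> cone_dim (val F) ->
  CZ K (pts w (face_rset C0 F)) b j.
Proof.
set y := w - rp b => Fy jF; have [G [GF Gmax dimG]] := facet_exists F_neq0.
have [g Gg] := cint_lattice G; have GFs : val G `<=` val F by apply/cone_leP/ltW.
have [e e0 Fe] := cint_absorb Fy (GFs _ (cint_sub Gg)).
(* With half of [e], the vector [v] is the mean of the interior point [y] and the point [y - e g] of
   [F], hence interior. *)
pose y0 := (e / 2) *: rp g; pose v := y - y0.
have e20 : 0 < e / 2 by rewrite divr_gt0.
have Gy0 : cint G y0 by exact: cint_scale.
have Fv : cint F v.
  have -> : v = 2^-1 *: y + 2^-1 *: (y - e *: rp g).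
    by rewrite /v /y0; apply/rowP => k; rewrite !mxE; field.
  by apply: cint_add; [apply: cint_scale; rewrite // invr_gt0|apply: coneZ; rewrite // invr_ge0].
suff : CZ K (pts w (shift_rset v FC 0)) b j by rewrite shift_pts // scale0r subr0.
apply: (PZ_left (shift_split FC Fv ler01)).
  rewrite shift_pts // scale1r; apply: CZ_exterior.
  have -> : w - v - rp b = y0 by rewrite addrAC /v -/y opprB addrC subrK.
  by move=> [_ /(_ _ GF)]; apply; exact: cint_sub.
move=> i ji; apply: jump_PZ => // m m0 m1.
have wE : w - m *: v - rp b = y - m *: v by rewrite addrAC.
have ym : y - m *: v = (1 - m) *: y + m *: y0.
  by rewrite /v scalerBr scalerBl scale1r opprB addrA addrAC.
have [m1'|m1'] := eqVneq m 1.
  have Ey : y - m *: v = y0 by rewrite m1' scale1r /v opprB addrC subrK.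
  apply: (facet_PZ GF Gmax) => [D DF DG i'|]; apply: IH; rewrite // wE Ey.
    left => Dy; case/eqP: DG; exact: cint_uniq Dy Gy0.
  by right => iG; apply: jF; rewrite dimG -iG.
apply: boundary_PZ => D DF i'; apply: IH => //; left; rewrite wE ym => Dy.
have Fy' : cint F ((1 - m) *: y + m *: y0).
  apply: cint_add; first by apply: cint_scale; rewrite // subr_gt0 lt_neqAle m1'.
  apply: coneZ (ltW m0) _; apply: GFs; exact: cint_sub.
by have := DF; rewrite (cint_uniq Dy Fy') ltxx.
Qed.
End Step.

Theorem CZ_cone F : (F <= C0)%O -> forall w b j,
  ~ cint F (w - rp b) \/ j <> cone_dim (val F) -> CZ K (pts w (face_rset C0 F)) b j.
Proof.
move: {2}(below F).+1 (ltnSn (below F)) => n; elim: n F => // n IHn F Fn FC w b j H.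
have IH D : (D < F)%O -> forall w b j,
    ~ cint D (w - rp b) \/ j <> cone_dim (val D) -> CZ K (pts w (face_rset C0 D)) b j.
  move=> DF; apply: IHn; first exact: leq_trans (below_lt DF) _.
  exact: le_trans (ltW DF) FC.
have [F0|F0] := pselect (exists2 x, val F x & x != 0); last first.
  apply: (CZ_zero_cone FC) H => x Fx; apply/eqP; apply: contrapT => /negP x0.
  by apply: F0; exists x.
have [Fb|nFb] := pselect (cint F (w - rp b)); last exact: CZ_exterior.
by case: H => // jF; exact: CZ_interior.
Qed.

End Vanishing.

Section ConeModule.
Variables (R : realType) (d : nat) (S : fan R d) (K : fieldType) (C : face_poset S).
Local Notation I := (graded_maximal_ideal (S := S) (K := K)).

Definition cone_mono : graded_module (face_grading S K) :=
  mono_module K (cone_data (@cone_convexT R d S C)).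

Lemma cone_mono_TZ (a : 'rV[int]_d) j :
  ~ cint C (- real_point R a) \/ j <> cone_dim (val C) -> TZ I cone_mono a j.
Proof.
rewrite -[- _]add0r => /(@CZ_cone _ _ _ K C C (lexx C) 0 a j) Z.
have XE : pts 0 (face_rset C C) = CSet (@cone_convexT R d S C).
  apply: cset_ext => p; apply/asboolP/asboolP; rewrite subr0.
    by move/(face_rsetE _ (lexx C)).
  by move=> Cp; apply/(face_rsetE _ (lexx C)).
by rewrite XE in Z.
Qed.

Lemma cone_module_liso (a : 'rV[int]_d) j :
  liso (cohomology (torsion_cobar I a (cone_module C K)) j)
       (cohomology (torsion_cobar I a cone_mono) j).
Proof.
apply: (@torsion_cobar_liso _ _ _ _ I _ _ (@cone_to_mono _ _ _ K C) (@mono_to_cone _ _ _ K C)).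
- exact: cone_to_mono_alin.
- exact: can_alin (@cone_to_mono_alin R d S K C) (@cone_to_monoK _ _ _ _ C)
    (@mono_to_coneK _ _ _ _ C).
- exact: cone_to_mono_gmap.
- exact: mono_to_cone_gmap.
- exact: cone_to_monoK.
- exact: mono_to_coneK.
Qed.
End ConeModule.

(** * Resolution by chains of cones *)

Section ChainCone.
Variables (K : fieldType) (disp : Order.disp_t) (Q : finPOrderType disp).
Implicit Types (m : Q).

Lemma chain_lt q (x : chain Q q) (i j : 'I_q) : (i < j)%N -> (val x i < val x j)%O.
Proof. by move: (valP x) => /forallP/(_ i)/forallP/(_ j)/implyP. Qed.

Lemma chain_faceE q (k : 'I_q.+1) (x : chain Q q.+1) i :
  val (chain_face k x) i = val x (lift k i).
Proof. by rewrite SubK ffunE. Qed.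

Lemma chain_cons_exists q m (x : chain Q q) : (forall i, (m < val x i)%O) ->
  exists y : chain Q q.+1, val y ord0 = m /\ chain_face ord0 y = x.
Proof.
move=> mx; pose f : {ffun 'I_q.+1 -> Q} :=
  [ffun i => if unlift ord0 i is Some j then val x j else m].
have fP : [forall i : 'I_q.+1, forall j : 'I_q.+1, (i < j)%N ==> (f i < f j)%O].
  apply/forallP => i; apply/forallP => j; apply/implyP; rewrite !ffunE.
  case: unliftP => [i'|] ->; case: unliftP => [j'|] -> //= ij.
  by apply: chain_lt; move: ij; rewrite ltnNge leq_bump2 -ltnNge.
exists (Sub f fP); rewrite SubK ffunE unlift_none; split=> //.
by apply: val_inj; apply/ffunP => i; rewrite chain_faceE SubK ffunE liftK.
Qed.

Lemma chain_cons_uniq q (y y' : chain Q q.+1) : val y ord0 = val y' ord0 ->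
  chain_face ord0 y = chain_face ord0 y' -> y = y'.
Proof.
move=> e0 ef; apply: val_inj; apply/ffunP => i; case: (unliftP ord0 i) => [j ->|-> //].
by rewrite -!chain_faceE ef.
Qed.

Lemma chain_face_lift q (k : 'I_q.+1) (x : chain Q q.+2) :
  chain_face ord0 (chain_face (lift ord0 k) x) = chain_face k (chain_face ord0 x).
Proof.
apply: val_inj; apply/ffunP => i; rewrite !chain_faceE; congr (val x _).
by apply: val_inj; rewrite /= /bump /=; lia.
Qed.

(** The value of [f] at [x] with [m] prepended, or 0 if that is no chain: the sum has at most one
    term. *)
Definition cone_homotopy m q (f : {ffun chain Q q.+1 -> K^o}) : {ffun chain Q q -> K^o} :=
  [ffun x => \sum_(y | (chain_face ord0 y == x) && (val y ord0 == m)) f y].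

Lemma cone_homotopyE m q (f : {ffun chain Q q.+1 -> K^o}) (y : chain Q q.+1) :
  val y ord0 = m -> cone_homotopy m f (chain_face ord0 y) = f y.
Proof.
move=> ym; rewrite ffunE (big_pred1 y) // => y'.
apply/andP/eqP => [[/eqP fy /eqP y'm]|->]; last by rewrite ym !eqxx.
by apply: chain_cons_uniq => //; rewrite y'm ym.
Qed.

Lemma cone_homotopy0 m q (f : {ffun chain Q q.+1 -> K^o}) (x : chain Q q) i :
  ~~ (m < val x i)%O -> cone_homotopy m f x = 0.
Proof.
move=> mx; rewrite ffunE big1 // => y /andP[/eqP yx /eqP ym].
by case/negP: mx; rewrite -yx chain_faceE -ym; exact: chain_lt.
Qed.

(** The chains above [m] form a cone with apex [m]. If [x] starts at [m], only its face without [m]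
    counts; otherwise the vanishing of the differential at [x] with [m] prepended is used. *)
Lemma simplicial_diff_cone m q (f : {ffun chain Q q.+1 -> K^o}) (x : chain Q q.+1) :
  (forall i, (m <= val x i)%O) ->
  (forall y : chain Q q.+2, (forall i, (m <= val y i)%O) -> simplicial_diff f y = 0) ->
  simplicial_diff (cone_homotopy m f) x = f x.
Proof.
move=> mx f0; rewrite ffunE; have [x0|x0] := eqVneq (val x ord0) m.
  rewrite (bigD1 ord0) //= expr0 mul1r cone_homotopyE // big1 ?addr0 // => k k0.
  case: q f x mx f0 x0 k k0 => [|q] f x mx f0 x0 k k0.
    by rewrite ord1 eqxx in k0.
  rewrite (@cone_homotopy0 m _ f _ ord0) ?mulr0 //.
  rewrite chain_faceE (_ : lift k ord0 = ord0) ?x0 ?ltxx //.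
  by apply: val_inj; rewrite /= /bump leqNgt lt0n k0.
have [i|y [ym yx]] := @chain_cons_exists _ m x.
  have m0 : (m < val x ord0)%O by rewrite lt_neqAle eq_sym x0 mx.
  case: (unliftP ord0 i) => [j ->|-> //]; apply: lt_trans m0 _.
  exact: chain_lt.
have my i : (m <= val y i)%O.
  case: (unliftP ord0 i) => [j ->|->]; last by rewrite ym.
  by rewrite -chain_faceE yx.
have := f0 y my; rewrite ffunE big_ord_recl expr0 mul1r yx => /eqP.
rewrite addr_eq0 => /eqP ->; rewrite -sumrN.
apply: eq_bigr => k _; rewrite -yx -chain_face_lift cone_homotopyE.
  by rewrite /= /bump leq0n exprD expr1 mulN1r mulNr opprK.
by rewrite chain_faceE -[RHS]ym; congr (val y _); exact: val_inj.
Qed.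

Lemma eq_simplicial_diff q (f g : {ffun chain Q q -> K^o}) (x : chain Q q.+1) :
  (forall k, f (chain_face k x) = g (chain_face k x)) ->
  simplicial_diff f x = simplicial_diff g x.
Proof. by move=> fg; rewrite !ffunE; apply: eq_bigr => k _; rewrite fg. Qed.
End ChainCone.

Section ChainResolution.
Variables (R : realType) (d : nat) (S : fan R d) (K : fieldType).
Local Notation pt := ('rV[int]_d).
Local Notation FP := (face_poset S).
Local Notation Y q := (mono_module K (chain_data S q)).

Definition incidence q (c : chain FP q) (c' : chain FP q.+1) : K :=
  \sum_(k < q.+1) (-1) ^+ k * (chain_face k c' == c)%:R.

Lemma sum_incidence q (f : chain FP q -> K) (c' : chain FP q.+1) :
  \sum_c incidence c c' * f c = simplicial_diff [ffun c => f c : K^o] c'.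
Proof.
rewrite ffunE; under eq_bigr do rewrite /incidence mulr_suml.
rewrite exchange_big; apply: eq_bigr => k _ /=.
rewrite (bigD1 (chain_face k c')) //= eqxx mulr1 big1 ?addr0 ?ffunE // => c.
by rewrite eq_sym => /negbTE ->; rewrite mulr0 mul0r.
Qed.

Definition chain_diff q : Y q -> Y q.+1 :=
  transfer (chain_data S q.+1) 0 (fun c c' _ => incidence c c').

Lemma lcoef_chain_diff q (x : Y q) c p : lcoef c p (chain_diff x) =
  if support_point S p && in_chain c p then
    simplicial_diff [ffun c => lcoef c p x : K^o] c else 0.
Proof.
rewrite lcoef_transfer /= subr0; case: ifP => // _.
exact: (sum_incidence (fun c => lcoef c p x)).
Qed.

Lemma in_chain_face q (k : 'I_q.+1) (c : chain FP q.+1) p :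
  in_chain c p -> in_chain (chain_face k c) p.
Proof. by move=> /forallP cp; apply/forallP => i; rewrite chain_faceE. Qed.

Lemma chain_diff_gmap q : gmap 0 (@chain_diff q).
Proof. exact: transfer_gmap. Qed.

Lemma chain_diff_alin q : alin (@chain_diff q).
Proof.
apply: transfer_alin => s c c' p sS /= /andP[pS cp]; rewrite addr0.
have [-> |] := eqVneq (incidence c c') 0; first by rewrite !if_same.
move=> nz; have sub t : in_chain c' t -> in_chain c t.
  apply: contraTT => ct; have : incidence c c' != 0 by [].
  apply: contraNN => c't; rewrite /incidence big1 // => k _.
  have [ck|_] := eqVneq (chain_face k c') c; last by rewrite mulr0.
  by case/negP: ct; rewrite -ck in_chain_face.
congr (if _ then _ else _); rewrite pS /=.
have [sp|] := boolP (in_common_cone S s p); last by rewrite andbF.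
rewrite addrC (in_common_coneD sp) (in_chainD c' sp) /=.
have [c's|] := boolP (in_chain c' s); last by rewrite !andbF.
by rewrite (sub _ c's) andbT.
Qed.

Lemma chain_diffK q (x : Y q) : chain_diff (chain_diff x) = 0.
Proof.
apply: lcoef_inj => c p; rewrite lcoef_chain_diff lcoef0; case: ifP => // /andP[pS cp].
rewrite -[RHS](_ : simplicial_diff (simplicial_diff [ffun c => lcoef c p x : K^o]) c = 0).
  apply: eq_simplicial_diff => k; rewrite ffunE lcoef_chain_diff pS /=.
  by rewrite in_chain_face.
by rewrite simplicial_diffK ffunE.
Qed.

(** The cone with [p] in its interior, the least one containing [p]; the zero cone is the default
    off the support. *)
Definition carrier (p : pt) : FP := xget (sval (cid (zero_cone S))) [set C | cint C (real_point R p)].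

Lemma carrierP p : support_point S p -> cint (carrier p) (real_point R p).
Proof.
move=> /asboolP[C CS Cp]; have [D _ Dp] := cint_exists (Cp : val ([` CS]%fset : FP) _).
exact: (xgetPex _ (ex_intro (fun E => [set C | cint C (real_point R p)] E) D Dp)).
Qed.

Lemma in_chain_carrier q (c : chain FP q) p : support_point S p ->
  in_chain c p = [forall i, (carrier p <= val c i)%O].
Proof.
move=> /carrierP pC; apply: eq_forallb => i; apply/asboolP/idP.
  exact: cint_le pC.
by move=> /cone_leP H; apply: H; exact: cint_sub pC.
Qed.

(** In degree [p] only chains above the carrier of [p] occur, so the contraction with that apex
    applies. The matrix [eta] is this contraction, with an apex that varies with the degree. *)
Lemma chain_diff_exact q (z : Y q.+1) : chain_diff z = 0 -> exists y, z = chain_diff y.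
Proof.
move=> dz; pose eta (c' : chain FP q.+1) (c : chain FP q) (p : pt) : K :=
  ((chain_face ord0 c' == c) && (val c' ord0 == carrier p))%:R.
exists (transfer (chain_data S q) 0 eta z); apply: lcoef_inj => c' p.
have [/andP[pS cp]|out] := boolP (mono_pt (chain_data S q.+1) c' p); last by rewrite !lcoef_out.
rewrite lcoef_chain_diff pS cp /=.
pose f : {ffun chain FP q.+1 -> K^o} := [ffun c => lcoef c p z].
have E : simplicial_diff (cone_homotopy (carrier p) f) c' = f c'.
  apply: simplicial_diff_cone => [i|y yp].
    by move: cp; rewrite in_chain_carrier // => /forallP.
  have := lcoef_chain_diff z y p; rewrite dz lcoef0 pS.
  by rewrite in_chain_carrier // (introT forallP yp).
transitivity (f c'); first by rewrite ffunE.
rewrite -E; apply: eq_simplicial_diff => k.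
rewrite [RHS]ffunE lcoef_transfer /= subr0 pS in_chain_face //=.
rewrite ffunE big_mkcond; apply: eq_bigr => c _; rewrite /eta ffunE.
by case: ifP => _; rewrite ?mul1r ?mul0r.
Qed.

Lemma chain_diff_inj (x : Y 0) : chain_diff x = 0 -> x = 0.
Proof.
move=> dx; apply: lcoef_inj => c p; rewrite lcoef0.
have [/andP[pS cp]|out] := boolP (mono_pt (chain_data S 0) c p); last by rewrite lcoef_out.
have [//|c' [c'0 c'c]] := @chain_cons_exists _ _ 0 (carrier p) c; first by case.
have := lcoef_chain_diff x c' p; rewrite dx lcoef0 pS in_chain_carrier //.
rewrite (introT forallP) => [|i]; last by rewrite ord1 c'0.
by rewrite ffunE big_ord1 expr0 mul1r c'c ffunE.
Qed.

End ChainResolution.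

(** * Summands of the resolution indexed by chains *)

Section Labels.
Variables (R : realType) (d : nat) (S : fan R d) (K : fieldType).
Local Notation pt := ('rV[int]_d).
Local Notation FP := (face_poset S).
Local Notation Y q := (mono_module K (chain_data S q)).
Local Notation CM C := (cone_mono K C).
Implicit Types (C : FP).

Lemma chain_head q (c : chain FP q.+1) i : (val c ord0 <= val c i)%O.
Proof.
by case: (unliftP ord0 i) => [j ->|-> //]; apply: ltW; exact: chain_lt.
Qed.

Lemma in_cone_le (C D : FP) p : (C <= D)%O -> in_cone C p -> in_cone D p.
Proof. by move=> /cone_leP CD /asboolP Cp; apply/asboolP; exact: CD. Qed.

Lemma in_chain_head q (c : chain FP q.+1) p : in_chain c p = in_cone (val c ord0) p.
Proof.
apply/forallP/idP => [|cp i]; first exact.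
exact: in_cone_le (chain_head c i) cp.
Qed.

(** For a nonempty chain [c] with head above [C], the projection to the summand of [c], the ring of
    its head, followed by restriction to [C]. *)
Definition label_proj C q (c : chain FP q) : Y q -> CM C :=
  transfer (cone_data (@cone_convexT R d S C)) 0 (fun c1 _ _ => (c1 == c)%:R).

Definition label_incl C q (c : chain FP q) : CM C -> Y q :=
  transfer (chain_data S q) 0 (fun _ c1 _ => (c1 == c)%:R).

Lemma lcoef_label_proj C q (c : chain FP q) x l p :
  lcoef l p (label_proj C c x) = if in_cone C p then lcoef c p x else 0.
Proof.
rewrite lcoef_transfer /= subr0; case: ifP => // _.
by rewrite (bigD1 c) //= eqxx mul1r big1 ?addr0 // => c1 /negbTE ->; rewrite mul0r.
Qed.

Lemma lcoef_label_incl C q (c c1 : chain FP q) x p :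
  lcoef c1 p (label_incl c (x : CM C)) =
  if support_point S p && in_chain c1 p && (c1 == c) then lcoef tt p x else 0.
Proof.
rewrite lcoef_transfer /= subr0; case: ifP => //= _.
rewrite (bigD1 tt) //= big1 ?addr0 => [|[]] //.
by case: (c1 == c); rewrite ?mul1r ?mul0r.
Qed.

Lemma label_proj_gmap C q (c : chain FP q) : gmap 0 (label_proj C c).
Proof. exact: transfer_gmap. Qed.

Lemma label_incl_gmap C q (c : chain FP q) : gmap 0 (@label_incl C q c).
Proof. exact: transfer_gmap. Qed.

Lemma label_proj_alin C q (c : chain FP q.+1) : (C <= val c ord0)%O ->
  alin (label_proj C c).
Proof.
move=> Cc; apply: transfer_alin => s c1 [] p sS /= /andP[pS]; rewrite addr0 in_chain_head.
have [->|_ _] := eqVneq c1 c; last by rewrite !if_same.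
move=> cp; congr (if _ then _ else _); rewrite in_chain_head.
have [cs|cs] := boolP (in_cone (val c ord0) s); last first.
  rewrite andbF /=; apply: contraNF cs => /andP[_ /andP[Cs _]].
  exact: in_cone_le Cs.
have sp := in_common_coneP cs cp; rewrite sp /=.
by rewrite [p + s]addrC (in_cone_add C sp); case: (in_cone C p); rewrite ?andbT ?andbF ?andbb.
Qed.

Lemma label_incl_alin q (c : chain FP q.+1) : alin (@label_incl (val c ord0) q.+1 c).
Proof.
apply: transfer_alin => s [] c1 p sS /= cp; rewrite addr0.
have [->|_] := eqVneq c1 c; last by rewrite !if_same.
congr (if _ then _ else _); rewrite !in_chain_head cp (in_cone_support cp) /=.
have [cs|cs] := boolP (in_cone (val c ord0) s); last by rewrite andbF.
have sp := in_common_coneP cs cp; rewrite sp /=.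
by rewrite in_cone_addL //= (in_cone_support (in_cone_addL cp cs)).
Qed.

Lemma label_projK C q (c : chain FP q.+1) x : C = val c ord0 ->
  label_proj C c (label_incl c x) = x.
Proof.
move=> Cc; apply: lcoef_inj => -[] p; rewrite lcoef_label_proj lcoef_label_incl eqxx andbT.
rewrite in_chain_head -Cc; case: ifP => [Cp|/negbT Cp]; last by rewrite lcoef_out.
by rewrite Cp (in_cone_support Cp).
Qed.

Lemma label_proj0 C q (c c1 : chain FP q) (x : CM C) : c != c1 ->
  label_proj C c (label_incl c1 x) = 0.
Proof.
move=> cc1; apply: lcoef_inj => l p.
by rewrite lcoef_label_proj lcoef_label_incl lcoef0 (negbTE cc1) andbF if_same.
Qed.

Lemma label_incl_proj C q (c : chain FP q.+1) x : (C <= val c ord0)%O ->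
  label_proj C c (label_incl c (label_proj (val c ord0) c x)) = label_proj C c x.
Proof.
move=> Cc; apply: lcoef_inj => -[] p; rewrite !lcoef_label_proj; case: ifP => // Cp.
have cp := in_cone_le Cc Cp.
by rewrite lcoef_label_incl eqxx in_chain_head cp (in_cone_support cp) lcoef_label_proj cp.
Qed.

Lemma label_sum q (x : Y q.+1) :
  \sum_c label_incl c (label_proj (val c ord0) c x) = x.
Proof.
apply: lcoef_inj => c p; rewrite lcoef_sum (bigD1 c) //= big1 ?addr0; last first.
  by move=> c1 cc1; rewrite lcoef_label_incl eq_sym (negbTE cc1) andbF.
have [/andP[pS cp]|cp] := boolP (mono_pt (chain_data S q.+1) c p); last by rewrite !lcoef_out.
by rewrite lcoef_label_incl eqxx pS cp /= lcoef_label_proj -in_chain_head cp.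
Qed.

Variable (C0 : FP).
Local Notation OI := (open_interval C0).

Lemma cone_label_exists q (c : chain OI q) : exists y : chain FP q.+1,
  val y ord0 = C0 /\ forall i, val y (lift ord0 i) = val (val c i).
Proof.
pose f : {ffun 'I_q -> FP} := [ffun i => val (val c i)].
have fP : [forall i : 'I_q, forall j : 'I_q, (i < j)%N ==> (f i < f j)%O].
  apply/forallP => i; apply/forallP => j; apply/implyP => ij; rewrite !ffunE.
  exact: (chain_lt c ij).
have [i|y [y0 yf]] := @chain_cons_exists _ _ q C0 (Sub f fP).
  by rewrite SubK ffunE; exact: (valP (val c i)).
by exists y; split=> // i; rewrite -chain_faceE yf SubK ffunE.
Qed.

(** The chain [c] with [C0] prepended; by [cone_label_surj] every chain with head [C0] arises. *)
Definition cone_label q (c : chain OI q) : chain FP q.+1 := sval (cid (cone_label_exists c)).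

Lemma cone_label_head q (c : chain OI q) : val (cone_label c) ord0 = C0.
Proof. by rewrite /cone_label; case: cid => y []. Qed.

Lemma cone_label_tail q (c : chain OI q) i :
  val (cone_label c) (lift ord0 i) = val (val c i).
Proof. by rewrite /cone_label; case: cid => y []. Qed.

Lemma cone_label_inj q : injective (@cone_label q).
Proof.
move=> c c' cc'; apply: val_inj; apply/ffunP => i; apply: val_inj.
by rewrite /= -!cone_label_tail cc'.
Qed.

Lemma cone_label_surj q (y : chain FP q.+1) : val y ord0 = C0 ->
  exists c, cone_label c = y.
Proof.
move=> y0; have yC i : (C0 < val y (lift ord0 i))%O by rewrite -y0; exact: chain_lt.
pose f : {ffun 'I_q -> OI} := [ffun i => (exist (fun D : FP => is_true (C0 < D)%O) _ (yC i) : OI)].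
have fP : [forall i : 'I_q, forall j : 'I_q, (i < j)%N ==> (f i < f j)%O].
  apply/forallP => i; apply/forallP => j; apply/implyP => ij; rewrite !ffunE.
  by apply: (@chain_lt _ _ _ y); rewrite /= ltnNge leq_bump2 -ltnNge.
exists (Sub f fP); apply: chain_cons_uniq; first by rewrite cone_label_head.
apply: val_inj; apply/ffunP => i.
by rewrite !chain_faceE cone_label_tail SubK ffunE.
Qed.

Lemma cone_label_face q (k : 'I_q.+1) (c : chain OI q.+1) :
  chain_face (lift ord0 k) (cone_label c) = cone_label (chain_face k c).
Proof.
apply: chain_cons_uniq.
  rewrite chain_faceE cone_label_head -(cone_label_head c).
  by apply: (congr1 (fun i => val (cone_label c) i)); exact: val_inj.
rewrite chain_face_lift; apply: val_inj; apply/ffunP => i.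
by rewrite !chain_faceE !cone_label_tail chain_faceE.
Qed.
End Labels.

(** * Tensor products and cochains with values *)

Section TensorLift.
Variables (K : fieldType) (U V : lmodType K).

Definition pure (u : U) (v : V) : tensor U V :=
  quotient_pi (subspace_span (@tensor_relation K U V)) << (u, v) >>.

Lemma quotient_pi_lin (X : lmodType K) (W : subspace X) k x y :
  quotient_pi W (k *: x + y) = k *: quotient_pi W x + quotient_pi W y.
Proof. by rewrite quotient_piD -quotient_piZ. Qed.

Lemma pure_linl k u u' v : pure (k *: u + u') v = k *: pure u v + pure u' v.
Proof.
rewrite /pure -quotient_pi_lin; apply/quotient_piP => W relW.
have r1 := relW _ (TensorDl (k *: u) u' v); have r2 := relW _ (TensorZl k u v).
rewrite opprD addrA addrAC -[X in W X](_ : (<< (k *: u + u', v) >> - << (k *: u, v) >> - << (u', v) >>)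
  + (<< (k *: u, v) >> - k *: << (u, v) >>) = _); first exact: subspaceD.
by rewrite [X in X + _]addrAC addrA subrK addrAC.
Qed.

Lemma pure_linr k u v v' : pure u (k *: v + v') = k *: pure u v + pure u v'.
Proof.
rewrite /pure -quotient_pi_lin; apply/quotient_piP => W relW.
have r1 := relW _ (TensorDr u (k *: v) v'); have r2 := relW _ (TensorZr k u v).
rewrite opprD addrA addrAC -[X in W X](_ : (<< (u, k *: v + v') >> - << (u, k *: v) >> - << (u, v') >>)
  + (<< (u, k *: v) >> - k *: << (u, v) >>) = _); first exact: subspaceD.
by rewrite [X in X + _]addrAC addrA subrK addrAC.
Qed.

Lemma tensor_ind (P : tensor U V -> Prop) : P 0 ->
  (forall k x y, P x -> P y -> P (k *: x + y)) -> (forall u v, P (pure u v)) ->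
  forall x, P x.
Proof.
move=> P0 PD Pu x; rewrite -[x]quotient_reprK.
elim/malg_basis_ind: (quotient_repr x) => [|k f g Pf Pg|[u v]].
- have E := quotient_piD (subspace_span (@tensor_relation K U V)) 0 0.
  by rewrite addr0 in E; rewrite (canRL (addrK _) (esym E)) subrr.
- by rewrite quotient_pi_lin; exact: PD.
- exact: Pu.
Qed.

Lemma tensor_lift (X : lmodType K) (beta : U -> V -> X) :
  (forall k u u' v, beta (k *: u + u') v = k *: beta u v + beta u' v) ->
  (forall k u v v', beta u (k *: v + v') = k *: beta u v + beta u v') ->
  exists2 T : tensor U V -> X, forall k x y, T (k *: x + y) = k *: T x + T y &
    forall u v, T (pure u v) = beta u v.
Proof.
move=> bl br; pose L (f : {malg K[(U * V)%type]}) := linear_ext (fun uv => beta uv.1 uv.2) f.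
have LP k f g : L (k *: f + g) = k *: L f + L g by exact: linearP.
have LB f g : L (f - g) = L f - L g by exact: raddfB.
have LZ k f : L (k *: f) = k *: L f by exact: linearZ.
have LU u v : L << (u, v) >> = beta u v by exact: linear_extU.
have b0l v : beta 0 v = 0 by have := bl (-1) 0 0 v; rewrite !scaleN1r !addNr.
have b0r u : beta u 0 = 0 by have := br (-1) u 0 0; rewrite !scaleN1r !addNr.
have L0 : L 0 = 0 by exact: raddf0.
have ker0D f g : L f = 0 -> L g = 0 -> L (f + g) = 0.
  by move=> Lf Lg; rewrite -[f]scale1r LP Lf Lg scaler0 addr0.
have ker0Z k f : L f = 0 -> L (k *: f) = 0 by move=> Lf; rewrite LZ Lf scaler0.
(* The span of the relations is tested on the kernel of [L], a subspace containing them by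
   bilinearity of [beta]. *)
pose ker := @Subspace _ _ (fun f => L f = 0) L0 ker0D ker0Z.
have kerP f g : quotient_pi (subspace_span (@tensor_relation K U V)) f = quotient_pi _ g -> L f = L g.
  move=> /quotient_piP /(_ ker) H; apply/eqP; rewrite -subr_eq0 -LB; apply/eqP; apply: H.
  move=> _ [u1 u2 v|u v1 v2|k u v|k u v] /=; rewrite !(LB, LZ, LU).
  - by have := bl 1 u1 u2 v; rewrite !scale1r => ->; rewrite addrAC addrK subrr.
  - by have := br 1 u v1 v2; rewrite !scale1r => ->; rewrite addrAC addrK subrr.
  - by have := bl k u 0 v; rewrite b0l !addr0 => ->; rewrite subrr.
  - by have := br k u v 0; rewrite b0r !addr0 => ->; rewrite subrr.
exists (fun x => L (quotient_repr x)) => [k x y|u v].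
  rewrite -LP; apply: kerP; rewrite quotient_reprK quotient_pi_lin.
  by rewrite !quotient_reprK.
by rewrite -LU; apply: kerP; rewrite quotient_reprK.
Qed.
End TensorLift.

Section Extension.
Variables (K : fieldType) (V : lmodType K).
Implicit Types I J : finType.
Local Notation "C( I )" := {ffun I -> K^o} (at level 2, format "C( I )").

Definition lin (U U' : lmodType K) (T : U -> U') :=
  forall k x y, T (k *: x + y) = k *: T x + T y.

Lemma lin0 (U U' : lmodType K) (T : U -> U') : lin T -> T 0 = 0.
Proof. by move=> lT; have := lT (-1) 0 0; rewrite !scaleN1r !addNr. Qed.

Lemma lin_sum (U U' : lmodType K) (T : U -> U') (J : Type) (r : seq J) (k : J -> K) (x : J -> U) :
  lin T -> T (\sum_(j <- r) k j *: x j) = \sum_(j <- r) k j *: T (x j).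
Proof.
move=> lT; elim: r => [|j r IHr]; first by rewrite !big_nil lin0.
by rewrite !big_cons lT IHr.
Qed.

Definition delta_ffun I (i : I) : C(I) := [ffun j => (j == i)%:R].

Lemma ffun_delta I (g : C(I)) : g = \sum_i g i *: delta_ffun i.
Proof.
apply/ffunP => i; rewrite sum_ffunE (bigD1 i) //= !ffunE eqxx.
rewrite -[_ *: _]/(_ * _) mulr1 big1 ?addr0 // => k.
by rewrite !ffunE eq_sym => /negbTE ->; exact: mulr0.
Qed.

Lemma lin_ffunE I J (T : C(I) -> C(J)) : lin T ->
  forall g j, T g j = \sum_i T (delta_ffun i) j * g i.
Proof.
move=> lT g j.
rewrite {1}[g]ffun_delta.
have -> : T (\sum_i g i *: delta_ffun i) = \sum_i g i *: T (delta_ffun i).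
  exact: lin_sum.
by rewrite sum_ffunE; apply: eq_bigr => i _; rewrite ffunE; exact: mulrC.
Qed.

(** [T] applied to functions with values in [V] through its matrix: extension of scalars without a
    tensor product. *)
Definition ext I J (T : C(I) -> C(J)) (f : {ffun I -> V}) : {ffun J -> V} :=
  [ffun j => \sum_i T (delta_ffun i) j *: f i].

Lemma ext_lin I J (T : C(I) -> C(J)) k f g : ext T (k *: f + g) = k *: ext T f + ext T g.
Proof.
apply/ffunP => j; rewrite !ffunE scaler_sumr -big_split; apply: eq_bigr => i _ /=.
by rewrite !ffunE scalerDr !scalerA mulrC.
Qed.

Lemma ext_comp I J (L : finType) (T : C(I) -> C(J)) (T' : C(J) -> C(L)) f : lin T' ->
  ext (T' \o T) f = ext T' (ext T f).
Proof.
move=> lT'; apply/ffunP => l; rewrite !ffunE.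
under [RHS]eq_bigr do rewrite ffunE scaler_sumr.
rewrite exchange_big; apply: eq_bigr => i _ /=; rewrite (lin_ffunE lT') scaler_suml.
by apply: eq_bigr => j _; rewrite scalerA.
Qed.

Lemma ext_add I J (T T' : C(I) -> C(J)) f :
  ext (fun x => T x + T' x) f = ext T f + ext T' f.
Proof.
apply/ffunP => j; rewrite !ffunE -big_split; apply: eq_bigr => i _ /=.
by rewrite ffunE scalerDl.
Qed.

Lemma eq_ext I J (T T' : C(I) -> C(J)) f : T =1 T' -> ext T f = ext T' f.
Proof. by move=> TT; apply/ffunP => j; rewrite !ffunE; apply: eq_bigr => i _; rewrite TT. Qed.

Lemma ext_id I (f : {ffun I -> V}) : ext id f = f.
Proof.
apply/ffunP => j; rewrite ffunE (bigD1 j) //= ffunE eqxx scale1r big1 ?addr0 // => i.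
by rewrite ffunE eq_sym => /negbTE ->; rewrite scale0r.
Qed.

Lemma ext0 I J (T : C(I) -> C(J)) f : (forall x, T x = 0) -> ext T f = 0.
Proof.
by move=> T0; apply/ffunP => j; rewrite !ffunE big1 // => i _; rewrite T0 ffunE scale0r.
Qed.

Lemma ext_pure I J (T : C(I) -> C(J)) (g : C(I)) v : lin T ->
  ext T [ffun i => g i *: v] = [ffun j => T g j *: v].
Proof.
move=> lT; apply/ffunP => j; rewrite !ffunE (lin_ffunE lT) scaler_suml.
by apply: eq_bigr => i _; rewrite ffunE scalerA.
Qed.

Lemma lin_pseudo_inverse I J (T : C(I) -> C(J)) : lin T ->
  exists2 s : C(J) -> C(I), lin s & forall x, T (s (T x)) = T x.
Proof.
move=> lT; pose T' : {linear C(I) -> C(J)} := HB.pack T (GRing.isLinear.Build K _ _ _ T lT).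
exists (fun y => (linfun T')^-1%VF y) => [k x y|x]; first exact: linearP.
have := @limg_lfunVK _ _ _ (linfun T') (T' x); rewrite !lfunE /=; apply.
by rewrite -[T x]/(T' x) -lfunE; exact: memv_img (memvf _).
Qed.
End Extension.

Lemma pure_suml (K : fieldType) (U V : lmodType K) (J : Type) (r : seq J) (k : J -> K) (u : J -> U) (v : V) :
  pure (\sum_(j <- r) k j *: u j) v = \sum_(j <- r) k j *: pure (u j) v.
Proof.
exact: (@lin_sum K U (tensor U V) (fun u => pure u v) J r k u (fun k x y => pure_linl k x y v)).
Qed.

Lemma pure_sumr (K : fieldType) (U V : lmodType K) (J : Type) (r : seq J) (k : J -> K) (u : U) (v : J -> V) :
  pure u (\sum_(j <- r) k j *: v j) = \sum_(j <- r) k j *: pure u (v j).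
Proof.
exact: (@lin_sum K V (tensor U V) (fun v => pure u v) J r k v (fun k x y => pure_linr k u x y)).
Qed.

Lemma pureZr (K : fieldType) (U V : lmodType K) (k : K) (u : U) (v : V) :
  pure u (k *: v) = k *: pure u v.
Proof. by have := pure_sumr [:: tt] (fun=> k) u (fun=> v); rewrite !big_seq1. Qed.

Lemma coh_class_sum (K : fieldType) (C : cochain_complex K) n (J : Type) (r : seq J) (x : J -> C n) :
  (forall j, differential C n (x j) = 0) ->
  coh_class (\sum_(j <- r) x j) = \sum_(j <- r) coh_class (x j).
Proof.
move=> dx; elim: r => [|j r IHr]; first by rewrite !big_nil coh_class0.
rewrite !big_cons -IHr -[x j]scale1r coh_class_lin ?scale1r //.
by rewrite raddf_sum big1 // => i _; exact: dx.
Qed.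

(** * Universal coefficients over a field *)

Section ValuedCochains.
Variables (K : fieldType) (disp : Order.disp_t) (Q : finPOrderType disp).
Local Notation C n := {ffun chain Q n -> K^o}.
Local Notation d := (@simplicial_diff K disp Q _).

Lemma simplicial_diff_lin n : lin (@simplicial_diff K disp Q n).
Proof. exact: simplicial_diff_linear. Qed.

Lemma lin_sub_comp (U U' : lmodType K) (f : U' -> U) (g : U -> U') :
  lin f -> lin g -> lin (fun x => x - f (g x)).
Proof.
move=> lf lg k x y; rewrite lg lf scalerBr opprD addrACA.
by [].
Qed.

Lemma lin_comp (U U' U'' : lmodType K) (f : U' -> U'') (g : U -> U') :
  lin f -> lin g -> lin (fun x => f (g x)).
Proof. by move=> lf lg k x y; rewrite lg lf. Qed.

Lemma linB (U U' : lmodType K) (f : U -> U') x y : lin f -> f (x - y) = f x - f y.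
Proof. by move=> lf; rewrite -scaleN1r addrC lf scaleN1r addrC. Qed.

Section Values.
Variable V : lmodType K.

Definition valued_diff n (f : {ffun chain Q n -> V}) : {ffun chain Q n.+1 -> V} :=
  ext (@simplicial_diff K disp Q n) f.

Fact valued_diff_linear n : linear (@valued_diff n).
Proof. exact: ext_lin. Qed.
HB.instance Definition _ n := GRing.isLinear.Build K _ _ _ (@valued_diff n)
  (@valued_diff_linear n).

Fact valued_diffK n f : @valued_diff n.+1 (@valued_diff n f) = 0.
Proof.
rewrite /valued_diff -ext_comp; last exact: simplicial_diff_lin.
by apply: ext0 => x; exact: simplicial_diffK.
Qed.

Definition valued_complex : cochain_complex K :=
  {| cochain := fun n => {ffun chain Q n -> V};
     differential := fun n => @valued_diff n;
     differentialK := valued_diffK |}.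

Lemma valued_diffE n (f : {ffun chain Q n -> V}) x :
  valued_diff f x = \sum_(k < n.+1) (-1) ^+ k *: f (chain_face k x).
Proof.
rewrite ffunE; under eq_bigr do rewrite ffunE scaler_suml.
rewrite exchange_big; apply: eq_bigr => k _ /=.
rewrite (bigD1 (chain_face k x)) //= ffunE eqxx mulr1 big1 ?addr0 // => c.
by rewrite ffunE eq_sym => /negbTE ->; rewrite mulr0 scale0r.
Qed.
End Values.

Local Notation OC := (order_complex K Q).

(* A projection of the cochains onto representatives of the cohomology,
   homotopic to the identity by K-linear maps, hence also after extending
   scalars to V. *)
Lemma harmonic r : exists h : C r -> C r,
  [/\ lin h, forall x, d (h x) = 0, forall x : OC r, is_coboundary x -> h x = 0 &
      forall (V : lmodType K) (f : valued_complex V r), differential (valued_complex V) r f = 0 ->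
        is_coboundary (f - ext h f : valued_complex V r)].
Proof.
have ld n := @simplicial_diff_lin n.
have [s ls ds] := lin_pseudo_inverse (ld r).
(* [u] projects onto the cocycles; in positive degree a second correction by coboundaries makes them
   map to 0. *)
pose u x := x - s (d x); have lu : lin u by exact: lin_sub_comp.
have du x : d (u x) = 0 by rewrite /u (linB _ _ (ld r)) ds subrr.
have ext_sd (V : lmodType K) (f : valued_complex V r) :
    differential (valued_complex V) r f = 0 -> ext (s \o d) f = 0.
  move=> df; have df' : ext d f = 0 by exact: df.
  by rewrite ext_comp // df'; apply/ffunP => c; rewrite !ffunE big1 // => i _; rewrite ffunE scaler0.
case: r s ls ds @u lu du ext_sd => [|r] s ls ds u lu du ext_sd.
  exists u; split=> // [x ->|V f df]; first exact: lin0 lu.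
  rewrite /= -{1}[f]ext_id (@eq_ext _ _ _ _ _ (fun x => u x + (s \o d) x)).
    by rewrite ext_add ext_sd // addr0 subrr.
  by move=> x /=; rewrite /u subrK.
have [s' ls' ds'] := lin_pseudo_inverse (ld r).
pose h x := u x - d (s' (u x)).
have lh : lin h.
  by apply: (lin_comp (f := fun x => x - d (s' x))) lu; exact: lin_sub_comp.
exists h; split=> // [x|x [y ->]|V f df].
- by rewrite /h (linB _ _ (ld _)) du simplicial_diffK subrr.
- rewrite /= /h /u simplicial_diffK (lin0 ls) subr0 ds'.
  exact: subrr.
exists (ext (s' \o u) f); rewrite /= /valued_diff -ext_comp //.
apply/eqP; rewrite subr_eq -ext_add; apply/eqP.
rewrite -{1}[f]ext_id (@eq_ext _ _ _ _ _ (fun x => (d \o (s' \o u)) x + h x + (s \o d) x)).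
  by rewrite ext_add ext_sd // addr0.
by move=> x /=; rewrite /h [X in X + _]addrC subrK /u subrK.
Qed.

Lemma pure0l (U V : lmodType K) (v : V) : pure (0 : U) v = 0.
Proof.
exact: (@lin0 K U (tensor U V) (fun u => pure u v) (fun k x y => pure_linl k x y v)).
Qed.

(** A description uniform in [r], degree 0 included, which reduces the vanishing of [Psi] on
    coboundaries to [h] killing the values of [A]. *)
Lemma coboundary_ext (V : lmodType K) r (f : valued_complex V r) : is_coboundary f ->
  exists n (A : C n -> C r) (y : {ffun chain Q n -> V}), f = ext A y /\
    forall b, is_coboundary (A b : OC r).
Proof.
case: r f => [|r] f /=.
  move=> ->; exists 0%N, (fun=> 0), 0; split=> //.
  by apply/esym/ext0.
by move=> [y ->]; exists r, d, y; split=> // b; exists b.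
Qed.

(** [T] sends the tensor of [u] and [v] to the class of [z u] times [v]; [Psi] sends a cochain to
    the sum over chains [c] of the class of [h] of the indicator of [c], tensored with the value at
    [c]. The properties of [h] make them inverse on cohomology. *)
Theorem tensor_cohomology (V : lmodType K) r :
  liso (cohomology (valued_complex V) r) (tensor (cohomology OC r) V).
Proof.
have [h [lh dh hb hf]] := harmonic r.
pose cl (g : C r) : cohomology OC r := coh_class (h g : OC r).
have cl_lin : lin cl by move=> k x y; rewrite /cl lh; apply: coh_class_lin; exact: dh.
have hK (g : C r) : d g = 0 -> is_coboundary (g - h g : OC r).
  have extE n m (T : C n -> C m) (x : C n) : lin T -> ext (V := K^o) T x = T x.
    by move=> lT; apply/ffunP => c; rewrite ffunE (lin_ffunE lT).
  move=> dg; have := hf K^o g; rewrite extE // => /(_ (etrans (extE _ _ _ _ (@simplicial_diff_lin r)) dg)).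
  case: (r) (g - h g) => [|r'] y //= [x ->]; exists x.
  exact: extE (@simplicial_diff_lin r').
pose rep u : C r := sval (cid2 (@coh_class_surj K OC r u)).
have [repd repE] : (forall u, d (rep u) = 0) /\ (forall u, coh_class (rep u : OC r) = u).
  by split=> u; rewrite /rep; case: cid2.
(* [rep] is an arbitrary choice, but [h] kills coboundaries, so [z] is linear. *)
pose z u := h (rep u).
have h_eq (x y : C r) : d x = 0 -> d y = 0 -> coh_class (x : OC r) = coh_class (y : OC r) -> h x = h y.
  move=> dx dy /(coh_class_eq (C := OC) (n := r) dx dy) /hb; rewrite (linB _ _ lh) => /eqP.
  by rewrite subr_eq0 => /eqP.
have ld n := @simplicial_diff_lin n.
have z_lin : lin z.
  move=> k u u'; rewrite /z -lh; apply: h_eq; rewrite ?ld ?repd ?scaler0 ?addr0 //.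
  by rewrite repE (@coh_class_lin K OC r k) ?repE //; exact: repd.
have zE u : cl u = coh_class (h u : OC r) by [].
have clE (x : C r) : d x = 0 -> cl x = coh_class (x : OC r).
  move=> dx; apply/esym/(coh_class_eq (C := OC) (n := r) dx (dh x)); exact: hK.
have dpure (g : C r) (v : V) : d g = 0 -> valued_diff [ffun c => g c *: v] = 0.
  by move=> dg; rewrite /valued_diff ext_pure // dg; apply/ffunP => c; rewrite !ffunE scale0r.
pose W := valued_complex V.
pose beta u v : cohomology W r := coh_class ([ffun c => z u c *: v] : W r).
have dz u : d (z u) = 0 by exact: dh.
have [|| T T_lin TE] := @tensor_lift K (cohomology OC r) V (cohomology W r) beta.
- move=> k u u' v; rewrite /beta -coh_class_lin; try exact: dpure.
  by congr coh_class; apply/ffunP => c; rewrite !ffunE z_lin !ffunE scalerDl scalerA.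
- move=> k u v v'; rewrite /beta -coh_class_lin; try exact: dpure.
  by congr coh_class; apply/ffunP => c; rewrite !ffunE scalerDr !scalerA mulrC.
pose Psi (f : W r) : tensor (cohomology OC r) V := \sum_c pure (cl (delta_ffun K c)) (f c).
have Psi_lin : lin Psi.
  move=> k f g; rewrite /Psi scaler_sumr -big_split; apply: eq_bigr => c _ /=.
  by rewrite !ffunE pure_linr.
have Psi_ext n (A : C n -> C r) (y : {ffun chain Q n -> V}) :
    Psi (ext A y) = \sum_b pure (cl (A (delta_ffun K b))) (y b).
  rewrite /Psi; transitivity (\sum_c \sum_b (A (delta_ffun K b) c) *: pure (cl (delta_ffun K c)) (y b)).
    apply: eq_bigr => c _; rewrite ffunE.
    exact: pure_sumr.
  rewrite exchange_big; apply: eq_bigr => b _ /=.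
  rewrite [in RHS](ffun_delta (A _)) (lin_sum _ _ _ cl_lin).
  exact/esym/pure_suml.
have Psi_pure (g : C r) v : Psi [ffun c => g c *: v] = pure (cl g) v.
  rewrite [in RHS](ffun_delta g) (lin_sum _ _ _ cl_lin).
  rewrite pure_suml.
  apply: eq_bigr => c _; rewrite ffunE.
  exact: pureZr.
have Psi_cob (f : W r) : is_coboundary f -> Psi f = 0.
  move=> /coboundary_ext[n [A [y [-> Ab]]]]; rewrite Psi_ext big1 // => b _.
  by rewrite /cl hb // (_ : coh_class _ = 0) ?pure0l //; exact: coh_class0.
pose repW w : W r := sval (cid2 (@coh_class_surj K W r w)).
have [repWd repWE] : (forall w, differential W r (repW w) = 0) /\ (forall w, coh_class (repW w) = w).
  by split=> w; rewrite /repW; case: cid2.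
have Psi_eq (f g : W r) : differential W r f = 0 -> differential W r g = 0 ->
    coh_class f = coh_class g -> Psi f = Psi g.
  move=> df dg /(coh_class_eq df dg) /Psi_cob; rewrite (linB _ _ Psi_lin) => /eqP.
  by rewrite subr_eq0 => /eqP.
have T_Psi (f : W r) : differential W r f = 0 -> T (Psi f) = coh_class f.
  move=> df; have dext (g : W r) : differential W r (ext h g) = 0.
    by rewrite /= /valued_diff -ext_comp //; apply: ext0 => x; exact: dh.
  have cext g : differential W r g = 0 -> coh_class (ext h g : W r) = coh_class g.
    by move=> dg; apply/esym/(coh_class_eq (C := W) (n := r) dg (dext g)); exact: hf.
  rewrite -(cext f df) -(cext (ext h f) (dext f)) -ext_comp //.
  transitivity (\sum_c T (pure (cl (delta_ffun K c)) (f c))).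
    rewrite /Psi; elim: (index_enum _) => [|c s IHs]; first by rewrite !big_nil (lin0 T_lin).
    by rewrite !big_cons -IHs -[X in T (X + _)]scale1r T_lin scale1r.
  under eq_bigr => c _ do rewrite TE.
  rewrite -coh_class_sum => [|c]; last exact: dpure.
  congr coh_class; apply/ffunP => c'; rewrite sum_ffunE ffunE; apply: eq_bigr => c _.
  by rewrite ffunE /=; congr (_ *: _); apply: (congr1 (fun g : C r => g c')); apply: h_eq; rewrite ?repd ?dh ?repE.
have F_lin : lin (fun w => Psi (repW w)).
  move=> k x y; rewrite -Psi_lin; apply: Psi_eq.
  - exact: repWd.
  - have := ext_lin d k (repW x) (repW y); have := repWd x; have := repWd y.
    rewrite /= /valued_diff => -> -> ->.
    by rewrite scaler0 addr0.
  - rewrite (coh_class_lin k (repWd x) (repWd y)).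
    by rewrite !repWE.
apply: (liso_mk F_lin) => [w Pw|].
  by have := T_Psi _ (repWd w); rewrite Pw (lin0 T_lin) repWE => ->.
elim/tensor_ind => [|k x y [x' <-] [y' <-]|u v].
- by exists 0; exact: (lin0 F_lin).
- by exists (k *: x' + y'); exact: F_lin.
exists (beta u v); have dv := dpure _ v (dz u).
pose f0 : W r := [ffun c => z u c *: v].
have df0 : differential W r f0 = 0 by exact: dv.
have bE : coh_class (repW (beta u v)) = coh_class f0 by exact: repWE.
apply: etrans (Psi_eq _ _ (repWd (beta u v)) df0 bE) _.
have clz : cl (z u) = u.
  by rewrite (clE _ (dz u)) -[RHS]repE; exact: clE (repd u).
have E : Psi f0 = pure (cl (z u)) v by exact: Psi_pure.
exact: (etrans E (congr1 (fun w => pure w v) clz)).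
Qed.
End ValuedCochains.

Lemma is_coboundary_sum (K : fieldType) (C : cochain_complex K) n (J : finType) (x : J -> C n) :
  (forall j, is_coboundary (x j)) -> is_coboundary (\sum_j x j).
Proof.
move=> bx; elim/big_ind: _ => //; first by case: (n) => [|m] //=; exists 0; rewrite raddf0.
case: (n) => [|m] u v /=; first by move=> -> ->; rewrite addr0.
by move=> [y ->] [y' ->]; exists (y + y'); rewrite raddfD.
Qed.

Lemma alternating_sum0 (K : fieldType) (U : lmodType K) q (u : U) (v : 'I_q.+1 -> U) :
  v ord0 = 0 -> u = \sum_(k < q.+1) (-1) ^+ k *: v k ->
  u = \sum_(k < q) (-1) ^+ k.+1 *: v (lift ord0 k).
Proof. by move=> v0 ->; rewrite big_ord_recl v0 scaler0 add0r; apply: eq_bigr. Qed.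

Lemma sign_scale (K : fieldType) (U : lmodType K) q k (u : U) :
  (-1) ^+ q.+1 *: ((-1) ^+ k.+1 *: u) = (-1) ^+ k *: ((-1) ^+ q *: u).
Proof. by rewrite !scalerA !exprS !mulN1r mulrNN mulrC. Qed.

(** * Columns of the double complex in a fixed degree *)

Section Columns.
Variables (R : realType) (d : nat) (S : fan R d) (K : fieldType) (a : 'rV[int]_d).
Local Notation FP := (face_poset S).
Local Notation Y q := (mono_module K (chain_data S q)).
Local Notation CM C := (cone_mono K C).
Local Notation I := (graded_maximal_ideal (S := S) (K := K)).
Local Notation TC M := (torsion_cobar I a M).
Local Notation tm f := (tmap I a a f).
Implicit Types (M N : graded_module (face_grading S K)).

Lemma tmap_coboundary M N (f : M -> N) j (x : TC M j) : gmap 0 f -> alin f ->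
  is_coboundary x -> is_coboundary (tm f x : TC N j).
Proof.
move=> gf lf; have gf' := gmap_same a gf; case: j x => [|j] x /=.
  by move=> ->; exact: (tmap_zero I gf' 0).
by move=> [y ->]; exists (tm f y); exact: (tmap_d I gf').
Qed.

Lemma tmap_cocycle M N (f : M -> N) j (x : TC M j) : gmap 0 f -> alin f ->
  differential (TC M) j x = 0 -> differential (TC N) j (tm f x) = 0.
Proof.
move=> gf lf dx; have gf' := gmap_same a gf.
by rewrite -(tmap_d I gf') // dx; exact: (tmap_zero I gf').
Qed.

Lemma tmap_sumr M N (f : M -> N) j (J : Type) (r : seq J) (x : J -> TC M j) : gmap 0 f ->
  tm f (\sum_(i <- r) x i) = \sum_(i <- r) tm f (x i).
Proof.
move=> gf; have gf' := gmap_same a gf; elim: r => [|i r IHr].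
  by rewrite !big_nil; exact: (tmap_zero I gf').
by rewrite !big_cons -IHr; exact: (tmap_additive gf').
Qed.

Lemma label_coboundary q j (x : TC (Y q.+1) j) :
  (forall c : chain FP q.+1,
     is_coboundary (tm (label_proj (val c ord0) c) x : TC (CM (val c ord0)) j)) ->
  is_coboundary x.
Proof.
move=> bx.
have -> : x = \sum_(c : chain FP q.+1) tm (@label_incl _ _ _ K (val c ord0) _ c) (tm (label_proj (val c ord0) c) x).
  transitivity (tm (fun y : Y q.+1 => \sum_(c : chain FP q.+1) label_incl c (label_proj (val c ord0) c y)) x).
    by rewrite -[LHS]tmap_id; apply: eq_tmap => y; rewrite label_sum.
  rewrite (@tmap_sum _ _ _ _ I a _ _ _ _ (fun (c : chain FP q.+1) y => label_incl c (label_proj (val c ord0) c y))) => [|c].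
    apply: eq_bigr => c _; rewrite -(tmap_comp0 _ (label_proj_gmap K _ c) (label_incl_gmap K _ c)).
    exact: eq_tmap.
  exact: (gmap_comp0 (label_proj_gmap K _ c) (label_incl_gmap K _ c)).
apply: is_coboundary_sum => c; apply: tmap_coboundary (bx c).
  exact: label_incl_gmap.
exact: label_incl_alin.
Qed.

Variables (C0 : FP) (n : nat).
Hypothesis vanish : forall C j, (C != C0) || (j != n) -> TZ I (CM C) a j.
Local Notation OI := (open_interval C0).
Local Notation V := (cohomology (TC (CM C0)) n).
Local Notation W := (@valued_complex K _ OI V).

Lemma columns_exact q j : j != n -> exact_at (TC (Y q.+1)) j.
Proof.
move=> jn x dx; apply: label_coboundary => c; apply: vanish; first by rewrite jn orbT.
by apply: tmap_cocycle dx; [exact: label_proj_gmap|exact: label_proj_alin].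
Qed.

Let gp q (c : chain FP q) := gmap_same a (@label_proj_gmap R d S K C0 q c).

(** Prepending [C0] shifts the indices of faces by one; the sign absorbs the resulting change of
    sign in the differential. *)
Definition column_class q (x : TC (Y q.+1) n) : W q :=
  [ffun c => (-1) ^+ q *: coh_class (tm (label_proj C0 (cone_label c)) x)].

Lemma cone_label_le q (c : chain OI q) : (C0 <= val (cone_label c) ord0)%O.
Proof. by rewrite cone_label_head. Qed.

Lemma label_cocycle q (c : chain FP q.+1) (x : TC (Y q.+1) n) : (C0 <= val c ord0)%O ->
  differential (TC (Y q.+1)) n x = 0 ->
  differential (TC (CM C0)) n (tm (label_proj C0 c) x) = 0.
Proof.
by move=> Cc dx; apply: tmap_cocycle dx; [exact: label_proj_gmap|exact: label_proj_alin].
Qed.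

Lemma column_class_lin q k (x y : TC (Y q.+1) n) :
  differential (TC (Y q.+1)) n x = 0 -> differential (TC (Y q.+1)) n y = 0 ->
  column_class (k *: x + y) = k *: column_class x + column_class y.
Proof.
move=> dx dy; apply/ffunP => c; rewrite !ffunE (tmap_lin I (gp _)) coh_class_lin.
- by rewrite scalerDr !scalerA mulrC.
- exact: label_cocycle (cone_label_le c) dx.
- exact: label_cocycle (cone_label_le c) dy.
Qed.

Lemma column_class_surj q (w : W q) :
  exists2 x : TC (Y q.+1) n, differential _ n x = 0 & column_class x = w.
Proof.
pose r c := sval (cid2 (coh_class_surj ((-1) ^+ q *: w c))).
have [rd rE] : (forall c, differential (TC (CM C0)) n (r c) = 0) /\
    (forall c, coh_class (r c) = (-1) ^+ q *: w c) by split=> c; rewrite /r; case: cid2.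
have gi (c : chain OI q) := @label_incl_gmap R d S K C0 q.+1 (cone_label c).
have li (c : chain OI q) : alin (@label_incl R d S K C0 q.+1 (cone_label c)).
  by move: (@label_incl_alin R d S K q (cone_label c)); rewrite cone_label_head.
have dx : differential (TC (Y q.+1)) n (\sum_c tm (@label_incl R d S K C0 q.+1 (cone_label c)) (r c)) = 0.
  by rewrite raddf_sum big1 // => c _; apply: tmap_cocycle (rd c); [exact: gi|exact: li].
exists (\sum_c tm (@label_incl R d S K C0 q.+1 (cone_label c)) (r c)) => //.
apply/ffunP => c; rewrite ffunE.
have -> : tm (label_proj C0 (cone_label c)) (\sum_c tm (@label_incl R d S K C0 q.+1 (cone_label c)) (r c)) = r c.
  transitivity (\sum_c' tm (label_proj C0 (cone_label c)) (tm (@label_incl R d S K C0 q.+1 (cone_label c')) (r c'))).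
    by apply: tmap_sumr; exact: label_proj_gmap.
  rewrite (bigD1 c) //= big1 ?addr0 => [|c' cc'].
    rewrite -(tmap_comp0 _ (gi c) (label_proj_gmap K _ _)) -[RHS]tmap_id.
    by apply: eq_tmap => y /=; rewrite label_projK // cone_label_head.
  rewrite -(tmap_comp0 _ (gi c') (label_proj_gmap K _ _)).
  apply: etrans (@tmap0 _ _ _ _ I a a (CM C0) (CM C0) n (r c')).
  apply: eq_tmap => y /=; apply: label_proj0; apply: contra cc' => /eqP E.
  by apply/eqP/esym/(cone_label_inj E).
by rewrite rE scalerA -exprMn mulrNN mulr1 expr1n scale1r.
Qed.

(** Components at chains with head different from [C0] are coboundaries by [vanish], so the chains
    with head [C0] decide. *)
Lemma column_class_eq0 q (x : TC (Y q.+1) n) : differential (TC (Y q.+1)) n x = 0 ->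
  column_class x = 0 <-> is_coboundary x.
Proof.
move=> dx; split=> [x0|bx].
  apply: label_coboundary => c.
  have dpx : differential (TC (CM (val c ord0))) n (tm (label_proj (val c ord0) c) x) = 0.
    by apply: tmap_cocycle dx; [exact: label_proj_gmap|exact: label_proj_alin].
  have [cC|cC] := eqVneq (val c ord0) C0; last by apply: vanish; rewrite ?cC.
  have [c0 c0E] := cone_label_surj cC.
  apply/(coh_class_eq0 dpx); move/ffunP/(_ c0): x0; rewrite !ffunE c0E => /eqP.
  rewrite scaler_eq0 signr_eq0 /= => /eqP.
  by rewrite cC.
apply/ffunP => c; rewrite !ffunE (_ : coh_class _ = 0) ?scaler0 //.
apply/coh_class_eq0; first exact: label_cocycle (cone_label_le c) dx.
by apply: tmap_coboundary bx; [exact: label_proj_gmap|exact/label_proj_alin/cone_label_le].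
Qed.

Lemma label_proj_diff q (c : chain FP q.+2) (y : Y q.+1) : (C0 <= val c ord0)%O ->
  label_proj C0 c (chain_diff y) =
  \sum_(k < q.+2) ((-1) ^+ k)%:A *: label_proj C0 (chain_face k c) y.
Proof.
move=> Cc; apply: lcoef_inj => l p; rewrite lcoef_label_proj lcoef_chain_diff lcoef_sum.
transitivity (\sum_(k < q.+2) if in_cone C0 p then (-1) ^+ k * lcoef (chain_face k c) p y else 0).
  case: ifP => [Cp|_]; last by rewrite big1.
  have cp := in_cone_le Cc Cp.
  by rewrite in_chain_head cp (in_cone_support cp) ffunE; apply: eq_bigr => k _; rewrite ffunE.
apply: eq_bigr => k _; rewrite mono_scaleK lcoefZ lcoef_label_proj.
by case: ifP => // _; rewrite mulr0.
Qed.

(** The projection to the ring of [C0] factors through the ring of the head of [c], whose cohomology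
    vanishes here. *)
Lemma label_class0 q (c : chain FP q.+1) (x : TC (Y q.+1) n) : (C0 < val c ord0)%O ->
  differential (TC (Y q.+1)) n x = 0 -> coh_class (tm (label_proj C0 c) x) = 0.
Proof.
move=> Cc dx; have Cc' := ltW Cc.
apply/coh_class_eq0; first exact: label_cocycle Cc' dx.
have gi := @label_incl_gmap R d S K (val c ord0) q.+1 c.
have gl C := @label_proj_gmap R d S K C q.+1 c.
have -> : tm (label_proj C0 c) x =
    tm (label_proj C0 c) (tm (@label_incl R d S K (val c ord0) q.+1 c) (tm (label_proj (val c ord0) c) x)).
  rewrite -(tmap_comp0 _ (gl _) gi) -(tmap_comp0 _ (gmap_comp0 (gl _) gi) (gl _)).
  by apply: eq_tmap => y /=; rewrite label_incl_proj.
apply: tmap_coboundary; [exact: gl|exact: label_proj_alin|].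
apply: tmap_coboundary; [exact: gi|exact: label_incl_alin|].
apply: vanish; first by rewrite gt_eqF.
by apply: tmap_cocycle dx; [exact: gl|exact: label_proj_alin].
Qed.

Lemma class_label_diff q (c : chain FP q.+2) (x : TC (Y q.+1) n) : (C0 <= val c ord0)%O ->
  differential (TC (Y q.+1)) n x = 0 ->
  coh_class (tm (label_proj C0 c) (tm (@chain_diff R d S K q.+1) x)) =
  \sum_(k < q.+2) (-1) ^+ k *: coh_class (tm (label_proj C0 (chain_face k c)) x).
Proof.
move=> Cc dx; have gl q' c' := @label_proj_gmap R d S K C0 q' c'.
have Ck k : (C0 <= val (chain_face k c) ord0)%O.
  by rewrite chain_faceE; apply: le_trans Cc (chain_head c _).
have cs (k : 'I_q.+2) := label_cocycle (Ck k) dx.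
have cZ (k : K) (z : TC (CM C0) n) : differential (TC (CM C0)) n z = 0 ->
    differential (TC (CM C0)) n (k *: z) = 0 /\ coh_class (k *: z) = k *: coh_class z.
  move=> dz; split; first by apply: etrans (linearZ_LR _ _ _) _; rewrite /= dz scaler0.
  by have := coh_class_lin k dz (raddf0 _); rewrite coh_class0 !addr0.
have -> : tm (label_proj C0 c) (tm (@chain_diff R d S K q.+1) x) =
    \sum_(k < q.+2) (-1) ^+ k *: tm (label_proj C0 (chain_face k c)) x.
  rewrite -(tmap_comp0 _ (@chain_diff_gmap R d S K q.+1) (gl _ _)).
  transitivity (tm (fun y : Y q.+1 => \sum_(k < q.+2) ((-1) ^+ k)%:A *: label_proj C0 (chain_face k c) y) x).
    by apply: eq_tmap => y; exact: label_proj_diff.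
  rewrite (@tmap_sum _ _ _ _ I a _ _ _ _ (fun (k : 'I_q.+2) y =>
    ((-1) ^+ k)%:A *: label_proj C0 (chain_face k c) y)) => [|k].
    by apply: eq_bigr => k _; exact: (tmapZ ((-1) ^+ k) x (gl _ _)).
  exact: (gmap_comp0 (gl _ _) (gmap_scale (CM C0) (deg_scalar (face_grading S K) ((-1) ^+ k)))).
rewrite coh_class_sum => [|k]; last by have [] := cZ ((-1) ^+ k) _ (cs k).
by apply: eq_bigr => k _; have [] := cZ ((-1) ^+ k) _ (cs k).
Qed.

(** Deleting the first entry [C0] leaves a larger head, and that term is 0 by [label_class0]. The
    remaining faces keep [C0] and come from faces in the open interval. *)
Lemma column_class_diff q (x : TC (Y q.+1) n) : differential (TC (Y q.+1)) n x = 0 ->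
  column_class (tm (@chain_diff R d S K q.+1) x) = differential W q (column_class x).
Proof.
move=> dx; apply/ffunP => c; rewrite ffunE [RHS]valued_diffE.
pose g k := coh_class (tm (label_proj C0 (chain_face k (cone_label c))) x).
have H0 : g ord0 = 0.
  apply: label_class0 dx; rewrite chain_faceE -{1}(cone_label_head c).
  exact: (@chain_lt _ _ _ (cone_label c)).
have S1 := @alternating_sum0 _ _ _ _ g H0 (class_label_diff (cone_label_le c) dx).
apply: etrans (congr1 (fun z => (-1) ^+ q.+1 *: z) S1) _.
rewrite scaler_sumr; apply: eq_bigr => k _.
rewrite ffunE; apply: etrans (sign_scale _ _ _) _.
by rewrite /g cone_label_face.
Qed.
End Columns.

(** * The graded pieces *)

Section TensorIso.
Variable K : fieldType.
Implicit Types U V : lmodType K.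

Lemma pure0r U V (u : U) : pure u (0 : V) = 0.
Proof. by have := pureZr 0 u (0 : V); rewrite !scale0r. Qed.

Lemma tensor_zero_l U V : (forall u : U, u = 0) -> forall x : tensor U V, x = 0.
Proof.
move=> U0; elim/tensor_ind => [//|k x y -> ->|u v]; first by rewrite scaler0 addr0.
by rewrite (U0 u) pure0l.
Qed.

Lemma tensor_zero_r U V : (forall v : V, v = 0) -> forall x : tensor U V, x = 0.
Proof.
move=> V0; elim/tensor_ind => [//|k x y -> ->|u v]; first by rewrite scaler0 addr0.
by rewrite (V0 v) pure0r.
Qed.

Lemma tensor_lisor U V V' : liso V V' -> liso (tensor U V) (tensor U V').
Proof.
have map (X X' : lmodType K) (f : X -> X') : (forall k x y, f (k *: x + y) = k *: f x + f y) ->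
    exists2 T : tensor U X -> tensor U X', forall k x y, T (k *: x + y) = k *: T x + T y &
      forall u v, T (pure u v) = pure u (f v).
  move=> lf; apply: (tensor_lift (beta := fun u v => pure u (f v))) => [k u u' v|k u v v'].
    exact: pure_linl.
  by rewrite lf pure_linr.
move=> VV'; have [g [f fK gK]] := liso_sym VV'; rewrite /= in fK gK.
have lf : forall k x y, f (k *: x + y) = k *: f x + f y.
  by move=> k x y; apply: (can_inj fK); rewrite gK linearP !gK.
have [Tf TfP TfE] := map _ _ _ lf.
have [Tg TgP TgE] := map _ _ g (linearP g).
have TfK : cancel Tf Tg.
  elim/tensor_ind => [|k x y IHx IHy|u v]; first by rewrite (lin0 TfP) (lin0 TgP).
    by rewrite TfP TgP IHx IHy.
  by rewrite TfE TgE gK.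
have TgK : cancel Tg Tf.
  elim/tensor_ind => [|k x y IHx IHy|u v]; first by rewrite (lin0 TgP) (lin0 TfP).
    by rewrite TgP TfP IHx IHy.
  by rewrite TgE TfE fK.
apply: (liso_mk TfP) => [x x0|y]; first by rewrite -[x]TfK x0 (lin0 TgP).
by exists (Tg y).
Qed.
End TensorIso.

Section DsumCollapse.
Variables (K : fieldType) (J : finType) (V : J -> lmodType K) (j0 : J).

Lemma dsum_eq0 : (forall j (x : V j), x = 0) -> forall x : dsum V, x = 0.
Proof. by move=> V0 x; apply/ffunP => j; rewrite [LHS]V0 [RHS]V0. Qed.

Lemma dsum_single : (forall j (x : V j), j != j0 -> x = 0) -> liso (dsum V) (V j0).
Proof.
move=> V0; apply: (liso_mk (f := fun x : dsum V => x j0)) => [k x y|x x0|v].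
- by rewrite [LHS]ffunE [X in X + _]ffunE.
- apply/ffunP => j; rewrite [RHS]ffunE; have [->//|jj0] := eqVneq j j0.
  exact: V0.
(* The cast places [v] at [j0] across the dependent type. *)
pose g j : V j := if pselect (j0 = j) is left e then ecast j (V j) e v else 0.
exists [ffun j => g j] => /=; rewrite ffunE /g; case: pselect => // e.
by rewrite (Prop_irrelevance e erefl).
Qed.
End DsumCollapse.

Section Main.
Variables (R : realType) (d : nat) (S : fan R d) (K : fieldType) (a : 'rV[int]_d).
Local Notation FP := (face_poset S).
Local Notation Y q := (mono_module K (chain_data S q)).
Local Notation CM C := (cone_mono K C).
Local Notation I := (graded_maximal_ideal (S := S) (K := K)).
Local Notation TC M := (torsion_cobar I a M).
Local Notation tm f := (tmap I a a f).

Lemma face_module_liso i :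
  liso (cohomology (TC (face_module S K)) i) (cohomology (TC (Y 0)) i).
Proof.
apply: (@torsion_cobar_liso _ _ _ _ I _ _ (@face_to_mono R d S K) (@mono_to_face R d S K)).
- exact: face_to_mono_alin.
- exact: can_alin (@face_to_mono_alin R d S K) (@face_to_monoK R d S K) (@mono_to_faceK R d S K).
- exact: face_to_mono_gmap.
- exact: mono_to_face_gmap.
- exact: face_to_monoK.
- exact: mono_to_faceK.
Qed.

(** [C0] is the cone with [- a] in its interior. If there is none, everything vanishes in degree [a]
    and any cone will do; the zero cone is taken. *)
Lemma support_face : exists C0 : FP, forall (C : FP) j,
  (C != C0) || (j != cone_dim (val C0)) -> TZ I (CM C) a j.
Proof.
have [[C0 C0a]|nC] := pselect (exists C : FP, cint C (- real_point R a)).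
  exists C0 => C j H; apply: cone_mono_TZ.
  have [Ca|] := pselect (cint C (- real_point R a)); last by left.
  move: H; rewrite (cint_uniq Ca C0a) eqxx /= => /eqP; by right.
have [Z _] := zero_cone S; exists Z => C j _; apply: cone_mono_TZ; left=> Ca.
by apply: nC; exists C.
Qed.

Variable C0 : FP.
Local Notation n := (cone_dim (val C0)).
Hypothesis vanish : forall (C : FP) j, (C != C0) || (j != n) -> TZ I (CM C) a j.
Local Notation W := (@valued_complex K _ (open_interval C0) (cohomology (TC (CM C0)) n)).

Let cg q := @chain_diff_gmap R d S K q.
Let cg' q := gmap_same a (cg q).
Let ca q := @chain_diff_alin R d S K q.

Let tm_lin q p k (x y : TC (Y q) p) :
  tm (@chain_diff R d S K q) (k *: x + y) = k *: tm (@chain_diff R d S K q) x + tm (@chain_diff R d S K q) y.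
Proof. exact: (tmap_lin I (cg' q)). Qed.

Let tm_d q p (x : TC (Y q) p) : tm (@chain_diff R d S K q) (differential (TC (Y q)) p x) =
  differential (TC (Y q.+1)) p (tm (@chain_diff R d S K q) x).
Proof. exact: (tmap_d I (cg' q) _ (@ca q)). Qed.

Let tm_inj p (x : TC (Y 0) p) : tm (@chain_diff R d S K 0) x = 0 -> x = 0.
Proof. apply: (tmap_inj (cg 0)); exact: chain_diff_inj. Qed.

Let tm_tm q p (x : TC (Y q) p) :
  tm (@chain_diff R d S K q.+1) (tm (@chain_diff R d S K q) x) = 0.
Proof.
rewrite -(tmap_comp0 _ (cg q) (cg q.+1)).
apply: etrans (@tmap0 _ _ _ _ I a a (Y q) (Y q.+2) p x); apply: eq_tmap => y.
exact: chain_diffK.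
Qed.

Let tm_ex q p (x : TC (Y q.+1) p) : tm (@chain_diff R d S K q.+1) x = 0 ->
  exists y : TC (Y q) p, x = tm (@chain_diff R d S K q) y.
Proof. apply: (tmap_exact (cg q) (cg q.+1)); exact: chain_diff_exact. Qed.

Lemma face_cohomology_low i : (i < n)%N -> exact_at (TC (Y 0)) i.
Proof.
exact: (@double_complex_low K (TC (Y 0)) (fun q => TC (Y q.+1))
  (fun p => @tmap _ _ _ _ I a a _ _ (@chain_diff R d S K 0) p)
  (fun q p => @tmap _ _ _ _ I a a _ _ (@chain_diff R d S K q.+1) p)
  (tm_lin (q := 0)) (fun q => tm_lin (q := q.+1)) (tm_d (q := 0)) (fun q => tm_d (q := q.+1))
  tm_inj (tm_tm (q := 0)) (fun q => tm_tm (q := q.+1))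
  (tm_ex (q := 0)) (fun q => tm_ex (q := q.+1)) n (columns_exact vanish)).
Qed.

(** Column [q] belongs to chains of [q + 1] cones; those with head [C0] are chains of [q] cones in
    the open interval, which matches the degree [q] of [W]. *)
Lemma face_cohomology r : liso (cohomology (TC (Y 0)) (r + n)) (cohomology W r).
Proof.
exact: (@double_complex_iso K (TC (Y 0)) W (fun q => TC (Y q.+1))
  (fun p => @tmap _ _ _ _ I a a _ _ (@chain_diff R d S K 0) p)
  (fun q p => @tmap _ _ _ _ I a a _ _ (@chain_diff R d S K q.+1) p)
  (tm_lin (q := 0)) (fun q => tm_lin (q := q.+1)) (tm_d (q := 0)) (fun q => tm_d (q := q.+1))
  tm_inj (tm_tm (q := 0)) (fun q => tm_tm (q := q.+1))
  (tm_ex (q := 0)) (fun q => tm_ex (q := q.+1)) n (columns_exact vanish)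
  (@column_class R d S K a C0 n) (@column_class_lin R d S K a C0 n)
  (@column_class_surj R d S K a C0 n)
  (@column_class_eq0 R d S K a C0 n vanish) (@column_class_diff R d S K a C0 n vanish) r).
Qed.
End Main.

Theorem theorem1p3 (R : realType) (d : nat) (Sigma : fan R d) (K : fieldType)
    (E : injective_resolution (face_module Sigma K))
    (F : forall C : face_poset Sigma, injective_resolution (cone_module C K))
    (i : nat) :
  let m := graded_maximal_ideal (S := Sigma) (K := K) in
  graded_iso
    (fun a : 'rV[int]_d => local_cohomology m E i a)
    (fun a : 'rV[int]_d =>
       dsum (fun C : face_poset Sigma =>
         tensor
           (reduced_cohomology K (open_interval C)
              (i%:Z - (cone_dim (val C))%:Z - 1))
           (local_cohomology m (F C) (cone_dim (val C)) a))).
Proof.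
move=> m a; have [C0 vanish] := support_face Sigma K a.
pose T C : lmodType K := tensor
  (reduced_cohomology K (open_interval C) (i%:Z - (cone_dim (val C))%:Z - 1))
  (local_cohomology m (F C) (cone_dim (val C)) a).
have cone_liso C : liso (local_cohomology m (F C) (cone_dim (val C)) a)
    (cohomology (torsion_cobar m a (cone_mono K C)) (cone_dim (val C))).
  exact: liso_trans (local_cohomology_cobar m (F C) a _) (cone_module_liso K C a _).
have face_liso : liso (local_cohomology m E i a)
    (cohomology (torsion_cobar m a (mono_module K (chain_data Sigma 0))) i).
  exact: liso_trans (local_cohomology_cobar m E a i) (face_module_liso Sigma K a i).
have T0 C (x : T C) : C != C0 -> x = 0.
  move=> CC0; apply: tensor_zero_r => v; have [f [g fK gK]] := cone_liso C.
  have /coh_eq0 z : exact_at (torsion_cobar m a (cone_mono K C)) (cone_dim (val C)).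
    by apply: vanish; rewrite CC0.
  by rewrite -[v]fK (z (f v)) -(raddf0 f) fK.
have [ni|ni] := leqP (cone_dim (val C0)) i; last first.
  apply: (liso_trans face_liso); apply: liso0.
    exact/coh_eq0/(face_cohomology_low vanish ni).
  apply: dsum_eq0 => C x; have [CC0|] := eqVneq C C0; last exact: T0.
  (* Here [i] is less than the dimension of [C0], so the reduced degree is below -1 and its
     cohomology is the zero space by definition. *)
  subst C; apply: tensor_zero_l => u; move: u; rewrite /reduced_cohomology.
  case e : (_ + 1) => [k|k] u; first by lia.
  by apply/rowP => -[].
apply: (liso_trans face_liso).
apply: liso_trans (liso_sym (dsum_single T0)).
rewrite -(subnK ni); apply: (liso_trans (face_cohomology vanish _)).
apply: (liso_trans (tensor_cohomology _ _ _)); rewrite /T.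
(* Cochains of degree [k - 1] sit at place [k] of [order_complex], which absorbs the -1. *)
have -> : reduced_cohomology K (open_interval C0) (i%:Z - (cone_dim (val C0))%:Z - 1) =
    cohomology (order_complex K (open_interval C0)) (i - cone_dim (val C0)).
  rewrite /reduced_cohomology; suff -> : i%:Z - (cone_dim (val C0))%:Z - 1 + 1 =
    Posz (i - cone_dim (val C0)) by [].
  by lia.
exact/tensor_lisor/liso_sym/cone_liso.
Qed.
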